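(* Let $f\in L^q(\Omega;H)$ and $g\in L^q(\Omega;L^2(\Gamma_2))$ for some $q\in[1,+\infty)$. For a given number $t\in(1,+\infty)$ define the dual number $n:=\frac{t}{t-1}$. Let $K>0$ and $A>0$ be fixed cut-off levels and let $u_K$, $u_{K,A}$ be the pathwise weak solutions of the elliptic problem with coefficient $a_K$ and $a_{K,A}$, respectively, as described in the context. Then for any $r\in[1,q/n)$ it holds $$\|u_K-u_{K,A}\|_{L^r(\Omega;V)}\le C(\mathcal D,\overline a_-,r)\,\big(\|f\|_{L^q(\Omega;H)}+\|g\|_{L^q(\Omega;L^2(\Gamma_2))}\big)\,\mathbb E\Big(\operatorname*{ess\,sup}_{\underline x\in\mathcal D}|a_K(\underline x)-a_{K,A}(\underline x)|^{rt}\Big)^{\frac1{rt}},$$ where $C(\mathcal D,\overline a_-,r)$ is a constant depending on the indicated parameters $\mathcal D$, $\overline a_-$ and $r$.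
   Context: $(\Omega,\mathcal F,\mathbb P)$ is a complete probability space, $0<D<+\infty$, $\mathcal D=(0,D)^2$, $H=L^2(\mathcal D)$. $\partial\mathcal D=\Gamma_1\cup\Gamma_2$ is a disjoint decomposition into two $1$-dimensional manifolds such that the exterior normal derivative on $\Gamma_2$ is well-defined for every $u\in C^1(\overline{\mathcal D})$. $T$ is the trace operator on $H^1(\mathcal D)$, $V=\{v\in H^1(\mathcal D):Tv|_{\Gamma_1}=0\}$, $\|v\|_V=\|v\|_{H^1(\mathcal D)}=\big(\int_{\mathcal D}|v|^2+\|\nabla v\|_2^2\,d\underline x\big)^{1/2}$. $L^p(\Omega;B)$ denotes the Bochner space with norm $\mathbb E(\|\cdot\|_B^p)^{1/p}$. With $\chi_B(z)=\min(z,B)$ for $z\ge0$, $B>0$, the coefficients are $$a_K(\omega,x,y)=\overline a(x,y)+\Phi_1(W_1(x,y))+\Phi_2\big(W_2(\chi_K(l_1(x)),\chi_K(l_2(y)))\big),\qquad a_{K,A}=\chi_A(a_K).$$ For $h\in\{a_K,a_{K,A}\}$ the pathwise weak solution is the unique $u(\omega,\cdot)\in V$ with $\int_{\mathcal D}h\,\nabla u\cdot\nabla v\,d\underline x=\int_{\mathcal D}fv\,d\underline x+\int_{\Gamma_2}g\,[Tv]\,d\underline x$ for all $v\in V$, i.e. the weak solution of $-\nabla\cdot(h\nabla u)=f$ in $\mathcal D$ with $u=0$ on $\Gamma_1$ and $h\,\vec n\cdot\nabla u=g$ on $\Gamma_2$. Standing assumptions on the coefficient data: (i) $W_1$, $W_2$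 are stochastically independent zero-mean Gaussian random fields on $[0,D]^2$ and $[0,K]^2$ with $\mathbb P$-a.s. continuous paths. With covariance functions $q_1,q_2$, covariance operators $Q_j\phi=\int_{[0,z_j]^2}q_j(\cdot,(x',y'))\phi(x',y')\,d(x',y')$ ($z=(D,K)$) and eigenpairs $(\lambda_i^{(j)},e_i^{(j)},\ i\in\mathbb N)$, where $(e_i^{(j)})_i$ is an orthonormal basis of $L^2([0,z_j]^2)$, the eigenfunctions are continuously differentiable and there are $\alpha,\beta,C_e,C_\lambda>0$ with $\|e_i^{(j)}\|_{L^\infty([0,z_j]^2)}\le C_e$, $\|\nabla e_i^{(j)}\|_{L^\infty([0,z_j]^2)}\le C_e i^\alpha$ for all $i\in\mathbb N$, $j=1,2$, and $\sum_{i=1}^\infty(\lambda_i^{(1)}+\lambda_i^{(2)})i^\beta\le C_\lambda<\infty$. (ii) $\Phi_1,\Phi_2:\mathbb R\to[0,+\infty)$ are continuous, $\Phi_1\in C^1(\mathbb R)$, $|\Phi_1'(x)|\le\phi\exp(\psi|x|)$ and $|\Phi_2(x)-\Phi_2(y)|\le C_{lip}|x-y|$ for $x,y\in\mathbb R$, with constants $\phi,\psi,C_{lip}>0$. (iii) $\overline a:\mathcal D\to(0,+\infty)$ is deterministic, continuous, and $\overline a_-\le\overline a(x,y)\le\overline a_+$ for $(x,y)\in\mathcal D$ with constants $\overline a_+,\overline a_->0$. (iv) $l_1,l_2$ are Lévy subordinators on $[0,D]$ ($\mathbb P$-a.s. non-decreasing real-valued Lévy processes) with Lévy triplets $(\gamma_1,0,\nu_1)$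 and $(\gamma_2,0,\nu_2)$, independent of $W_1$ and $W_2$.
   Formalization: The constant is C(D, min(a̅₋, A), r) instead of C(D, a̅₋, r): the same when A ≥ a̅₋. For A < a̅₋ no constant independent of A works: with a̅ = 1, Φ₁ = Φ₂ = 0, A < 1 one has u_{K,A} = u_K/A, which forces C ≥ c/A. *)

(* Defs.v *)
From HB Require Import structures.
From mathcomp Require Import all_boot all_order all_algebra.
From mathcomp Require Import all_classical all_reals all_analysis.
Set Implicit Arguments.
Unset Strict Implicit.
Unset Printing Implicit Defensive.
Import Order.TTheory GRing.Theory Num.Theory.
Import numFieldNormedType.Exports.
Local Open Scope classical_set_scope.
Local Open Scope ring_scope.

Section square.
Context {R : realType}.
Implicit Types (D : R) (p : R * R).

Definition leb2 :
    {measure set (measurableTypeR R * measurableTypeR R) -> \bar R} :=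
  (@lebesgue_measure R \x @lebesgue_measure R)%E.

Definition osquare D : set (R * R) := `]0, D[%classic `*` `]0, D[%classic.
Definition csquare D : set (R * R) := `[0, D]%classic `*` `[0, D]%classic.
Definition bsquare D : set (R * R) := csquare D `\` osquare D.

(* The four closed sides, each parametrised by arc length over [0, D]. *)
Definition side D (k : nat) (t : R) : R * R :=
  match k with
  | 0%N => (t, 0)
  | 1%N => (t, D)
  | 2%N => (0, t)
  | _ => (D, t)
  end.

Section side_measure.
Variables (D : R) (k : nat).

Lemma measurable_side :
  measurable_fun [set: measurableTypeR R]
    (side D k : measurableTypeR R -> measurableTypeR R * measurableTypeR R).
Proof.
by case: k => [|[|[|j]]]; apply/measurable_fun_pairP; split => //=;
  try exact: measurable_id; exact: (@measurable_cst _ _ (measurableTypeR R)).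
Qed.

Definition lebesgue_side : {measure set (measurableTypeR R) -> \bar R} :=
  mrestr (@lebesgue_measure R) (measurable_itv `[0, D]).

Definition side_measure :
    set (measurableTypeR R * measurableTypeR R) -> \bar R :=
  pushforward lebesgue_side (side D k).

Let side_measure0 : side_measure set0 = 0%E.
Proof. by rewrite /side_measure /pushforward preimage_set0 measure0. Qed.

Let side_measure_ge0 A : (0 <= side_measure A)%E.
Proof. by rewrite /side_measure /pushforward measure_ge0. Qed.

Let side_measure_sigma_additive : semi_sigma_additive side_measure.
Proof.
exact: (@measure_semi_sigma_additive _ _ _
  (measure_function_pushforward__canonical__measure_function_Measure lebesgue_side measurable_side)).
Qed.

HB.instance Definition _ := isMeasure.Build _ _ _ side_measure
  side_measure0 side_measure_ge0 side_measure_sigma_additive.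

End side_measure.

(* Surface measure on the boundary: the sides overlap only in the corners. *)
Definition surf D :
    {measure set (measurableTypeR R * measurableTypeR R) -> \bar R} :=
  msum (fun k => side_measure D k) 4.

End square.

Section function_spaces.
Context {R : realType}.
Implicit Types (D : R) (A : set (R * R)) (phi : R * R -> R).

(* Functions are only relevant on A: they are extended by 0 outside A. *)
Definition Lnorm_on
    (mu : {measure set (measurableTypeR R * measurableTypeR R) -> \bar R})
    A (p : \bar R) phi : \bar R := Lnorm mu p (EFin \o (phi \_ A)).

Definition L2_on
    (mu : {measure set (measurableTypeR R * measurableTypeR R) -> \bar R})
    A phi : Prop := phi \_ A \in Lfun mu 2%:E.

(* Coordinate directions of the plane: [false] is x, [true] is y. *)
Definition dir (b : bool) : R * R := if b then (0, 1) else (1, 0).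

Fixpoint iter_partial (s : seq bool) phi : R * R -> R :=
  if s is b :: s' then 'D_(dir b) (iter_partial s' phi) else phi.

Definition smooth phi : Prop := forall s : seq bool,
  continuous (iter_partial s phi) /\
  forall b x, derivable (iter_partial s phi) x (dir b).

Definition test_function D phi : Prop :=
  [/\ smooth phi, compact (closure [set x | phi x != 0])
    & closure [set x | phi x != 0] `<=` osquare D].

(* A Sobolev function is carried together with its weak gradient (which it
   determines almost everywhere): [u.1] is the function, [u.2 b] its weak
   derivative in direction [dir b]. *)
Definition sobolev : Type := ((R * R -> R) * (bool -> R * R -> R))%type.

Definition H1 D (u : sobolev) : Prop :=
  [/\ L2_on leb2 (osquare D) u.1,
      forall b, L2_on leb2 (osquare D) (u.2 b)
    & forall b phi, test_function D phi ->
        \int[leb2]_(x in osquare D) (u.1 x * 'D_(dir b) phi x) =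
        - \int[leb2]_(x in osquare D) (u.2 b x * phi x)].

Definition H1norm D (u : sobolev) : \bar R :=
  ((\int[leb2]_(x in osquare D)
      (u.1 x ^+ 2 + \sum_(b : bool) u.2 b x ^+ 2)%:E) `^ 2^-1)%E.

Definition classical_jet phi : sobolev := (phi, fun b => 'D_(dir b) phi).

(* The trace operator is the continuous extension to H^1 of the restriction
   to the boundary of functions that are smooth up to the boundary. *)
Definition is_trace D (u : sobolev) (tau : R * R -> R) : Prop :=
  L2_on (surf D) (bsquare D) tau /\
  exists phi : nat -> R * R -> R,
    [/\ forall n, smooth (phi n),
        (fun n => H1norm D (classical_jet (phi n) - u)) @ \oo --> 0%E
      & (fun n => Lnorm_on (surf D) (bsquare D) 2%:E (phi n - tau))
          @ \oo --> 0%E].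

Definition trace D (u : sobolev) : R * R -> R :=
  xget (fun=> 0) [set tau | is_trace D u tau].

Definition Vspace D (Gamma1 : set (R * R)) (u : sobolev) : Prop :=
  [/\ H1 D u, is_trace D u (trace D u)
    & {ae surf D, forall x, Gamma1 x -> trace D u x = 0}].

Definition weak_solution D (Gamma1 Gamma2 : set (R * R)) (h f g : R * R -> R)
    (u : sobolev) : Prop :=
  Vspace D Gamma1 u /\
  forall v, Vspace D Gamma1 v ->
    \int[leb2]_(x in osquare D) (h x * \sum_(b : bool) u.2 b x * v.2 b x) =
    \int[leb2]_(x in osquare D) (f x * v.1 x) +
    \int[surf D]_(x in Gamma2) (g x * trace D v x).

End function_spaces.

Section boundary.
Context {R : realType}.

Definition homeomorphic_on {X Y : topologicalType} (A : set X) (B : set Y) :=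
  exists (f : X -> Y) (g : Y -> X),
    [/\ {within A, continuous f} /\ {within B, continuous g},
        f @` A `<=` B, g @` B `<=` A,
        {in A, cancel f g} & {in B, cancel g f}].

(* One-dimensional topological manifold, possibly with boundary points. *)
Definition one_manifold (M : set (R * R)) : Prop :=
  forall p, M p -> exists U : set (R * R), [/\ open U, U p
    & homeomorphic_on (M `&` U) [set: R] \/
      homeomorphic_on (M `&` U) `[(0 : R), +oo[%classic].

(* For the convex set (0,D)^2: unit vectors orthogonal to a supporting line
   at p and pointing outwards. *)
Definition exterior_normal (D : R) (p n : R * R) : Prop :=
  n.1 ^+ 2 + n.2 ^+ 2 = 1 /\
  forall y, osquare D y -> (y.1 - p.1) * n.1 + (y.2 - p.2) * n.2 <= 0.

Definition boundary_decomposition (D : R) (Gamma1 Gamma2 : set (R * R)) :=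
  [/\ Gamma1 `|` Gamma2 = bsquare D, Gamma1 `&` Gamma2 = set0,
      one_manifold Gamma1 /\ Gamma1 !=set0, one_manifold Gamma2
    & forall p, Gamma2 p -> exists! n, exterior_normal D p n].

End boundary.

Section bochner.
Context d (Omega : measurableType d) (R : realType) (P : probability Omega R).
Variables (E : zmodType) (mem : set E) (N : E -> \bar R).

Definition strongly_measurable (F : Omega -> E) : Prop :=
  exists s : nat -> Omega -> E,
    [/\ forall n, finite_set (range (s n)),
        forall n v, measurable (s n @^-1` [set v]),
        forall n w, mem (s n w)
      & {ae P, forall w, (fun n => N (s n w - F w)) @ \oo --> 0%E}].

Definition bochner_norm (q : R) (F : Omega -> E) : \bar R :=
  ((\int[P]_w (N (F w) `^ q)) `^ q^-1)%E.

Definition bochner (q : R) (F : Omega -> E) : Prop :=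
  [/\ {ae P, forall w, mem (F w)}, strongly_measurable F
    & (bochner_norm q F < +oo)%E].

End bochner.

Section random.
Context d (Omega : measurableType d) (R : realType) (P : probability Omega R).

Definition sigma_rv (X : set (Omega -> R)) : set (set Omega) :=
  <<s [set A | exists2 f, X f &
        exists2 B : set (measurableTypeR R), measurable B & A = f @^-1` B] >>.

Definition indep_rv (X Y : set (Omega -> R)) : Prop :=
  forall A B, sigma_rv X A -> sigma_rv Y B -> P (A `&` B) = (P A * P B)%E.

(* Point masses are admitted as degenerate normal laws. *)
Definition gaussian_rv (X : Omega -> R) : Prop :=
  measurable_fun [set: Omega] (X : Omega -> measurableTypeR R) /\
  exists m s : R, forall B : set (measurableTypeR R), measurable B ->
    P (X @^-1` B) = if s == 0 then \d_m B else normal_prob m s B.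

Definition gaussian_field (S : set (R * R)) (W : R * R -> Omega -> R) : Prop :=
  forall n (p : 'I_n -> R * R) (c : 'I_n -> R), (forall i, S (p i)) ->
    gaussian_rv (fun w => \sum_(i < n) c i * W (p i) w).

Definition cov_operator (z : R) (W : R * R -> Omega -> R)
    (phi : R * R -> R) (x : R * R) : R :=
  \int[leb2]_(y in csquare z) (fine (covariance P (W x) (W y)) * phi y).

Definition inner_on (A : set (R * R)) (phi psi : R * R -> R) : R :=
  \int[leb2]_(x in A) (phi x * psi x).

Definition orthonormal_basis (A : set (R * R)) (e : nat -> R * R -> R) :=
  [/\ forall i, L2_on leb2 A (e i),
      forall i j, inner_on A (e i) (e j) = (i == j)%:R
    & forall phi, L2_on leb2 A phi ->
        (fun n => Lnorm_on leb2 A 2%:E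
           (phi - \sum_(i < n) (fun x => inner_on A phi (e i) * e i x)))
          @ \oo --> 0%E].

Definition C1_csquare (z : R) (phi : R * R -> R) : Prop :=
  {within csquare z, continuous phi} /\
  forall b, exists2 dphi : R * R -> R, {within csquare z, continuous dphi} &
    forall x, osquare z x ->
      derivable phi x (dir b) /\ 'D_(dir b) phi x = dphi x.

Definition grad_norm (phi : R * R -> R) (x : R * R) : R :=
  Num.sqrt (\sum_(b : bool) 'D_(dir b) phi x ^+ 2).

(* Eigenpairs are indexed from 0 here, whence the i.+1 in place of i. *)
Definition field_spec (z alpha Ce : R) (W : R * R -> Omega -> R)
    (lam : nat -> R) (e : nat -> R * R -> R) : Prop :=
  [/\ gaussian_field (csquare z) W,
      forall x, csquare z x -> ('E_P[W x] = 0)%E,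
      {ae P, forall w, {within csquare z, continuous (fun x => W x w)}},
      orthonormal_basis (csquare z) e /\
      forall i, {ae leb2, forall x, csquare z x ->
        cov_operator z W (e i) x = lam i * e i x}
    & forall i, [/\ C1_csquare z (e i),
        (Lnorm_on leb2 (csquare z) +oo (e i) <= Ce%:E)%E
      & (Lnorm_on leb2 (osquare z) +oo (grad_norm (e i)) <=
         (Ce * i.+1%:R `^ alpha)%:E)%E]].

Definition independent_increments (D : R) (l : R -> Omega -> R) : Prop :=
  forall n (t : nat -> R) (B : nat -> set (measurableTypeR R)),
    (forall i, (i <= n)%N -> 0 <= t i <= D) ->
    (forall i, (i < n)%N -> t i <= t i.+1) ->
    (forall i, measurable (B i)) ->
    fine (P [set w | forall i, (i < n)%N -> B i (l (t i.+1) w - l (t i) w)]) =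
    \prod_(i < n) fine (P [set w | B i (l (t i.+1) w - l (t i) w)]).

Definition stationary_increments (D : R) (l : R -> Omega -> R) : Prop :=
  forall s h (B : set (measurableTypeR R)),
    0 <= s -> 0 <= h -> s + h <= D -> measurable B ->
    P [set w | B (l (s + h) w - l s w)] = P [set w | B (l h w)].

Definition stochastically_continuous (D : R) (l : R -> Omega -> R) : Prop :=
  forall t eps, 0 <= t <= D -> 0 < eps ->
    (fun s => P [set w | eps <= `|l s w - l t w|])
      @ within `[0, D] (nbhs t) --> 0%E.

Definition levy_process (D : R) (l : R -> Omega -> R) : Prop :=
  [/\ forall t, 0 <= t <= D ->
        measurable_fun [set: Omega] (l t : Omega -> measurableTypeR R),
      {ae P, forall w, l 0 w = 0},
      independent_increments D l, stationary_increments D l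
    & stochastically_continuous D l].

Definition levy_measure (nu : {measure set (measurableTypeR R) -> \bar R}) :=
  nu [set 0] = 0%E /\
  (\int[nu]_y (Num.min 1 (y ^+ 2))%:E < +oo)%E.

(* Real and imaginary part of the Levy-Khinchine exponent
   i gamma xi - b xi^2 / 2 + int (e^{i xi y} - 1 - i xi y 1_{|y| <= 1}) nu(dy) *)
Definition levy_re (b : R) (nu : {measure set (measurableTypeR R) -> \bar R})
    (xi : R) : R :=
  - (b * xi ^+ 2 / 2) + \int[nu]_y (cos (xi * y) - 1).
Definition levy_im (gamma : R)
    (nu : {measure set (measurableTypeR R) -> \bar R}) (xi : R) : R :=
  gamma * xi + \int[nu]_y (sin (xi * y) - xi * y * \1_`[-1, 1]%classic y).

(* E exp(i xi l(t)) = exp(t (levy_re + i levy_im)), split into real and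
   imaginary parts. *)
Definition levy_triplet (D : R) (l : R -> Omega -> R) (gamma b : R)
    (nu : {measure set (measurableTypeR R) -> \bar R}) : Prop :=
  levy_measure nu /\
  forall t xi, 0 <= t <= D ->
    'E_P[fun w => cos (xi * l t w)]%E =
      (expR (t * levy_re b nu xi) * cos (t * levy_im gamma nu xi))%:E /\
    'E_P[fun w => sin (xi * l t w)]%E =
      (expR (t * levy_re b nu xi) * sin (t * levy_im gamma nu xi))%:E.

Definition levy_subordinator (D : R) (l : R -> Omega -> R) : Prop :=
  levy_process D l /\
  {ae P, forall w, forall s t, 0 <= s -> s <= t -> t <= D -> l s w <= l t w}.

Definition chi (B z : R) : R := Num.min z B.

Definition a_K (abar : R * R -> R) (Phi1 Phi2 : R -> R)
    (W1 W2 : R * R -> Omega -> R) (l1 l2 : R -> Omega -> R) (K : R)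
    (w : Omega) (x : R * R) : R :=
  abar x + Phi1 (W1 x w) + Phi2 (W2 (chi K (l1 x.1 w), chi K (l2 x.2 w)) w).

(* If a_K >= am > 0 then a_KA >= chi A am, which equals am when am <= A. *)
Definition a_KA (abar : R * R -> R) (Phi1 Phi2 : R -> R)
    (W1 W2 : R * R -> Omega -> R) (l1 l2 : R -> Omega -> R) (K A : R)
    (w : Omega) (x : R * R) : R :=
  chi A (a_K abar Phi1 Phi2 W1 W2 l1 l2 K w x).

Definition fields_assumption (D K : R) (W1 W2 : R * R -> Omega -> R) : Prop :=
  exists (alpha beta Ce Clam : R) (lam1 lam2 : nat -> R)
         (e1 e2 : nat -> R * R -> R),
    [/\ [/\ 0 < alpha, 0 < beta, 0 < Ce & 0 < Clam],
        indep_rv (W1 @` csquare D) (W2 @` csquare K),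
        field_spec D alpha Ce W1 lam1 e1,
        field_spec K alpha Ce W2 lam2 e2
      & (\sum_(0 <= i <oo) ((lam1 i + lam2 i) * i.+1%:R `^ beta)%:E
           <= Clam%:E)%E].

Definition Phi_assumption (Phi1 Phi2 : R -> R) : Prop :=
  exists ph psi Clip : R,
    [/\ [/\ 0 < ph, 0 < psi & 0 < Clip],
        [/\ forall x, 0 <= Phi1 x, forall x, 0 <= Phi2 x,
            continuous Phi1 & continuous Phi2],
        (forall x, derivable Phi1 x 1) /\ continuous (derive1 Phi1),
        forall x, `|derive1 Phi1 x| <= ph * expR (psi * `|x|)
      & forall x y, `|Phi2 x - Phi2 y| <= Clip * `|x - y|].

Definition abar_assumption (D : R) (abar : R * R -> R) (am ap : R) : Prop :=
  [/\ 0 < am, 0 < ap, {within osquare D, continuous abar}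
    & forall x, osquare D x -> am <= abar x <= ap].

Definition levy_assumption (D K : R) (W1 W2 : R * R -> Omega -> R)
    (l1 l2 : R -> Omega -> R) (gamma1 gamma2 : R)
    (nu1 nu2 : {measure set (measurableTypeR R) -> \bar R}) : Prop :=
  [/\ levy_subordinator D l1, levy_subordinator D l2,
      levy_triplet D l1 gamma1 0 nu1, levy_triplet D l2 gamma2 0 nu2
    & indep_rv (l1 @` `[0, D] `|` l2 @` `[0, D])
               (W1 @` csquare D `|` W2 @` csquare K)].

End random.

(* Main.v *)
Require Import Defs.
From HB Require Import structures.
From mathcomp Require Import all_boot all_order all_algebra.
From mathcomp Require Import all_classical all_reals all_analysis.
From mathcomp Require Import measurable_realfun ess_sup_inf ring lra.
Import Order.TTheory GRing.Theory Num.Theory.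
Import numFieldNormedType.Exports.
Local Open Scope classical_set_scope.
Local Open Scope ring_scope.

(* Pathwise, write a and b for the two coefficients, u and v for the solutions,
   w = u - v and X = ess sup |a - b|.  Testing both equations with w gives
     int b |grad w|^2 = int (b - a) grad u . grad w,
   so m |grad w| <= X |grad u| with m a lower bound of a and b, while testing the
   first equation with u bounds |grad u| by the data.  This needs the trace
   inequality and a Poincare inequality for functions with vanishing trace on
   Gamma1; both reduce to the fundamental theorem of calculus along lines for
   smooth functions and pass to the limit.  The Poincare inequality uses that a
   nonempty 1-manifold Gamma1 contains a nondegenerate arc, whose projection to
   one of the axes contains an interval.

   The expectation is then split by Hoelder's inequality with exponents t and n.
   This requires X to be a random variable: the subordinators have countably many
   jumps, so that a and b are continuous at almost every point of the square and
   {X > c} is a countable combination of events depending on rational points. *)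
Set Implicit Arguments.
Unset Strict Implicit.
Unset Printing Implicit Defensive.

(** Sobolev functions have no pointwise values and [trace] is an arbitrary representative, so
    estimates are proved for C1 functions on the plane and carried over by the smooth approximants
    of [is_trace]. Squared norms in the extended reals are kept until the end: they add up over
    sides and directions, and the approximation enters as an additive error e that tends to 0. That
    u - v lies in V, which is needed to test with it, already rests on the trace inequality, since
    representatives of a trace agree only up to surface null sets.

    The constant is pathwise, with m = [chi A am]: truncation at A may lower the bound am, and
    min(am, A) bounds both coefficients from below. Their upper bound M varies with the path; it
    gives integrability and enters no constant.

    The solutions are given path by path, so the V-norm of their difference is not known to be a
    random variable; measurability is established for the right-hand side only. The gap between r n
    and q is spent on raising the exponent of the data norm, which on a probability space is again
    Hoelder's inequality. *)

(* [s] is the coordinate along [dir b], [t] the transverse one. *)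
Definition pt {R : realType} (b : bool) (s t : R) : R * R :=
  if b then (t, s) else (s, t).

(** * Square integrals *)

Section square_sum.
Context d (T : measurableType d) (R : realType).
Variable mu : {measure set T -> \bar R}.
Implicit Types F G : T -> R.

Definition sqint F : \bar R := (\int[mu]_x (F x ^+ 2)%:E)%E.

Lemma sqint_ge0 F : (0 <= sqint F)%E.
Proof. by apply: integral_ge0 => x _; rewrite lee_fin sqr_ge0. Qed.

Lemma measurable_sqr_EFin F : measurable_fun setT F ->
  measurable_fun setT (EFin \o (fun x => F x ^+ 2)).
Proof.
by move=> mF; apply/measurable_EFinP; exact: measurable_funX.
Qed.

(** Stands in for the triangle inequality without square roots; it is (F - G)^2 >= 0 integrated. Its
    factor 2 reappears in the constants below. *)
Lemma sqintD F G : measurable_fun setT F -> measurable_fun setT G ->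
  (sqint (F \+ G)%R <= 2%:E * sqint F + 2%:E * sqint G)%E.
Proof.
move=> mF mG; rewrite /sqint -!ge0_integralZl//; last 4 first.
- exact: measurable_sqr_EFin.
- by move=> x _; rewrite lee_fin sqr_ge0.
- exact: measurable_sqr_EFin.
- by move=> x _; rewrite lee_fin sqr_ge0.
rewrite -ge0_integralD//; first last.
- by apply: measurable_funeM; exact: measurable_sqr_EFin.
- by move=> x _; rewrite -EFinM lee_fin mulr_ge0 ?sqr_ge0.
- by apply: measurable_funeM; exact: measurable_sqr_EFin.
- by move=> x _; rewrite -EFinM lee_fin mulr_ge0 ?sqr_ge0.
apply: ge0_le_integral => //.
- by move=> x _; rewrite lee_fin sqr_ge0.
- by apply: measurable_sqr_EFin; exact: measurable_funD.
- apply: emeasurable_funD; apply: measurable_funeM; exact: measurable_sqr_EFin.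
move=> x _; rewrite -!EFinM -EFinD lee_fin /=.
have := sqr_ge0 (F x - G x); rewrite sqrrB sqrrD; lra.
Qed.

Lemma sqintN F : sqint (\- F)%R = sqint F.
Proof. by apply: eq_integral => x _; rewrite /= sqrrN. Qed.

Lemma sqintB F G : measurable_fun setT F -> measurable_fun setT G ->
  (sqint (F \- G)%R <= 2%:E * sqint F + 2%:E * sqint G)%E.
Proof.
move=> mF mG; rewrite -(sqintN G); apply: (sqintD mF).
exact: measurableT_comp.
Qed.

Lemma integrable_sqr F : measurable_fun setT F -> (sqint F < +oo)%E ->
  mu.-integrable setT (EFin \o (fun x => F x ^+ 2)).
Proof.
move=> mF F2; apply/integrableP; split; first exact: measurable_sqr_EFin.
by under eq_integral do rewrite /= ger0_norm ?sqr_ge0//.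
Qed.

Lemma integrable_mul_L2 F G : measurable_fun setT F -> measurable_fun setT G ->
  (sqint F < +oo)%E -> (sqint G < +oo)%E ->
  mu.-integrable setT (EFin \o (fun x => F x * G x)).
Proof.
move=> mF mG F2 G2.
apply: (@le_integrable _ _ _ _ _ _ _ (EFin \o (fun x => F x ^+ 2 + G x ^+ 2))) => //.
- by apply/measurable_EFinP; exact: measurable_funM.
- move=> x _; rewrite !abse_EFin lee_fin normrM.
  rewrite (ger0_norm (addr_ge0 (sqr_ge0 _) (sqr_ge0 _))).
  rewrite -(real_normK (num_real (F x))) -(real_normK (num_real (G x))).
  have := sqr_ge0 (`|F x| - `|G x|); rewrite sqrrB.
  have := sqr_ge0 (`|F x|); have := sqr_ge0 (`|G x|); lra.
exact: (integrableD measurableT (integrable_sqr mF F2) (integrable_sqr mG G2)).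
Qed.

Lemma Lnorm2_sqrte F : Lnorm mu 2%:E (EFin \o F) = sqrte (sqint F).
Proof.
rewrite unlock /Lnorm poweR12_sqrt; last by apply: integral_ge0 => x _; exact: poweR_ge0.
by congr sqrte; apply: eq_integral => x _; rewrite abse_EFin poweR_EFin powR_mulrn// real_normK ?num_real.
Qed.

Lemma Lfun2P F : F \in Lfun mu 2%:E <->
  measurable_fun setT F /\ (sqint F < +oo)%E.
Proof.
have E : (Lnorm mu 2%:E (EFin \o F) < +oo)%E = (sqint F < +oo)%E.
  rewrite Lnorm2_sqrte -!ge0_fin_numE ?sqint_ge0 ?sqrte_ge0//.
  by rewrite sqrte_fin_num// sqint_ge0.
split.
  case/andP => mF; rewrite inE/= /finite_norm E => F2; split => //.
  exact/set_mem.
move=> [mF F2]; apply/andP; split; first exact/mem_set.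
by rewrite inE /= /finite_norm E.
Qed.

End square_sum.

(** * Measure and topology of the plane *)

Section plane.
Context {R : realType}.
Notation T2 := (measurableTypeR R * measurableTypeR R)%type.

(* A countable base of the topology of the plane. *)
Definition qball (i : rat * rat * nat) : set (R * R) :=
  ball ((ratr i.1.1 : R), (ratr i.1.2 : R)) i.2.+1%:R^-1.

Lemma rat_ball1 (x e : R) : 0 < e -> exists q : rat, ball (ratr q : R) e x.
Proof.
move=> e0; have [q] := @rat_in_itvoo R (x - e) (x + e) ltac:(lra).
by rewrite in_itv /= => /andP[h1 h2]; exists q; rewrite /ball/= ltr_norml; lra.
Qed.

Lemma rat_ball2 (p : R * R) (e : R) : 0 < e ->
  exists i : rat * rat, ball ((ratr i.1 : R), (ratr i.2 : R)) e p.
Proof.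
move=> e0; have [q1 h1] := rat_ball1 p.1 e0; have [q2 h2] := rat_ball1 p.2 e0.
by exists (q1, q2).
Qed.

Lemma nbhs_qball (p : R * R) (U : set (R * R)) : nbhs p U ->
  exists i, qball i p /\ qball i `<=` U.
Proof.
move=> /nbhs_ballP[e /= e0 eU].
have [k /= hk] := @ltr_add_invr R 0 (e / 2) ltac:(lra).
rewrite add0r in hk.
have k0 : 0 < (k.+1%:R^-1 : R) by rewrite invr_gt0.
have [q hq] := rat_ball2 p k0.
exists (q, k); split => //; move=> y hy; apply: eU.
rewrite (splitr e); pose c : R * R := (ratr q.1, ratr q.2).
have le_e : ball c k.+1%:R^-1 `<=` ball c (e / 2) by apply: le_ball; exact: ltW.
exact: ball_triangle (ball_sym (le_e _ hq)) (le_e _ hy).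
Qed.

Lemma open_qball i : open (qball i).
Proof. exact: ball_open. Qed.

Lemma measurable_qball i : measurable (qball i : set T2).
Proof.
rewrite (_ : qball i = ball (ratr i.1.1 : R) i.2.+1%:R^-1 `*` ball (ratr i.1.2 : R) i.2.+1%:R^-1) //.
by apply: measurableX; exact: measurable_ball.
Qed.

(** The plane carries the product sigma-algebra; an open set belongs to it because it is a countable
    union of rational balls, which are rectangles. *)
Lemma open_measurable2 (U : set (R * R)) : open U -> measurable (U : set T2).
Proof.
move=> oU.
rewrite (_ : U = \bigcup_(i : rat * rat * nat) (if `[< qball i `<=` U >] then qball i else set0)).
  apply: (@countable_bigcupT_measurable _ T2) => // i; case: ifPn => // _.
  exact: measurable_qball.
apply/seteqP; split=> [p Up|p [i _]]; last by case: asboolP => // h /h.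
have [i [ip iU]] := nbhs_qball (open_nbhs_nbhs (conj oU Up)).
by exists i => //; rewrite asboolT.
Qed.

Lemma within_continuous_measurable2 (A : set (R * R)) (f : R * R -> R) :
  measurable (A : set T2) -> {within A, continuous f} ->
  measurable_fun (A : set T2) (f : T2 -> R).
Proof.
move=> mA cf; apply: (measurability _ (RGenOpens.measurableE R)).
move=> _ [_ [a [b ->] <-]].
have oab : open (from_subspace A f @^-1` `]a, b[%classic).
  by move/continuousP : cf; apply; exact: interval_open.
have [V oV VD] := (@open_subspaceP _ A _).1 oab.
by rewrite setIC -VD; apply: measurableI => //; exact: open_measurable2.
Qed.

Lemma continuous_measurable2 (f : R * R -> R) :
  continuous f -> measurable_fun (setT : set T2) (f : T2 -> R).
Proof.
by move=> cf; apply: within_continuous_measurable2 => //; exact: continuous_subspaceT.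
Qed.

Lemma measurable_osquare (D : R) : measurable (osquare D : set T2).
Proof. by apply: measurableX; exact: measurable_itv. Qed.

Lemma measurable_csquare (D : R) : measurable (csquare D : set T2).
Proof. by apply: measurableX; exact: measurable_itv. Qed.

Lemma measurable_bsquare (D : R) : measurable (bsquare D : set T2).
Proof. apply: measurableD; [exact: measurable_csquare|exact: measurable_osquare]. Qed.

Lemma measurable_pt (b : bool) (s : R) :
  measurable_fun setT (pt b s : measurableTypeR R -> T2).
Proof.
case: b; rewrite /pt; apply/measurable_fun_pairP; split => //=;
  try exact: measurable_id; exact: (@measurable_cst _ _ (measurableTypeR R)).
Qed.

Lemma measurable_pt1 (b : bool) (t : R) :
  measurable_fun setT ((pt b)^~ t : measurableTypeR R -> T2).
Proof. by case: b; [exact: (measurable_pt false t)|exact: (measurable_pt true t)]. Qed.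


Lemma osquare_pt (D : R) b s t :
  osquare D (pt b s t) <-> `]0, D[%classic s /\ `]0, D[%classic t.
Proof. by case: b; rewrite /osquare/pt/=; split=> -[]. Qed.

Lemma leb2_iter (D : R) (b : bool) (F : R * R -> \bar R) :
  measurable_fun (osquare D : set T2) (F : T2 -> \bar R) ->
  (forall p, osquare D p -> 0 <= F p)%E ->
  (\int[leb2]_(p in osquare D) F p =
   \int[lebesgue_measure]_(s in `]0%R, D[) \int[lebesgue_measure]_(t in `]0%R, D[)
      F (pt b s t))%E.
Proof.
move=> mF F0; rewrite integral_mkcond.
have mF' : measurable_fun (setT : set T2) (F \_ (osquare D) : T2 -> \bar R).
  exact/(measurable_restrictT _ (measurable_osquare D)).
have F0' p : (0 <= (F \_ (osquare D)) p)%E by apply: erestrict_ge0.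
have E s t : (F \_ (osquare D)) (pt b s t) =
   (((fun s => ((fun t => F (pt b s t)) \_ `]0, D[%classic) t) \_ `]0, D[%classic) s).
  rewrite !patchE; case: (boolP (s \in `]0, D[%classic)) => hs; last first.
    by rewrite memNset// => /osquare_pt[/mem_set]; rewrite (negbTE hs).
  case: (boolP (t \in `]0, D[%classic)) => ht; last first.
    by rewrite memNset// => /osquare_pt[_ /mem_set]; rewrite (negbTE ht).
  by rewrite mem_set//; apply/osquare_pt; split; exact: set_mem.
transitivity (\int[lebesgue_measure]_s \int[lebesgue_measure]_t
    (F \_ (osquare D)) (pt b s t))%E.
  by case: b {E}; [exact: fubini_tonelli2|exact: fubini_tonelli1].
rewrite [RHS]integral_mkcond; apply: eq_integral => s _.
under eq_integral do rewrite E.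
rewrite patchE; case: ifPn => hs.
  by rewrite [RHS]integral_mkcond; apply: eq_integral => t _; rewrite patchE hs.
by apply: integral0_eq => t _; rewrite patchE (negbTE hs).
Qed.

End plane.

(** * Estimates for smooth functions on the square *)

Section line_estimate.
Context {R : realType}.
Notation mu := (@lebesgue_measure R).

Lemma integrable_seg (f : R -> R) (a b : R) : continuous f ->
  mu.-integrable `[a, b] (EFin \o f).
Proof.
move=> cf; apply: continuous_compact_integrable; first exact: segment_compact.
exact: continuous_subspaceT.
Qed.

(** Cauchy-Schwarz applied to the integral of h' between b and a; enlarging that interval to (0, D)
    gives a bound uniform in a and b. *)
Lemma increment_sq_le (D : R) (h h' : R -> R) (a b : R) :
  (forall x, derivable h x 1) -> (forall x, derive1 h x = h' x) -> continuous h' ->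
  0 <= a <= D -> 0 <= b <= D ->
  (((h a - h b) ^+ 2)%:E <=
   D%:E * \int[mu]_(x in `]0%R, D[) ((h' x) ^+ 2)%:E)%E.
Proof.
move=> dh hE ch; wlog ba : a b / b < a => [H|] aD bD.
  have [|ab|->] := ltgtP b a; first by move=> ba; exact: H.
  - by rewrite -sqrrN opprB; exact: H.
  - rewrite subrr expr0n/=; apply: mule_ge0; first by rewrite lee_fin; lra.
    by apply: integral_ge0 => x _; rewrite lee_fin sqr_ge0.
have h2c : continuous (fun x => h' x ^+ 2) by move=> x; exact: cvgM (ch x) (ch x).
have mh2 (A : set (measurableTypeR R)) : measurable A ->
    measurable_fun A (EFin \o (fun x => h' x ^+ 2)).
  move=> mA; apply/measurable_EFinP; apply: measurable_funTS.
  exact: continuous_measurable_fun.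
(* Integrate [2 c h' - c ^ 2 <= h' ^ 2] with [c] the mean slope. *)
pose c := (h a - h b) / (a - b).
pose H (x : R) : R := 2 * c * h x - c ^+ 2 * x.
pose H' (x : R) : R := 2 * c * h' x - c ^+ 2.
have dH (x : R) : is_derive x 1 H (H' x).
  have dhx : is_derive x 1 h (h' x) by apply: DeriveDef => //; rewrite -derive1E hE.
  rewrite /H /H'.
  have -> : 2 * c * h' x - c ^+ 2 = (2 * c) *: h' x - c ^+ 2 *: (1 : R).
    by rewrite /GRing.scale/= mulr1.
  exact: is_deriveB.
have cH' : continuous H'.
  move=> x; apply: cvgB; last exact: cvg_cst.
  by apply: cvgM; [exact: cvg_cst|exact: ch].
have cH : continuous H.
  by move=> x; apply: differentiable_continuous; apply/derivable1_diffP; exact: (@ex_derive _ _ _ _ _ _ _ (dH x)).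
have F2 : (\int[mu]_(x in `[b, a]) (H' x)%:E = (H a)%:E - (H b)%:E)%E.
  apply: continuous_FTC2 => //.
  - exact: continuous_subspaceT.
  - split=> [x _||]; first exact: (@ex_derive _ _ _ _ _ _ _ (dH x)).
    + exact/cvg_at_right_filter/cH.
    + exact/cvg_at_left_filter/cH.
  - by move=> x _; rewrite derive1E; exact: (@derive_val _ _ _ _ _ _ _ (dH x)).
have ab0 : a - b != 0 by rewrite subr_eq0 gt_eqF.
have HE : H a - H b = (h a - h b) ^+ 2 / (a - b).
  by rewrite /H /c; field.
have L1 : (((h a - h b) ^+ 2 / (a - b))%:E <= \int[mu]_(x in `[b, a]) (h' x ^+ 2)%:E)%E.
  rewrite -HE EFinB -F2; apply: le_integral => //.
  - exact: integrable_seg cH'.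
  - exact: integrable_seg h2c.
  - move=> x _; rewrite lee_fin /H'.
    by have := sqr_ge0 (h' x - c); rewrite sqrrB; lra.
have L2 : (\int[mu]_(x in `[b, a]) (h' x ^+ 2)%:E <=
           \int[mu]_(x in `]0%R, D[) (h' x ^+ 2)%:E)%E.
  rewrite -(@integral_itv_bndoo _ _ _ _ true false); last by apply: mh2.
  apply: ge0_subset_integral => //.
  - exact: mh2.
  - by move=> x _; rewrite lee_fin sqr_ge0.
  - by move=> x /=; rewrite !in_itv/= => /andP[? ?]; apply/andP; split; lra.
apply: (@le_trans _ _ ((a - b)%:E * \int[mu]_(x in `]0%R, D[) (h' x ^+ 2)%:E))%E.
  apply: le_trans (lee_wpmul2l _ (le_trans L1 L2)); last by rewrite lee_fin; lra.
  by rewrite -EFinM lee_fin mulrC divfK.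
apply: lee_wpmul2r; last by rewrite lee_fin; lra.
by apply: integral_ge0 => x _; rewrite lee_fin sqr_ge0.
Qed.

Definition C1_plane (phi : R * R -> R) := [/\ continuous phi,
  forall b, continuous ('D_(dir b) phi) & forall b x, derivable phi x (dir b)].

Lemma smooth_C1 phi : smooth phi -> C1_plane phi.
Proof.
move=> sphi; split; first by have [] := sphi [::].
- by move=> b; have [] := sphi [:: b].
- by have [] := sphi [::].
Qed.

Lemma cvg_pair_nbhs (T : Type) (F : set_system T) (f g : T -> R) (a b : R) :
  Filter F -> f @ F --> a -> g @ F --> b -> (fun x => (f x, g x)) @ F --> (a, b).
Proof. by move=> FF fa gb; exact: (@cvg_pair _ _ _ F (nbhs a) (nbhs b)). Qed.

Lemma continuous_pt b (t : R) : continuous ((pt b)^~ t).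
Proof.
by case: b => s; apply: cvg_pair_nbhs => //; exact: cvg_cst.
Qed.

(** The difference quotients themselves coincide, so derivability and the value of the derivative
    both transfer to lines. *)
Lemma line_shift (phi : R * R -> R) b s t :
  (fun h => h^-1 *: (((fun s => phi (pt b s t)) \o shift s) (h *: 1) - phi (pt b s t))) =
  (fun h => h^-1 *: ((phi \o shift (pt b s t)) (h *: dir b) - phi (pt b s t))).
Proof.
apply/funext => h /=; congr (_ *: (phi _ - _)).
rewrite /pt /dir /shift/=; case: b.
- rewrite (_ : h *: ((0, 1) : R * R) = (h *: 0, h *: 1))//.
  by rewrite [RHS](_ : _ = (h *: 0 + t, h *: 1 + s))// scaler0 add0r.
- rewrite (_ : h *: ((1, 0) : R * R) = (h *: 1, h *: 0))//.
  by rewrite [RHS](_ : _ = (h *: 1 + s, h *: 0 + t))// scaler0 add0r.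
Qed.

Lemma derivable_line (phi : R * R -> R) b s t :
  derivable phi (pt b s t) (dir b) -> derivable (fun s => phi (pt b s t)) s 1.
Proof. by rewrite /derivable line_shift. Qed.

Lemma derive_line (phi : R * R -> R) b s t :
  derive1 (fun s => phi (pt b s t)) s = 'D_(dir b) phi (pt b s t).
Proof. by rewrite derive1E /derive line_shift. Qed.

Lemma line_sq_le (D : R) (phi : R * R -> R) b (s s' t : R) : C1_plane phi ->
  0 <= s <= D -> 0 <= s' <= D ->
  ((phi (pt b s t) ^+ 2)%:E <= 2%:E * (phi (pt b s' t) ^+ 2)%:E +
    (2 * D)%:E * \int[mu]_(x in `]0%R, D[) ('D_(dir b) phi (pt b x t) ^+ 2)%:E)%E.
Proof.
move=> [cphi cd dphi] sD s'D.
have := @increment_sq_le D (fun s => phi (pt b s t)) (fun s => 'D_(dir b) phi (pt b s t)) s s'.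
move=> /(_ _ _ _ sD s'D) H.
have {}H := H (fun x => derivable_line (dphi b _)) (fun x => derive_line phi b x t).
have {}H : ((((phi (pt b s t)) - phi (pt b s' t)) ^+ 2)%:E <=
   D%:E * \int[mu]_(x in `]0%R, D[) ('D_(dir b) phi (pt b x t) ^+ 2)%:E)%E.
  apply: H => x.
  exact: cvg_comp (@continuous_pt b t x) (cd b _).
set J := (\int[mu]_(x in _) _)%E in H *.
have HJ : (2%:E * (D%:E * J) = (2 * D)%:E * J)%E by rewrite muleA -EFinM.
rewrite -HJ.
apply: le_trans (leeD (lexx _) (lee_wpmul2l _ H)); last by rewrite lee_fin.
rewrite -!EFinM -EFinD lee_fin.
(* With p, q the two values, p^2 <= 2 q^2 + 2 (p - q)^2 amounts to (2 q - p)^2 >= 0. *)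
have := sqr_ge0 (2 * phi (pt b s' t) - phi (pt b s t)).
rewrite !sqrrB exprMn; lra.
Qed.

End line_estimate.

Section square_estimates.
Context {R : realType}.
Notation T1 := (measurableTypeR R).
Notation T2 := (measurableTypeR R * measurableTypeR R)%type.
Notation mu := (@lebesgue_measure R).
Notation I D := (`]0%R, D[%classic).
Implicit Types (F U V W : R * R -> \bar R) (E : R -> \bar R) (D : R).

(* The transverse coordinate, so that [crd b (pt b s t) = t]. *)
Definition crd (b : bool) (p : R * R) : R := if b then p.1 else p.2.

Lemma crd_pt b s t : crd b (pt b s t) = t. Proof. by case: b. Qed.
Lemma ptN b (s t : R) : pt (~~ b) t s = pt b s t. Proof. by case: b. Qed.

Lemma measurable_crd b : measurable_fun (setT : set T2) (crd b : T2 -> T1).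
Proof. by case: b; [exact: measurable_fst|exact: measurable_snd]. Qed.

Lemma measurable_line b t F : measurable_fun (setT : set T2) (F : T2 -> \bar R) ->
  measurable_fun (setT : set T1) ((fun s => F (pt b s t)) : T1 -> \bar R).
Proof. by move=> mF; exact: measurableT_comp mF (measurable_pt1 b t). Qed.

Lemma measurable_pt2 b :
  measurable_fun (setT : set T2) ((fun p : T2 => pt b p.1 p.2) : T2 -> T2).
Proof.
by case: b; apply/measurable_fun_pairP; split => //=;
  [exact: (@measurable_snd _ _ T1 T1)|exact: (@measurable_fst _ _ T1 T1)
  |exact: (@measurable_fst _ _ T1 T1)|exact: (@measurable_snd _ _ T1 T1)].
Qed.

Lemma measurable_fiber b (J : set T1) F : measurable J ->
  measurable_fun (setT : set T2) (F : T2 -> \bar R) -> (forall p, 0 <= F p)%E ->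
  measurable_fun (setT : set T1) ((fun t => \int[mu]_(s in J) F (pt b s t))%E : T1 -> \bar R).
Proof.
move=> mJ mF F0.
pose G := ((fun p : T2 => F (pt b p.1 p.2)) \_ (J `*` (setT : set T1) : set T2)).
have mG : measurable_fun (setT : set T2) (G : T2 -> \bar R).
  apply/(measurable_restrictT _ _).1; first exact: measurableX.
  apply: measurable_funTS; exact: measurableT_comp mF (measurable_pt2 b).
have G0 p : (0 <= G p)%E by apply: erestrict_ge0 => x _; exact: F0.
have : measurable_fun setT (fubini_G mu G) by exact: measurable_fun_fubini_tonelli_G.
apply: eq_measurable_fun => t _; rewrite /fubini_G.
rewrite [RHS]integral_mkcond; apply: eq_integral => s _.
rewrite /G !patchE; case: (boolP (s \in J)) => sJ.
  by rewrite mem_set//; split => //=; exact: set_mem.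
by rewrite memNset// => -[/= /mem_set]; rewrite (negbTE sJ).
Qed.

(** Integral over the band of lines of direction [dir b] with transverse coordinate in J. The
    transverse integral is outermost, so that estimates valid along a line can be integrated over
    the band. *)
Definition strip D b (J : set T1) F : \bar R :=
  (\int[mu]_(t in J) \int[mu]_(s in I D) F (pt b s t))%E.

Lemma strip_swap D b (J : set T1) F : measurable J ->
  measurable_fun (setT : set T2) (F : T2 -> \bar R) -> (forall p, 0 <= F p)%E ->
  (strip D b J F = \int[mu]_(s in I D) \int[mu]_(t in J) F (pt b s t))%E.
Proof.
move=> mJ mF F0.
pose G := ((fun p : T2 => F (pt b p.1 p.2)) \_ ((I D : set T1) `*` J : set T2)).
have mG : measurable_fun (setT : set T2) (G : T2 -> \bar R).
  apply/(measurable_restrictT _ _).1; first by apply: measurableX => //; exact: measurable_itv.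
  apply: measurable_funTS; exact: measurableT_comp mF (measurable_pt2 b).
have G0 p : (0 <= G p)%E by apply: erestrict_ge0 => x _; exact: F0.
have GE s t : G (s, t) = if s \in I D then if t \in J then F (pt b s t) else 0%E else 0%E.
  rewrite /G patchE.
  case: (boolP (s \in I D)) => sI; last first.
    by rewrite memNset// => -[Is _]; move: sI; rewrite (mem_set (Is : I D s)).
  case: (boolP (t \in J)) => tJ; last first.
    by rewrite memNset// => -[_ Jt]; move: tJ; rewrite (mem_set (Jt : J t)).
  by rewrite mem_set//; split => /=; exact: set_mem.
transitivity (\int[mu]_t \int[mu]_s G (s, t))%E.
  rewrite /strip integral_mkcond; apply: eq_integral => t _; rewrite patchE.
  case: ifPn => tJ; last by apply/esym/integral0_eq => s _; rewrite GE (negbTE tJ) if_same.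
  by rewrite integral_mkcond; apply: eq_integral => s _; rewrite patchE GE tJ.
transitivity (\int[mu]_s \int[mu]_t G (s, t))%E.
  exact: (esym (@fubini_tonelli _ _ _ _ _ mu mu G mG G0)).
rewrite [RHS]integral_mkcond; apply: eq_integral => s _.
rewrite patchE; case: ifPn => sI; last by apply: integral0_eq => t _; rewrite GE (negbTE sI).
by rewrite [RHS]integral_mkcond; apply: eq_integral => t _; rewrite patchE GE sI.
Qed.

Lemma strip_full D b F : measurable_fun (setT : set T2) (F : T2 -> \bar R) ->
  (forall p, 0 <= F p)%E -> (strip D b (I D) F = \int[leb2]_(p in osquare D) F p)%E.
Proof.
move=> mF F0; rewrite strip_swap//.
by rewrite (leb2_iter b)//; exact: measurable_funTS.
Qed.

Lemma strip_le D b (J : set T1) U V W (c d : R) : measurable J ->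
  measurable_fun (setT : set T2) (U : T2 -> \bar R) ->
  measurable_fun (setT : set T2) (V : T2 -> \bar R) ->
  measurable_fun (setT : set T2) (W : T2 -> \bar R) ->
  (forall p, 0 <= U p)%E -> (forall p, 0 <= V p)%E -> (forall p, 0 <= W p)%E ->
  0 <= c -> 0 <= d ->
  (forall s t, I D s -> J t -> U (pt b s t) <= c%:E * V (pt b s t) + d%:E * W (pt b s t))%E ->
  (strip D b J U <= c%:E * strip D b J V + d%:E * strip D b J W)%E.
Proof.
move=> mJ mU mV mW U0 V0 W0 c0 d0 H.
have mI : measurable (I D) by exact: measurable_itv.
have mfib F : measurable_fun (setT : set T2) (F : T2 -> \bar R) -> (forall p, 0 <= F p)%E ->
    measurable_fun J ((fun t => \int[mu]_(s in I D) F (pt b s t))%E : T1 -> \bar R).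
  by move=> mF F0; apply: measurable_funTS; exact: measurable_fiber.
have fib0 F t : (forall p, 0 <= F p)%E -> (0 <= \int[mu]_(s in I D) F (pt b s t))%E.
  by move=> F0; exact: integral_ge0.
rewrite /strip -!ge0_integralZl//; [|exact: mfib|by move=> *; exact: fib0..
  |exact: mfib|by move=> *; exact: fib0].
rewrite -ge0_integralD//; last 4 first.
- by move=> t _; rewrite mule_ge0// fib0.
- by apply: measurable_funeM; exact: mfib.
- by move=> t _; rewrite mule_ge0// fib0.
- by apply: measurable_funeM; exact: mfib.
apply: ge0_le_integral => //.
- by move=> *; exact: fib0.
- exact: mfib.
- by apply: emeasurable_funD; apply: measurable_funeM; exact: mfib.
move=> t Jt.
have mline F : measurable_fun (setT : set T2) (F : T2 -> \bar R) ->
    measurable_fun (I D) ((fun s => F (pt b s t)) : T1 -> \bar R).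
  by move=> mF; apply: measurable_funTS; exact: measurable_line.
rewrite -!ge0_integralZl//; [|exact: mline..].
rewrite -ge0_integralD//; last 4 first.
- by move=> s _; rewrite mule_ge0.
- by apply: measurable_funeM; exact: mline.
- by move=> s _; rewrite mule_ge0.
- by apply: measurable_funeM; exact: mline.
apply: ge0_le_integral => //.
- exact: mline.
- by apply: emeasurable_funD; apply: measurable_funeM; exact: mline.
- by move=> s Is; exact: H.
Qed.

Lemma lebesgue_measure_side D : 0 < D -> mu (I D) = D%:E.
Proof. by move=> D0; rewrite lebesgue_measure_itv/= lte_fin D0 oppr0 adde0. Qed.

Lemma strip_crd D b (J : set T1) E : 0 < D -> measurable J ->
  measurable_fun (setT : set T1) (E : T1 -> \bar R) -> (forall t, 0 <= E t)%E ->
  (strip D b J (fun p => E (crd b p)) = D%:E * \int[mu]_(t in J) E t)%E.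
Proof.
move=> D0 mJ mE E0; rewrite -ge0_integralZl//; last 2 first.
- exact: measurable_funTS.
- by rewrite lee_fin ltW.
apply: eq_integral => t _; under eq_integral do rewrite crd_pt.
by rewrite integral_cst// [X in (_ * X)%E](_ : _ = D%:E) 1?muleC//; exact: lebesgue_measure_side.
Qed.

End square_estimates.

Section C1_estimates.
Context {R : realType}.
Notation T1 := (measurableTypeR R).
Notation T2 := (measurableTypeR R * measurableTypeR R)%type.
Notation mu := (@lebesgue_measure R).
Notation I D := (`]0%R, D[%classic).
Variables (D : R) (phi : R * R -> R).
Hypotheses (D0 : 0 < D) (phi1 : C1_plane phi).

Definition esq (psi : R * R -> R) (p : R * R) : \bar R := (psi p ^+ 2)%:E.

Lemma esq_ge0 psi p : (0 <= esq psi p)%E. Proof. by rewrite lee_fin sqr_ge0. Qed.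

Lemma measurable_esq psi : continuous psi -> measurable_fun (setT : set T2) (esq psi : T2 -> \bar R).
Proof.
by move=> cpsi; apply: (@measurable_sqr_EFin _ T2); exact: continuous_measurable2.
Qed.

Let line b (t : R) : \bar R := (\int[mu]_(s in I D) esq ('D_(dir b) phi) (pt b s t))%E.

Let mline b : measurable_fun (setT : set T1) (line b : T1 -> \bar R).
Proof.
have [_ cd _] := phi1; apply: measurable_fiber; first exact: measurable_itv.
  exact: measurable_esq.
by move=> p; exact: esq_ge0.
Qed.

Let line0 b t : (0 <= line b t)%E. Proof. by apply: integral_ge0 => s _; exact: esq_ge0. Qed.

Let line_int b : (\int[mu]_(t in I D) line b t =
  \int[leb2]_(p in osquare D) esq ('D_(dir b) phi) p)%E.
Proof.
have [_ cd _] := phi1.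
rewrite -(strip_full D b); [by []|exact: measurable_esq|exact: esq_ge0].
Qed.

(** The value at the end e of a line is bounded by the value at a point s plus the energy of the
    line; integrating over s in (0, D) produces the factor D on the left. *)
Lemma trace_C1 b (e : R) : 0 <= e <= D ->
  (D%:E * \int[mu]_(t in I D) esq phi (pt b e t) <=
   2%:E * \int[leb2]_(p in osquare D) esq phi p +
   (2 * D ^+ 2)%:E * \int[leb2]_(p in osquare D) esq ('D_(dir b) phi) p)%E.
Proof.
move=> eD; have [cphi cd _] := phi1.
have mphi := measurable_esq cphi.
have mE : measurable_fun (setT : set T1) ((fun t => esq phi (pt b e t)) : T1 -> \bar R).
  exact: measurableT_comp mphi (measurable_pt b e).
rewrite -(strip_crd b D0 (measurable_itv `]0%R, D[) mE (fun t => esq_ge0 phi _)).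
rewrite -(strip_full D b mphi (esq_ge0 phi)) -line_int [X in (_ + X)%E](_ : _ = (2 * D)%:E * strip D b (I D) (fun p => line b (crd b p)))%E; last first.
  rewrite (strip_crd b D0 (measurable_itv `]0%R, D[) (mline b) (line0 b)).
  by rewrite [RHS]muleA -EFinM -mulrA.
apply: strip_le => //.
- exact: measurableT_comp mE (measurable_crd b).
- exact: measurableT_comp (mline b) (measurable_crd b).
- by move=> p; exact: esq_ge0.
- by move=> p; exact: esq_ge0.
- by rewrite mulr_ge0// ltW.
- move=> s t /= sD _; rewrite !crd_pt; apply: line_sq_le => //.
  by move: sD; rewrite in_itv/=; lra.
Qed.

(* [E] controls [phi] at one end of every segment of direction [dir b] over [J]:
   go from that end into the strip over [J], then across to the whole square. *)
Lemma poincare_C1 b (J : set T1) (len : R) (E : T1 -> \bar R) :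
  measurable J -> J `<=` I D -> mu J = len%:E ->
  measurable_fun setT E -> (forall t, 0 <= E t)%E ->
  (forall t, J t -> exists2 e, 0 <= e <= D & (esq phi (pt b e t) <= E t)%E) ->
  (len%:E * \int[leb2]_(p in osquare D) esq phi p <=
   (4 * D ^+ 2)%:E * \int[mu]_(t in J) E t +
   (4 * D ^+ 3)%:E * \int[leb2]_(p in osquare D) esq ('D_(dir b) phi) p +
   (2 * D ^+ 2 * len)%:E * \int[leb2]_(p in osquare D) esq ('D_(dir (~~ b)) phi) p)%E.
Proof.
move=> mJ JI muJ mE E0 JE; have [cphi cd _] := phi1.
have mphi := measurable_esq cphi.
have mI : measurable (I D : set T1) by exact: measurable_itv.
have len0 : 0 <= len by rewrite -lee_fin -muJ.
pose A := (\int[leb2]_(p in osquare D) esq phi p)%E.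
pose K (s : R) := (\int[mu]_(t in J) esq phi (pt b s t))%E.
have KE (s : R) : K s = (\int[mu]_(t in J) esq phi (pt (~~ b) t s))%E.
  by apply: eq_integral => t _; rewrite ptN.
have mK : measurable_fun (setT : set T1) (K : T1 -> \bar R).
  have := @measurable_fiber _ (~~ b) J _ mJ mphi (esq_ge0 phi).
  by apply: eq_measurable_fun => s _; rewrite KE.
have K0 s : (0 <= K s)%E by apply: integral_ge0 => t _; exact: esq_ge0.
(* Inside the band, every line over J has an end where E bounds the square of [phi]. *)
have step1 : (strip D b J (esq phi) <= 2%:E * (D%:E * \int[mu]_(t in J) E t) +
    (2 * D)%:E * (D%:E * \int[leb2]_(p in osquare D) esq ('D_(dir b) phi) p))%E.
  apply: (@le_trans _ _ (2%:E * strip D b J (fun p => E (crd b p)) +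
      (2 * D)%:E * strip D b J (fun p => line b (crd b p)))%E).
    apply: strip_le => //.
    - exact: measurableT_comp mE (measurable_crd b).
    - exact: measurableT_comp (mline b) (measurable_crd b).
    - by move=> p; exact: esq_ge0.
    - by rewrite mulr_ge0// ltW.
    - move=> s t sI tJ; rewrite !crd_pt; have [e eD He] := JE _ tJ.
      have sD : 0 <= s <= D by move: sI; rewrite /= in_itv/=; lra.
      apply: le_trans (line_sq_le b t phi1 sD eD) _.
      by apply: leeD => //; exact: lee_wpmul2l.
  rewrite (strip_crd b D0 mJ mE E0) (strip_crd b D0 mJ (mline _) (line0 _)); apply: leeD; first by [].
  rewrite -line_int; apply: lee_wpmul2l; first by rewrite lee_fin mulr_ge0// ltW.
  apply: lee_wpmul2l; first by rewrite lee_fin ltW.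
  by apply: ge0_subset_integral => //; exact: measurable_funTS.
have step2 : (len%:E * A <= 2%:E * (D%:E * strip D b J (esq phi)) +
    (2 * D * len)%:E * (D%:E * \int[leb2]_(p in osquare D) esq ('D_(dir (~~ b)) phi) p))%E.
  have -> : (len%:E * A = strip D (~~ b) (I D) (fun p => len%:E * esq phi p))%E.
    rewrite strip_full//; last 2 first.
    - by apply: measurable_funeM.
    - by move=> p; rewrite mule_ge0// esq_ge0.
    rewrite /A -ge0_integralZl//.
    - exact: measurable_osquare.
    - exact: measurable_funTS.
    - by move=> p _; exact: esq_ge0.
  apply: (@le_trans _ _ (2%:E * strip D (~~ b) (I D) (fun p => K (crd (~~ b) p)) +
      (2 * D * len)%:E * strip D (~~ b) (I D) (fun p => line (~~ b) (crd (~~ b) p)))%E).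
    apply: strip_le => //.
    - exact: measurable_funeM.
    - exact: measurableT_comp mK (measurable_crd _).
    - exact: measurableT_comp (mline _) (measurable_crd _).
    - by move=> p; rewrite mule_ge0// esq_ge0.
    - by rewrite !mulr_ge0// ltW.
    - move=> t s tI sI; rewrite !crd_pt.
      (* Both sides become integrals over t' in J, so that the point is compared, along its
         transverse line, with every point of the band; this yields the factor [len]. *)
      have -> : (len%:E * esq phi (pt (~~ b) t s) = \int[mu]_(t' in J) cst (esq phi (pt (~~ b) t s)) t')%E.
        by rewrite integral_cst// muleC; congr (_ * _)%E.
      have -> : (2%:E * K s + (2 * D * len)%:E * line (~~ b) s =
          \int[mu]_(t' in J) (2%:E * esq phi (pt (~~ b) t' s) + cst ((2 * D)%:E * line (~~ b) s) t'))%E.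
        have mln : measurable_fun (J : set T1) ((fun t' => esq phi (pt (~~ b) t' s)) : T1 -> \bar R).
          by apply: measurable_funTS; exact: measurableT_comp mphi (measurable_pt1 _ _).
        have c0 : (0 <= (2 * D)%:E * line (~~ b) s)%E.
          by rewrite mule_ge0// lee_fin mulr_ge0// ltW.
        rewrite ge0_integralD//.
        - rewrite ge0_integralZl//; last by move=> *; exact: esq_ge0.
          rewrite -KE integral_cst//; congr (_ + _)%E.
          by rewrite EFinM muleAC -muJ.
        - by move=> *; rewrite mule_ge0// esq_ge0.
        by apply: measurable_funeM.
      apply: ge0_le_integral => //.
      - by move=> *; exact: esq_ge0.
      - apply: emeasurable_funD => //; apply: measurable_funeM; apply: measurable_funTS.
        exact: measurableT_comp mphi (measurable_pt1 _ _).
      - move=> t' Jt'; apply: line_sq_le => //.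
          by move: tI; rewrite /= in_itv/=; lra.
        by have := JI _ Jt'; rewrite /= in_itv/=; lra.
  rewrite (strip_crd (~~ b) D0 mI mK K0) (strip_crd (~~ b) D0 mI (mline _) (line0 _)) line_int.
  rewrite leeD2r//; apply: lee_wpmul2l; first by [].
  apply: lee_wpmul2l; first by rewrite lee_fin ltW.
  by rewrite (strip_swap D b mJ mphi (esq_ge0 phi)).
apply: le_trans step2 _; apply: leeD; last first.
  rewrite muleA -EFinM; apply: lee_wpmul2r; last by rewrite lee_fin; lra.
  by apply: integral_ge0 => p _; exact: esq_ge0.
rewrite muleA -EFinM.
apply: le_trans (lee_wpmul2l _ step1) _; first by rewrite lee_fin mulr_ge0// ltW.
have X0 : (0 <= \int[mu]_(t in J) E t)%E by apply: integral_ge0.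
have Y0 : (0 <= \int[leb2]_(p in osquare D) esq ('D_(dir b) phi) p)%E.
  by apply: integral_ge0 => p _; exact: esq_ge0.
have D0' : (0 <= D%:E)%E by rewrite lee_fin ltW.
have DD : (0 <= (2 * D)%:E)%E by rewrite lee_fin mulr_ge0// ltW.
rewrite ge0_muleDr; [|by rewrite !mule_ge0..].
rewrite !muleA -!EFinM; apply: leeD; apply: lee_wpmul2r => //; rewrite lee_fin; lra.
Qed.

End C1_estimates.

(** * Sobolev functions and traces *)

Section restricted_measure.
Context d (T : measurableType d) (R : realType).
Variable mu : {measure set T -> \bar R}.

Lemma ge0_integral_mrestr (A : set T) (mA : measurable A) (F : T -> \bar R) :
  measurable_fun setT F -> (forall x, 0 <= F x)%E ->
  (\int[mrestr mu mA]_x F x = \int[mu]_(x in A) F x)%E.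
Proof.
move=> mF F0.
have mAC : measurable (~` A) by exact: measurableC.
rewrite (@ge0_negligible_integral _ _ _ _ setT (~` A))//; last first.
  by transitivity (mu (~` A `&` A)); rewrite // setICl measure0.
rewrite setDE setCK setTI.
apply: eq_measure_integral => B mB BA.
by transitivity (mu (B `&` A)); rewrite // setIidl.
Qed.

Definition sqint_on (A : set T) (psi : T -> R) : \bar R :=
  (\int[mu]_(x in A) (psi x ^+ 2)%:E)%E.

Lemma sqint_onE A psi : sqint_on A psi = sqint mu (psi \_ A).
Proof.
rewrite /sqint_on integral_mkcond; apply: eq_integral => x _.
by rewrite !patchE; case: ifPn => // _; rewrite expr0n.
Qed.

Lemma sqint_on_ge0 A psi : (0 <= sqint_on A psi)%E.
Proof. by rewrite sqint_onE sqint_ge0. Qed.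

Lemma restrB A (f g : T -> R) : (f - g) \_ A = (f \_ A \- g \_ A)%R.
Proof. by apply/funext => x; rewrite /= !patchE; case: ifPn => // _; rewrite subr0. Qed.

Lemma sqint_onB A (psi psi' : T -> R) : measurable A -> measurable_fun A psi -> measurable_fun A psi' ->
  (sqint_on A (psi - psi')%R <= 2%:E * sqint_on A psi + 2%:E * sqint_on A psi')%E.
Proof.
move=> mA m m'; rewrite !sqint_onE restrB; apply: sqintB.
- exact/(measurable_restrictT _ mA).1.
- exact/(measurable_restrictT _ mA).1.
Qed.

Lemma sqint_onC A (psi psi' : T -> R) : sqint_on A (psi - psi')%R = sqint_on A (psi' - psi)%R.
Proof. by apply: eq_integral => x _; congr EFin; rewrite -sqrrN opprB. Qed.

End restricted_measure.

Section surface.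
Context {R : realType}.
Notation T1 := (measurableTypeR R).
Notation T2 := (measurableTypeR R * measurableTypeR R)%type.
Notation mu := (@lebesgue_measure R).
Notation I D := (`]0%R, D[%classic).
Variables (D : R).
Hypothesis D0 : 0 < D.

(** The direction normal to side k and the coordinate of the side in that direction: sides become
    ends of the lines used in the line estimates. *)
Definition side_bit (k : nat) : bool := (k < 2)%N.
Definition side_end (k : nat) : R := if odd k then D else 0.

Lemma side_pt k t : (k < 4)%N -> side D k t = pt (side_bit k) (side_end k) t.
Proof. by case: k => [|[|[|[|]]]]. Qed.

Lemma side_end_itv k : 0 <= side_end k <= D.
Proof. by rewrite /side_end; case: ifP => _; rewrite lexx ?ltW// andbT ltW. Qed.

Lemma bsquare_side k t : (k < 4)%N -> 0 <= t <= D -> bsquare D (side D k t).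
Proof.
move=> k4 tD; rewrite /bsquare /csquare /osquare; split.
  by case: k k4 => [|[|[|[|]]]]//= _; split; rewrite /= in_itv/= ?lexx ?(ltW D0) ?tD.
by case: k k4 => [|[|[|[|]]]]//= _ []; rewrite /= !in_itv/= ?ltxx ?andbF.
Qed.

Lemma surf_integral (F : T2 -> \bar R) : measurable_fun setT F -> (forall p, 0 <= F p)%E ->
  (\int[surf D]_p F p = \sum_(k < 4) \int[mu]_(t in I D) F (side D k t))%E.
Proof.
move=> mF F0; rewrite /surf ge0_integral_measure_sum//; apply: eq_bigr => k _.
have mFk : measurable_fun (setT : set T1) ((fun t => F (side D k t)) : T1 -> \bar R).
  exact: measurableT_comp mF (measurable_side D k).
rewrite (@ge0_integral_pushforward _ _ _ _ _ _ (measurable_side D k) (lebesgue_side D))//.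
rewrite preimage_setT; transitivity (\int[mu]_(t in `[0%R, D]) F (side D k t))%E.
  have := ge0_integral_mrestr mu (measurable_itv `[0%R, D]) mFk (fun t => F0 _).
  by apply.
by rewrite (@integral_itv_bndoo _ _ _ _ true false)//; exact: measurable_funTS.
Qed.

(** Each side measure is a summand of [surf], so a surface null set pulls back to a null set of
    parameters on every side. *)
Lemma surf_ae (P : R * R -> Prop) k : (k < 4)%N -> {ae surf D, forall p, P p} ->
  {ae mu, forall t, 0 <= t <= D -> P (side D k t)}.
Proof.
move=> k4 [N [mN N0 PN]].
exists ((side D k @^-1` N) `&` `[0, D]%classic); split.
- apply: measurableI; last exact: measurable_itv.
  by rewrite -[X in measurable X]setTI; exact: measurable_side.
- have : (side_measure D k N <= surf D N)%E.
    rewrite /surf [leRHS]/=/msum (bigD1 (Ordinal k4))//= leeDl//.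
    by apply: sume_ge0.
  by rewrite N0 measure_le0 => /eqP.
- move=> t /= /not_implyP[tD nP]; split; last by rewrite /= in_itv.
  exact: PN.
Qed.

Lemma sqint_on_surf (tau : R * R -> R) : measurable_fun (bsquare D : set T2) (tau : T2 -> R) ->
  (sqint_on (surf D) (bsquare D) tau =
   \sum_(k < 4) \int[mu]_(t in I D) (esq tau (side D k t)))%E.
Proof.
move=> mtau; rewrite sqint_onE /sqint surf_integral.
- apply: eq_bigr => k _; apply: eq_integral => t /set_mem tI.
  rewrite patchE mem_set//; apply: bsquare_side => //.
  by move: tI; rewrite /= in_itv/=; lra.
- apply: measurable_sqr_EFin; apply/(measurable_restrictT _ _).1 => //.
  exact: measurable_bsquare.
- by move=> p; rewrite lee_fin sqr_ge0.
Qed.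

End surface.

Section sobolev_norms.
Context {R : realType}.
Notation T2 := (measurableTypeR R * measurableTypeR R)%type.
Implicit Types (D : R) (u v : @sobolev R).

Lemma L2_onP (mu : {measure set T2 -> \bar R}) (A : set T2) (psi : T2 -> R) : measurable A ->
  L2_on mu A psi <-> measurable_fun A psi /\ (sqint_on mu A psi < +oo)%E.
Proof.
move=> mA; rewrite sqint_onE; split.
  by move/Lfun2P => [m f]; split => //; apply/(measurable_restrictT _ mA).
by move=> [m f]; apply/Lfun2P; split => //; apply/(measurable_restrictT _ mA).
Qed.

Lemma Lnorm_on2 (mu : {measure set T2 -> \bar R}) (A : set (R * R)) (psi : R * R -> R) :
  Lnorm_on mu A 2%:E psi = sqrte (sqint_on mu A psi).
Proof. by rewrite /Lnorm_on Lnorm2_sqrte sqint_onE. Qed.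

Definition sobolev_measurable D u := measurable_fun (osquare D : set T2) (u.1 : T2 -> R) /\
  forall b, measurable_fun (osquare D : set T2) (u.2 b : T2 -> R).

Definition H1sq D u : \bar R :=
  (\int[leb2]_(x in osquare D) (u.1 x ^+ 2 + \sum_(b : bool) u.2 b x ^+ 2)%:E)%E.

Definition gradsq D u : \bar R :=
  (sqint_on leb2 (osquare D) (u.2 true) + sqint_on leb2 (osquare D) (u.2 false))%E.

Lemma H1sq_ge0 D u : (0 <= H1sq D u)%E.
Proof.
apply: integral_ge0 => x _; rewrite lee_fin addr_ge0 ?sqr_ge0//.
by apply: sumr_ge0 => b _; rewrite sqr_ge0.
Qed.

Lemma gradsq_ge0 D u : (0 <= gradsq D u)%E.
Proof. by rewrite adde_ge0 ?sqint_on_ge0. Qed.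

Lemma H1norm_sqrte D u : H1norm D u = sqrte (H1sq D u).
Proof. by rewrite /H1norm poweR12_sqrt// H1sq_ge0. Qed.

Lemma H1sqE D u : sobolev_measurable D u -> H1sq D u = (sqint_on leb2 (osquare D) u.1 + gradsq D u)%E.
Proof.
move=> [m1 m2]; rewrite /H1sq /gradsq /sqint_on.
have mQ := @measurable_osquare R D.
have msq psi : measurable_fun (osquare D : set T2) (psi : T2 -> R) ->
    measurable_fun (osquare D : set T2) ((fun x => (psi x ^+ 2)%:E) : T2 -> \bar R).
  by move=> m; apply/measurable_EFinP; exact: measurable_funX.
have ge0 (psi : T2 -> R) x : (0 <= (psi x ^+ 2)%:E)%E by rewrite lee_fin sqr_ge0.
rewrite -ge0_integralD//; [|exact: msq..].
rewrite -ge0_integralD//; [|exact: msq| |].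
- by apply: eq_integral => x _; rewrite big_bool/= -!EFinD.
- by move=> x _; rewrite adde_ge0.
- by apply: emeasurable_funD; exact: msq.
Qed.

Lemma sobolev_measurableB D u v : sobolev_measurable D u -> sobolev_measurable D v ->
  sobolev_measurable D (u - v).
Proof.
move=> [u1 u2] [v1 v2]; split; first exact: measurable_funB.
by move=> b; apply: measurable_funB.
Qed.

Lemma two_distr (x y z w : \bar R) : (0 <= x -> 0 <= y -> 0 <= z -> 0 <= w ->
  2%:E * x + 2%:E * z + (2%:E * y + 2%:E * w) = 2%:E * (x + y) + 2%:E * (z + w))%E.
Proof. by move=> x0 y0 z0 w0; rewrite addeACA (ge0_muleDr _ x0 y0) (ge0_muleDr _ z0 w0). Qed.

Lemma gradsqB D u v : sobolev_measurable D u -> sobolev_measurable D v ->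
  (gradsq D (u - v)%R <= 2%:E * gradsq D u + 2%:E * gradsq D v)%E.
Proof.
move=> [_ mu] [_ mv]; rewrite /gradsq -two_distr ?sqint_on_ge0//.
by apply: leeD; apply: sqint_onB => //; exact: measurable_osquare.
Qed.

Lemma H1sqB D u v : sobolev_measurable D u -> sobolev_measurable D v ->
  (H1sq D (u - v)%R <= 2%:E * H1sq D u + 2%:E * H1sq D v)%E.
Proof.
move=> mu mv; rewrite !H1sqE//; last exact: sobolev_measurableB.
rewrite -two_distr ?sqint_on_ge0 ?gradsq_ge0//; apply: leeD; last exact: gradsqB.
by apply: sqint_onB; [exact: measurable_osquare|exact: mu.1|exact: mv.1].
Qed.

Lemma H1sqC D u v : H1sq D (u - v)%R = H1sq D (v - u)%R.
Proof.
apply: eq_integral => x _; congr EFin.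
rewrite -[in LHS](opprB v u) [X in X + _]sqrrN; congr (_ + _).
by apply: eq_bigr => b _; exact: sqrrN.
Qed.

Lemma gradsqC D u v : gradsq D (u - v)%R = gradsq D (v - u)%R.
Proof.
by rewrite /gradsq; congr (_ + _)%E; apply: eq_integral => x _;
  rewrite -(opprB v u); congr EFin; exact: sqrrN.
Qed.

Lemma jet_measurable D phi : C1_plane phi -> sobolev_measurable D (classical_jet phi).
Proof.
move=> [c cd _]; split; first by apply: measurable_funTS; exact: (continuous_measurable2 c).
by move=> b; apply: measurable_funTS; exact: (continuous_measurable2 (cd b)).
Qed.

Lemma H1_measurable D u : H1 D u -> sobolev_measurable D u.
Proof.
move=> [u1 u2 _]; split; first by have [] := (L2_onP _ _ (@measurable_osquare R D)).1 u1.
by move=> b; have [] := (L2_onP _ _ (@measurable_osquare R D)).1 (u2 b).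
Qed.

Lemma H1sq_lty D u : H1 D u -> (H1sq D u < +oo)%E.
Proof.
move=> uH; rewrite H1sqE; last exact: H1_measurable.
have [u1 u2 _] := uH; have mQ := @measurable_osquare R D.
have f1 := ((L2_onP _ _ mQ).1 u1).2; have f2 b := ((L2_onP _ _ mQ).1 (u2 b)).2.
apply: lte_add_pinfty; first exact: f1.
by apply: lte_add_pinfty; exact: f2.
Qed.

Lemma jetB (phi psi : R * R -> R) : C1_plane phi -> C1_plane psi ->
  classical_jet (phi - psi) = classical_jet phi - classical_jet psi.
Proof.
move=> [_ _ d1] [_ _ d2]; rewrite /classical_jet; congr pair.
by apply/funext => b; apply/funext => x; rewrite deriveB.
Qed.

Lemma iter_partialB s (phi psi : R * R -> R) : smooth phi -> smooth psi ->
  iter_partial s (phi - psi) = iter_partial s phi - iter_partial s psi.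
Proof.
move=> sphi spsi; elim: s => // b s IH /=; rewrite IH.
by apply/funext => x; rewrite deriveB//; [exact: (sphi s).2|exact: (spsi s).2].
Qed.

Lemma smoothB (phi psi : R * R -> R) : smooth phi -> smooth psi -> smooth (phi - psi).
Proof.
move=> sphi spsi s; rewrite iter_partialB//; split.
  by move=> x; apply: cvgB; [exact: (sphi s).1|exact: (spsi s).1].
by move=> b x; apply: derivableB; [exact: (sphi s).2|exact: (spsi s).2].
Qed.

Lemma sqrte_cvg0P (x : nat -> \bar R) : (forall n, 0 <= x n)%E ->
  (fun n => sqrte (x n)) @ \oo --> 0%E <->
  forall e : R, 0 < e -> \forall n \near \oo, (x n <= e%:E)%E.
Proof.
move=> x0; split=> [xcv e e0|H].
  have h : (0 < (Num.sqrt e)%:E)%E by rewrite lte_fin sqrtr_gt0.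
  have : \forall n \near \oo, (sqrte (x n) < (Num.sqrt e)%:E)%E := xcv _ (open_ereal_lt' h).
  apply: filterS => n /ltW; rewrite -[X in (_ <= X)%E]/(sqrte e%:E) lee_sqrt//.
  by rewrite lee_fin ltW.
apply/fine_cvgP; split.
  apply: (filterS _ (H _ ltr01)) => n xn.
  by rewrite sqrte_fin_num// ge0_fin_numE// (le_lt_trans xn)// ltry.
apply/cvgrPdist_le => e e0.
have e20 : 0 < e ^+ 2 by rewrite exprn_gt0.
apply: (filterS _ (H _ e20)) => n xn /=.
have xf : x n \is a fin_num by rewrite ge0_fin_numE// (le_lt_trans xn)// ltry.
rewrite sub0r normrN ger0_norm ?fine_ge0 ?sqrte_ge0//.
rewrite -lee_fin fineK ?sqrte_fin_num//.
rewrite -(ger0_norm (ltW e0)) -sqrtr_sqr -[X in (_ <= X)%E]/(sqrte (e ^+ 2)%:E) lee_sqrt//.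
by rewrite lee_fin sqr_ge0.
Qed.

End sobolev_norms.

Section traces.
Context {R : realType}.
Notation T2 := (measurableTypeR R * measurableTypeR R)%type.
Notation mu := (@lebesgue_measure R).
Notation I D := (`]0%R, D[%classic).
Implicit Types (D : R) (u v : @sobolev R) (phi tau sigma : R * R -> R).

(** Choosing an approximant for each e = 1 / (n + 1) recovers the sequence. The epsilon form
    supplies one smooth function that is close in both squared norms, which is what the limit
    arguments consume. *)
Lemma is_traceP D u tau : is_trace D u tau <-> L2_on (surf D) (bsquare D) tau /\
  forall e : R, 0 < e -> exists2 phi, smooth phi &
    (H1sq D (classical_jet phi - u)%R <= e%:E /\ sqint_on (surf D) (bsquare D) (phi - tau)%R <= e%:E)%E.
Proof.
have E1 (phi : nat -> R * R -> R) : (fun n => H1norm D (classical_jet (phi n) - u)) =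
    (fun n => sqrte (H1sq D (classical_jet (phi n) - u))).
  by apply/funext => n; rewrite H1norm_sqrte.
have E2 (phi : nat -> R * R -> R) : (fun n => Lnorm_on (surf D) (bsquare D) 2%:E (phi n - tau)) =
    (fun n => sqrte (sqint_on (surf D) (bsquare D) (phi n - tau))).
  by apply/funext => n; rewrite Lnorm_on2.
split=> [[Ltau [phi [sphi]]]|[Ltau H]].
  rewrite E1 E2 => /sqrte_cvg0P h1 /sqrte_cvg0P h2; split => // e e0.
  have [N _ HN] := h1 (fun n => H1sq_ge0 D _) e e0.
  have [M _ HM] := h2 (fun n => sqint_on_ge0 _ _ _) e e0.
  exists (phi (maxn N M)) => //; split; [apply: HN|apply: HM] => /=.
    exact: leq_maxl.
  exact: leq_maxr.
split => //.
have pe (n : nat) : 0 < (n.+1%:R^-1 : R) by rewrite invr_gt0.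
have {}H (n : nat) : exists phi, smooth phi /\
    ((H1sq D (classical_jet phi - u)%R <= (n.+1%:R^-1)%:E)%E /\
     (sqint_on (surf D) (bsquare D) (phi - tau)%R <= (n.+1%:R^-1)%:E)%E).
  by have [phi sphi hphi] := H _ (pe n); exists phi.
have [phi Hphi] := choice H.
exists phi; rewrite E1 E2; split; first by move=> n; have [] := Hphi n.
- apply/sqrte_cvg0P; first by move=> n; exact: H1sq_ge0.
  move=> e e0; apply: filterS (near_infty_natSinv_lt (PosNum e0)) => n /ltW ne.
  by have [_ [h _]] := Hphi n; apply: le_trans h _; rewrite lee_fin.
- apply/sqrte_cvg0P; first by move=> n; exact: sqint_on_ge0.
  move=> e e0; apply: filterS (near_infty_natSinv_lt (PosNum e0)) => n /ltW ne.
  by have [_ [_ h]] := Hphi n; apply: le_trans h _; rewrite lee_fin.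
Qed.

Lemma L2_onB (nu : {measure set T2 -> \bar R}) (A : set T2) (f g : T2 -> R) :
  L2_on nu A f -> L2_on nu A g -> L2_on nu A (f - g).
Proof.
move=> /Lfun2P[mf f2] /Lfun2P[mg g2]; apply/Lfun2P; rewrite restrB; split.
  exact: measurable_funB.
apply: le_lt_trans (sqintB _ mf mg) _.
by apply: lte_add_pinfty; exact: lte_mul_pinfty.
Qed.

Lemma is_traceB D u v tau sigma : sobolev_measurable D u -> sobolev_measurable D v ->
  is_trace D u tau -> is_trace D v sigma -> is_trace D (u - v) (tau - sigma).
Proof.
move=> mu mv /is_traceP[Lt Ht] /is_traceP[Ls Hs]; apply/is_traceP; split.
  exact: L2_onB.
have mB := @measurable_bsquare R D.
(* The factor 2 of the squared triangle inequality, applied to two errors: 2 (e / 4) + 2 (e / 4) =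
   e. *)
move=> e e0; have e4 : 0 < e / 4 by lra.
have [phi sphi [p1 p2]] := Ht _ e4; have [psi spsi [q1 q2]] := Hs _ e4.
exists (phi - psi); first exact: smoothB.
have s2 (x y : \bar R) : (x <= (e / 4)%:E -> y <= (e / 4)%:E -> 2%:E * x + 2%:E * y <= e%:E)%E.
  move=> xe ye; have -> : (e%:E = 2%:E * (e / 4)%:E + 2%:E * (e / 4)%:E)%E.
    by rewrite -!EFinM -EFinD; congr EFin; field.
  by apply: leeD; apply: lee_wpmul2l.
have cphi := smooth_C1 sphi; have cpsi := smooth_C1 spsi.
split.
  rewrite jetB// [X in H1sq D X](_ : _ =
     (classical_jet phi - u) - (classical_jet psi - v)); last first.
    by rewrite !opprD !opprK addrACA.
  apply: le_trans (H1sqB _ _) (s2 _ _ p1 q1); apply: sobolev_measurableB => //;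
  exact: jet_measurable.
rewrite [X in sqint_on _ _ X](_ : _ = (phi - tau) - (psi - sigma)); last first.
  by rewrite !opprD !opprK addrACA.
have mt := ((L2_onP _ _ mB).1 Lt).1; have ms := ((L2_onP _ _ mB).1 Ls).1.
apply: le_trans (sqint_onB _ mB _ _) (s2 _ _ p2 q2); apply: measurable_funB => //;
apply: measurable_funTS; apply: continuous_measurable2.
  by have [] := cphi.
by have [] := cpsi.
Qed.

(** Dividing [trace_C1] by D leaves the coefficients 2 / D for the function and 2 D for its
    derivative; their sum dominates both. *)
Lemma trace_side_C1 D phi k : 0 < D -> C1_plane phi -> (k < 4)%N ->
  (\int[mu]_(t in I D) esq phi (side D k t) <=
   (2 / D + 2 * D)%:E * H1sq D (classical_jet phi))%E.
Proof.
move=> D0 c1 k4; rewrite H1sqE; last exact: jet_measurable.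
have := @trace_C1 _ D phi D0 c1 (side_bit k) _ (side_end_itv D0 k).
under eq_integral do rewrite -side_pt//.
set X := (\int[mu]_(_ in _) _)%E => H.
have D0' : (0 < D%:E)%E by rewrite lte_fin.
rewrite -(@lee_pmul2l _ D%:E)//; apply: le_trans H _.
rewrite muleA -EFinM (_ : D * (2 / D + 2 * D) = 2 + 2 * D ^+ 2); last by field; rewrite gt_eqF.
rewrite (ge0_muleDr _ (sqint_on_ge0 _ _ _) (gradsq_ge0 _ _)); apply: leeD.
  apply: lee_wpmul2r; first exact: sqint_on_ge0.
  by rewrite lee_fin lerDl mulr_ge0// sqr_ge0.
apply: (@le_trans _ _ ((2 * D ^+ 2)%:E * gradsq D (classical_jet phi))%E).
  apply: lee_wpmul2l; first by rewrite lee_fin mulr_ge0// sqr_ge0.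
  by rewrite /gradsq; case: (side_bit k); [rewrite leeDl//|rewrite leeDr//]; exact: sqint_on_ge0.
apply: lee_wpmul2r; first exact: gradsq_ge0.
by rewrite lee_fin lerDr.
Qed.

Lemma ge0_EFin (x : \bar R) : (0 <= x)%E -> (x < +oo)%E -> exists2 r : R, 0 <= r & x = r%:E.
Proof.
by move=> x0 xoo; exists (fine x); [exact: fine_ge0|rewrite fineK// ge0_fin_numE].
Qed.

(** 16 is 4 sides, times 2 for replacing tau by a smooth approximant, times 2 for replacing the jet
    of that approximant by u. *)
Definition Ctrace D := 16 * (2 / D + 2 * D).

Lemma Ctrace_ge0 D : 0 < D -> 0 <= Ctrace D.
Proof. by move=> D0; rewrite /Ctrace mulr_ge0// addr_ge0// ?divr_ge0 ?mulr_ge0// ltW. Qed.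

Lemma trace_le_H1sq D u tau : 0 < D -> sobolev_measurable D u -> (H1sq D u < +oo)%E ->
  is_trace D u tau ->
  (sqint_on (surf D) (bsquare D) tau <= (Ctrace D)%:E * H1sq D u)%E.
Proof.
move=> D0 um uoo /is_traceP[Lt Ht]; have mB := @measurable_bsquare R D.
have [mt t2] := (L2_onP _ _ mB).1 Lt.
have c0 : 0 <= 2 / D + 2 * D by rewrite addr_ge0// ?divr_ge0 ?mulr_ge0// ltW.
set c := (2 / D + 2 * D) in c0.
apply/lee_addgt0Pr => e e0.
(* The errors y in H1 and z on the boundary enter the final bound as 16 c y + 2 z, which is at most
   e for this choice. *)
have e'0 : 0 < e / (2 + 16 * c) by apply: divr_gt0 => //; lra.
have [phi sphi [p1 p2]] := Ht _ e'0; have cphi := smooth_C1 sphi.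
have mphi : measurable_fun (bsquare D : set T2) (phi : T2 -> R).
  by apply: measurable_funTS; apply: continuous_measurable2; have [] := cphi.
have h1 : (sqint_on (surf D) (bsquare D) tau <=
    2%:E * sqint_on (surf D) (bsquare D) phi + 2%:E * sqint_on (surf D) (bsquare D) (phi - tau)%R)%E.
  rewrite [X in sqint_on _ _ X](_ : tau = phi - (phi - tau)); last by rewrite opprB addrC subrK.
  by apply: sqint_onB => //; exact: measurable_funB.
have h3 : (H1sq D (classical_jet phi) <= 2%:E * H1sq D (classical_jet phi - u)%R + 2%:E * H1sq D u)%E.
  have -> : H1sq D (classical_jet phi) = H1sq D ((classical_jet phi - u) - (- u)).
    by rewrite opprK subrK.
  have nHN : H1sq D (- u) = H1sq D u by rewrite -sub0r H1sqC subr0.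
  rewrite -[in leRHS]nHN; apply: H1sqB.
    by apply: sobolev_measurableB => //; exact: jet_measurable.
  by rewrite -sub0r; apply: sobolev_measurableB => //; split => // *; exact: measurable_cst.
have [x x0 xE] := ge0_EFin (H1sq_ge0 D u) uoo.
have [y y0 yE] := ge0_EFin (H1sq_ge0 D _) (le_lt_trans p1 (ltry _)).
have [z z0 zE] := ge0_EFin (sqint_on_ge0 _ _ _) (le_lt_trans p2 (ltry _)).
rewrite xE yE -!EFinM -EFinD in h3.
have [w w0 wE] := ge0_EFin (H1sq_ge0 D _) (le_lt_trans h3 (ltry _)).
have h2 : (sqint_on (surf D) (bsquare D) phi <= (4 * (c * w))%:E)%E.
  rewrite sqint_on_surf//.
  apply: (@le_trans _ _ (\sum_(k < 4) (c * w)%:E)%E).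
    by apply: lee_sum => k _; rewrite EFinM -wE; exact: trace_side_C1.
  by rewrite sumEFin sumr_const card_ord -[in leLHS]mulr_natl.
have [s s0 sE] := ge0_EFin (sqint_on_ge0 _ _ _) (le_lt_trans h2 (ltry _)).
have [t t0 tE] := ge0_EFin (sqint_on_ge0 (surf D) (bsquare D) tau) t2.
rewrite sE zE tE -!EFinM -EFinD lee_fin in h1.
rewrite wE lee_fin in h3; rewrite sE lee_fin in h2.
rewrite yE lee_fin in p1; rewrite zE lee_fin in p2.
rewrite tE xE -EFinM -EFinD lee_fin /Ctrace -/c.
have eE : e = e / (2 + 16 * c) * (2 + 16 * c) by rewrite divfK// gt_eqF//; lra.
set e' := e / (2 + 16 * c) in eE p1 p2 e'0.
rewrite eE.
have : c * w <= c * (2 * y + 2 * x) by rewrite ler_wpM2l.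
have : c * y <= c * e' by rewrite ler_wpM2l.
by nra.
Qed.

End traces.

(** * The Poincare inequality *)

Section geometry.
Context {R : realType}.
Implicit Types (D : R) (Gamma : set (R * R)).

Lemma continuous_crd b : continuous (crd b : R * R -> R).
Proof. by case: b => p; [exact: cvg_fst|exact: cvg_snd]. Qed.

Lemma bsquare_pt D b p : bsquare D p -> 0 < crd b p < D ->
  exists e : bool, p = pt b (if e then D else 0) (crd b p).
Proof.
move=> [[/= p1 p2] pN] pb; move: p1 p2; rewrite !in_itv/= => p1 p2.
have pbN : ~ (0 < crd (~~ b) p < D).
  move=> h; apply: pN; rewrite /osquare; split; rewrite /= in_itv/=;
  by case: b pb h.
have : 0 <= crd (~~ b) p <= D by case: b {pb pbN}.
move=> /andP[h0 hD]; have [h0'|h0'] := eqVneq (crd (~~ b) p) 0.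
  by exists false; case: b h0' {pb pbN h0 hD pN} => /= <-; case: p {p1 p2}.
exists true; have h : crd (~~ b) p = D.
  by apply/eqP/negPn/negP => hD'; apply: pbN; rewrite !lt_neqAle eq_sym h0' h0 hD' hD.
by case: b h {pb pbN h0 hD h0' pN} => /= <-; case: p {p1 p2}.
Qed.

Lemma csquare_crd D b p : csquare D p -> 0 <= crd b p <= D.
Proof. by move=> [/= p1 p2]; move: p1 p2; rewrite !in_itv/=; case: b. Qed.

(** The inverse g of a chart is injective, so g 0 and g 1 differ in some coordinate, and the
    intermediate value theorem fills the interval between the two values. The side e may vary with
    t, because the arc may turn around corners. *)
Lemma manifold_boundary_interval D Gamma : Gamma `<=` bsquare D ->
  one_manifold Gamma -> Gamma !=set0 ->
  exists b a c, [/\ 0 <= a, a < c, c <= D &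
    forall t, a < t < c -> exists e : bool, Gamma (pt b (if e then D else 0) t)].
Proof.
move=> GB mG [p Gp]; have [U [oU Up hU]] := mG p Gp.
(* Both chart models, the line and the half-line, contain [0, 1]; interior points and end points of
   the manifold are thus treated together. *)
have [B [B01 [f [g [[cf cg] fA gB fK gK]]]]] : exists B : set R,
    `[0, 1]%classic `<=` B /\ homeomorphic_on (Gamma `&` U) B.
  case: hU => hU; first by exists setT.
  by exists (`[0, +oo[%classic); split=> // x /=; rewrite !in_itv/= => /andP[->].
have {}cg : {within `[0, 1]%classic, continuous g} by apply: continuous_subspaceW cg.
have G01 s : 0 <= s <= 1 -> Gamma (g s).
  move=> s01; have Bs : B s by apply: B01; rewrite /= in_itv.
  by have [] := gB _ (ex_intro2 _ _ s Bs erefl).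
have g01 : g 0 != g 1.
  apply/eqP => /(congr1 f); rewrite !gK ?inE; last 2 first.
  - by apply: B01; rewrite /= in_itv/= lexx ler01.
  - by apply: B01; rewrite /= in_itv/= lexx ler01.
  by apply/eqP; rewrite eq_sym oner_eq0.
have [b hb] : exists b, crd b (g 0) != crd b (g 1).
  have [e1|] := eqVneq (g 0).1 (g 1).1; last by exists true.
  have [e2|] := eqVneq (g 0).2 (g 1).2; last by exists false.
  by move: g01; rewrite [g 0]surjective_pairing e1 e2 -surjective_pairing eqxx.
pose h := crd b \o g.
have ch : {within `[0, 1], continuous h}.
  apply/subspace_continuousP => x x01.
  have cgx := (subspace_continuousP _ _).1 cg x x01.
  exact: cvg_comp cgx (@continuous_crd b (g x)).
have crdD s : 0 <= s <= 1 -> 0 <= h s <= D.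
  by move=> s01; apply: csquare_crd; have [] := GB _ (G01 s s01).
have h0D := crdD 0 ltac:(by rewrite lexx ler01); have h1D := crdD 1 ltac:(by rewrite lexx ler01).
exists b, (Num.min (h 0) (h 1)), (Num.max (h 0) (h 1)); split.
- by rewrite le_min; case/andP: h0D => -> _; case/andP: h1D.
- move: hb; rewrite -[crd b (g 0)]/(h 0) -[crd b (g 1)]/(h 1) => hb.
  by case/orP: (lt_total hb) => hlt; rewrite lt_max !gt_min hlt ?orbT.
- by rewrite ge_max; case/andP: h0D => _ ->; case/andP: h1D.
move=> t /andP[t1 t2].
have [s] := @IVT _ h 0 1 t ler01 ch ltac:(by rewrite (ltW t1) (ltW t2)).
rewrite in_itv/= => s01 hs.
have tD : 0 < crd b (g s) < D.
  rewrite -[crd b (g s)]/(h s) hs; apply/andP; split.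
    by apply: le_lt_trans t1; rewrite le_min; case/andP: h0D => -> _; case/andP: h1D.
  by apply: lt_le_trans t2 _; rewrite ge_max; case/andP: h0D => _ ->; case/andP: h1D.
have [e he] := bsquare_pt (GB _ (G01 s s01)) tD.
by exists e; rewrite -hs -[h s]/(crd b (g s)) -he; exact: G01.
Qed.

End geometry.

(** * Uniqueness of traces and linearity of V *)

Section L2_products.
Context d (T : measurableType d) (R : realType).
Variable mu : {measure set T -> \bar R}.

Lemma integrable_mul_sqint_on (A : set T) (f g : T -> R) : measurable A ->
  measurable_fun A f -> measurable_fun A g ->
  (sqint_on mu A f < +oo)%E -> (sqint_on mu A g < +oo)%E ->
  mu.-integrable A (EFin \o (fun x => f x * g x)).
Proof.
move=> mA mf mg f2 g2; apply/(integrable_mkcond _ mA).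
rewrite (_ : (EFin \o (fun x => f x * g x)) \_ A = EFin \o (fun x => (f \_ A) x * (g \_ A) x)).
  rewrite !sqint_onE in f2 g2.
  by apply: integrable_mul_L2 => //; apply/(measurable_restrictT _ mA).1.
by apply/funext => x; rewrite /= !patchE; case: ifPn => //= _; rewrite mulr0.
Qed.

Lemma sqint_on_eq0 (A : set T) (f : T -> R) : measurable A -> measurable_fun A f ->
  sqint_on mu A f = 0%E -> {ae mu, forall x, A x -> f x = 0}.
Proof.
move=> mA mf f0.
have msq : measurable_fun A (EFin \o (fun x => f x ^+ 2)).
  by apply/measurable_EFinP; exact: measurable_funX.
have := (ae_eq_integral_abs mu mA msq).1.
have -> : (\int[mu]_(x in A) `|(EFin \o (fun x0 => (f x0 ^+ 2)%R)) x| = 0)%E.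
  by rewrite -[RHS]f0; apply: eq_integral => x _; rewrite /= ger0_norm ?sqr_ge0.
move=> /(_ erefl); apply: filterS => x /= /[apply] -[] /eqP.
by rewrite sqrf_eq0 => /eqP.
Qed.

End L2_products.

Section Vspace_theory.
Context {R : realType}.
Notation T2 := (measurableTypeR R * measurableTypeR R)%type.
Notation mu := (@lebesgue_measure R).
Notation I D := (`]0%R, D[%classic).
Variables (D : R).
Hypothesis D0 : 0 < D.
Implicit Types (u v : @sobolev R).
Notation Q := (osquare D).
Let mQ := @measurable_osquare R D.
Let mB := @measurable_bsquare R D.

Lemma leb2_osquare : leb2 (Q : set T2) = (D * D)%:E.
Proof.
transitivity (mu (I D) * mu (I D))%E; last by rewrite lebesgue_measure_side.
by apply: product_measure1E; exact: measurable_itv.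
Qed.

Lemma compact_csquare : compact (csquare D).
Proof. by apply: compact_setX; exact: segment_compact. Qed.

Lemma within_csquare_bounded (psi : R * R -> R) (A : set (R * R)) : A `<=` csquare D ->
  {within csquare D, continuous psi} -> exists M, forall x, A x -> `|psi x| <= M.
Proof.
move=> AC cpsi.
have /compact_bounded[M [Mreal HM]] := continuous_compact cpsi compact_csquare.
by exists (M + 1) => x Ax; apply: (HM (M + 1)); [rewrite ltrDl|exists x => //; exact: AC].
Qed.

Lemma osquare_csquare : Q `<=` csquare D.
Proof.
by move=> p [/= p1 p2]; split; move: p1 p2; rewrite /= !in_itv/= => /andP[? ?] /andP[? ?];
  rewrite !ltW.
Qed.

Lemma sqint_on_bounded (psi : T2 -> R) (M : R) : measurable_fun (Q : set T2) psi ->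
  (forall x, Q x -> `|psi x| <= M) -> (sqint_on leb2 (Q : set T2) psi < +oo)%E.
Proof.
move=> mpsi HM.
apply: (@le_lt_trans _ _ (\int[leb2]_(x in (Q : set T2)) (cst (M ^+ 2)%:E) x)%E).
  apply: ge0_le_integral => //.
  - by move=> x _; rewrite lee_fin sqr_ge0.
  - by apply/measurable_EFinP; exact: measurable_funX.
  - move=> x Qx; rewrite lee_fin -real_normK ?num_real//.
    by rewrite lerXn2r// ?nnegrE//; [exact: le_trans (HM _ Qx)|exact: HM].
by rewrite integral_cst// leb2_osquare -EFinM ltry.
Qed.

Lemma sqint_on_continuous (psi : R * R -> R) : continuous psi -> (sqint_on leb2 (Q : set T2) psi < +oo)%E.
Proof.
move=> cpsi; have [M HM] := within_csquare_bounded osquare_csquare (continuous_subspaceT cpsi).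
by apply: (sqint_on_bounded _ HM); apply: measurable_funTS; exact: continuous_measurable2.
Qed.

(** The weak derivative identity is linear once the integrals split; they do, since an L2 function
    times a function continuous on the closed square is integrable. *)
Lemma H1B u v : H1 D u -> H1 D v -> H1 D (u - v).
Proof.
move=> [u1 u2 uw] [v1 v2 vw]; split.
- exact: L2_onB.
- by move=> b; apply: L2_onB; [exact: u2|exact: v2].
move=> b phi tphi; have [sphi _ _] := tphi; have [cphi cd _] := smooth_C1 sphi.
have int (w psi : R * R -> R) : L2_on leb2 Q w -> continuous psi ->
    leb2.-integrable (Q : set T2) (EFin \o (fun x => w x * psi x)).
  move=> /(L2_onP _ _ mQ)[mw w2] cpsi; apply: integrable_mul_sqint_on => //.
    by apply: measurable_funTS; exact: continuous_measurable2.
  exact: sqint_on_continuous.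
have sub (w w' psi : R * R -> R) : L2_on leb2 Q w -> L2_on leb2 Q w' -> continuous psi ->
    \int[leb2]_(x in Q) ((w x - w' x) * psi x) =
    \int[leb2]_(x in Q) (w x * psi x) - \int[leb2]_(x in Q) (w' x * psi x).
  move=> Lw Lw' cpsi; rewrite -RintegralB//; [|exact: int..].
  by apply: eq_Rintegral => x _; rewrite mulrBl.
rewrite [LHS](sub _ _ _ u1 v1 (cd b)) [X in _ = - X](sub _ _ _ (u2 b) (v2 b) cphi).
by rewrite uw// vw// opprB opprK addrC.
Qed.

Lemma H1sq0 : H1sq D (0 : @sobolev R) = 0%E.
Proof.
apply: integral0_eq => x _; rewrite big_bool.
by transitivity ((0 ^+ 2 + (0 ^+ 2 + 0 ^+ 2) : R)%:E) => //; rewrite expr0n/= !addr0.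
Qed.

(** The difference of two traces of u is a trace of u - u = 0, and the trace inequality makes its
    norm vanish. *)
Lemma is_trace_unique u tau sigma : sobolev_measurable D u ->
  is_trace D u tau -> is_trace D u sigma ->
  {ae surf D, forall x, bsquare D x -> tau x = sigma x}.
Proof.
move=> um ht hs; have := is_traceB um um ht hs; rewrite subrr => h0.
have m0 : sobolev_measurable D (0 : @sobolev R).
  by split => // *; exact: measurable_cst.
have := trace_le_H1sq D0 m0 _ h0; rewrite H1sq0 mule0 => /(_ (ltry _)) h.
have {}h : sqint_on (surf D) (bsquare D) (tau - sigma) = 0%E.
  by apply/eqP; rewrite eq_le h sqint_on_ge0.
have mt := ((L2_onP _ _ mB).1 ht.1).1; have ms := ((L2_onP _ _ mB).1 hs.1).1.
have := sqint_on_eq0 mB (measurable_funB mt ms) h.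
by apply: filterS => x /[apply] /eqP; rewrite subr_eq0 => /eqP.
Qed.

Lemma trace_is_trace u tau : is_trace D u tau -> is_trace D u (trace D u).
Proof. by move=> ut; rewrite /trace; apply: (@xgetPex _ (fun=> 0) [set tau | is_trace D u tau]); exists tau. Qed.

(** [trace] chooses its value for u - v independently of those for u and v; uniqueness identifies it
    almost everywhere with their difference. *)
Lemma VspaceB Gamma1 u v : Gamma1 `<=` bsquare D -> Vspace D Gamma1 u -> Vspace D Gamma1 v ->
  Vspace D Gamma1 (u - v).
Proof.
move=> GB [u1 u2 u3] [v1 v2 v3].
have mu' := H1_measurable u1; have mv := H1_measurable v1.
have uv := is_traceB mu' mv u2 v2.
have huv := trace_is_trace uv; split => //; first exact: H1B.
have h := is_trace_unique (sobolev_measurableB mu' mv) huv uv.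
have FF := ae_filter_ringOfSetsType (surf D).
apply: (filterS _ (filterI (filterI u3 v3) h)) => x [[u0 v0] uvx] Gx.
rewrite uvx; last exact: GB.
by transitivity (trace D u x - trace D v x) => //; rewrite u0// v0// subrr.
Qed.

End Vspace_theory.

(** * The Poincare inequality on V *)

Section poincare.
Context {R : realType}.
Notation T1 := (measurableTypeR R).
Notation T2 := (measurableTypeR R * measurableTypeR R)%type.
Notation mu := (@lebesgue_measure R).
Notation I D := (`]0%R, D[%classic).
Variables (D : R).
Hypothesis D0 : 0 < D.
Implicit Types (u v : @sobolev R).
Notation Q := (osquare D).
Let mQ := @measurable_osquare R D.
Let mB := @measurable_bsquare R D.

(** Number of the side met by lines of direction [dir b] at their end e, where e = true is the end
    at coordinate D. *)
Definition side_of (b e : bool) : nat := ((if b then 0 else 2) + e)%N.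

Lemma gradsq_jet b (phi : R * R -> R) : gradsq D (classical_jet phi) =
  (sqint_on leb2 (Q : set T2) ('D_(dir b) phi) + sqint_on leb2 (Q : set T2) ('D_(dir (~~ b)) phi))%E.
Proof. by case: b; [reflexivity|exact: addeC]. Qed.

Lemma side_of_lt b e : (side_of b e < 4)%N. Proof. by case: b; case: e. Qed.

Lemma side_ofE b (e : bool) t : side D (side_of b e) t = pt b (if e then D else 0) t.
Proof. by case: b; case: e. Qed.

(** The side on which Gamma1 is met changes with the parameter, so a single null set has to serve
    all four sides: the union of the four pulled-back ones. *)
Lemma ae_zero_sides Gamma1 (tau : R * R -> R) : {ae surf D, forall x, Gamma1 x -> tau x = 0} ->
  exists N : set T1, [/\ measurable N, mu N = 0%E & forall b e t, I D t -> ~ N t ->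
    Gamma1 (pt b (if e then D else 0) t) -> tau (pt b (if e then D else 0) t) = 0].
Proof.
move=> H; have /choice[N HN] (k : 'I_4) : exists N : set T1, [/\ measurable N, mu N = 0%E &
    forall t, 0 <= t <= D -> ~ N t -> Gamma1 (side D k t) -> tau (side D k t) = 0].
  have [N [mN N0 HN]] := surf_ae (ltn_ord k) H; exists N; split => // t tD Nt.
  by apply: contrapT => h; apply: Nt; apply: HN => /(_ tD).
exists (\big[setU/set0]_(k < 4) N k); split.
- by apply: bigsetU_measurable => k _; have [] := HN k.
- apply/eqP; rewrite -measure_le0.
  apply: le_trans (@content_subadditive _ _ _ mu (\big[setU/set0]_(k < 4) N k) (fun k => N (inord k)) 4 _ _ _) _.
  + by move=> k _; have [] := HN (inord k).
  + by apply: bigsetU_measurable => k _; have [] := HN k.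
  + rewrite -!bigcup_seq => x [k /= _ Nx]; exists k => //=; first exact: mem_index_enum.
    by rewrite inord_val.
  + by rewrite big1// => k _; have [] := HN (inord k).
move=> b e t tI Nt; rewrite -side_ofE; have k4 := side_of_lt b e.
have [_ _ h] := HN (Ordinal k4); apply: h.
  by move: tI; rewrite /= in_itv/= => /andP[? ?]; rewrite !ltW.
move=> Nk; apply: Nt; rewrite -bigcup_seq; exists (Ordinal k4) => //=.
exact: mem_index_enum.
Qed.

(** Apply [poincare_C1] to a smooth approximant [phi]. At the chosen ends the trace [tau] vanishes,
    so phi^2 = (phi - tau)^2 there; the boundary term is an approximation error and only the
    gradient survives in the limit. *)
Lemma poincare_V Gamma1 Gamma2 : boundary_decomposition D Gamma1 Gamma2 ->
  exists2 C : R, 0 <= C & forall u, Vspace D Gamma1 u ->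
    (sqint_on leb2 (Q : set T2) u.1 <= C%:E * gradsq D u)%E.
Proof.
move=> [G12 _ [mG1 G1n] _ _].
have GB : Gamma1 `<=` bsquare D by rewrite -G12; exact: subsetUl.
have [b [a [c [a0 ac cD Gac]]]] := manifold_boundary_interval GB mG1 G1n.
pose len := c - a; have len0 : 0 < len by rewrite subr_gt0.
(* Dominates both gradient coefficients of [poincare_C1]. The factor 4 below comes from passing from
   u to [phi] and from the gradient of [phi] back to that of u. *)
pose c1 := 4 * D ^+ 3 + 2 * D ^+ 2 * len.
have D2 : 0 <= D ^+ 2 by rewrite sqr_ge0.
have D3 : 0 <= D ^+ 3 by rewrite exprn_ge0// ltW.
have c10 : 0 <= c1 by rewrite /c1 addr_ge0// mulr_ge0// ?mulr_ge0// ltW.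
exists (4 * c1 / len); first by rewrite divr_ge0 ?mulr_ge0// ltW.
move=> u [uH ut uG].
have um := H1_measurable uH; have uoo := H1sq_lty uH.
have [N [mN N0 HN]] := ae_zero_sides uG.
have [Lt Ht] := (is_traceP D u _).1 ut; set tau := trace D u in ut uG HN Lt Ht.
have [mt t2] := (L2_onP _ _ mB).1 Lt.
pose J : set T1 := `]a, c[%classic `\` N.
have mac : measurable (`]a, c[%classic : set T1) by exact: measurable_itv.
have mJ : measurable J by exact: measurableD.
have JI : J `<=` I D.
  by move=> t [/=]; rewrite !in_itv/= => /andP[ta tc] _; apply/andP; split; lra.
have muJ : mu J = len%:E.
  have h : mu (`]a, c[%classic : set T1) = len%:E.
    by rewrite lebesgue_measure_itv/= lte_fin ac EFinB.
  have hJ : mu (`]a, c[%classic : set T1) = (mu J + mu (`]a, c[%classic `&` N))%E.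
    exact: measureDI.
  have hN : mu (`]a, c[%classic `&` N) = 0%E.
    by apply/eqP; rewrite -measure_le0 -N0 le_measure ?inE//; exact: measurableI.
  by rewrite -h hJ hN adde0.
apply/lee_addgt0Pr => e e0.
(* The total coefficient with which the squared approximation error enters the final bound. *)
pose K := 2 + 8 * D ^+ 2 / len + 4 * c1 / len.
have K0 : 0 < K.
  by rewrite /K -addrA ltr_pwDl// addr_ge0// divr_ge0// ?mulr_ge0// ltW.
have e'0 : 0 < e / K by apply: divr_gt0.
have [phi sphi [p1 p2]] := Ht _ e'0; have cphi := smooth_C1 sphi.
have [cp cd _] := cphi.
pose dl := (phi - tau) \_ (bsquare D).
have mdl : measurable_fun (setT : set T2) (dl : T2 -> R).
  have mp : measurable_fun (bsquare D : set T2) (phi : T2 -> R).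
    by apply: measurable_funTS; exact: (continuous_measurable2 cp).
  have mpt : measurable_fun (bsquare D : set T2) (phi - tau : T2 -> R).
    exact: (measurable_funB mp mt).
  exact: ((measurable_restrictT _ mB).1 mpt).
have mesq := measurable_sqr_EFin mdl.
have mside e1 : measurable_fun (setT : set T1) ((fun t => esq dl (side D (side_of b e1) t)) : T1 -> \bar R).
  exact: measurableT_comp mesq (measurable_side D _).
(* Both sides are summed, since the one that meets Gamma1 depends on t. *)
pose E (t : R) : \bar R := (esq dl (side D (side_of b false) t) + esq dl (side D (side_of b true) t))%E.
have mE : measurable_fun (setT : set T1) (E : T1 -> \bar R) by exact: emeasurable_funD.
have E0 t : (0 <= E t)%E by rewrite adde_ge0 ?esq_ge0.
have JE t : J t -> exists2 e, 0 <= e <= D & (esq phi (pt b e t) <= E t)%E.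
  move=> Jt; have tI := JI _ Jt; case: Jt => [tac Nt].
  have [e1 He1] := Gac t ltac:(by move: tac; rewrite /= in_itv).
  exists (if e1 then D else 0); first by case: (e1); rewrite lexx ltW.
  have := HN b e1 t tI Nt He1; rewrite -side_ofE => tau0.
  have -> : esq phi (side D (side_of b e1) t) = esq dl (side D (side_of b e1) t).
    rewrite /esq /dl patchE mem_set; last first.
      apply: bsquare_side => //; first exact: side_of_lt.
      by move: tI; rewrite /= in_itv/= => /andP[? ?]; rewrite !ltW.
    by rewrite [(phi - tau) _](_ : _ = phi (side D (side_of b e1) t) - tau (side D (side_of b e1) t))// tau0 subr0.
  by rewrite /E; case: (e1); [rewrite leeDr//|rewrite leeDl//]; exact: esq_ge0.
have intE : (\int[mu]_(t in J) E t <= (e / K)%:E)%E.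
  apply: le_trans p2; rewrite sqint_onE -/dl /sqint surf_integral//; last first.
    by move=> p; exact: esq_ge0.
  apply: (@le_trans _ _ (\int[mu]_(t in I D) E t)%E).
    by apply: ge0_subset_integral => //; exact: measurable_funTS.
  have mIs e1 := @measurable_funTS _ _ _ _ (I D) _ (mside e1).
  rewrite /E ge0_integralD//; [|by move=> *; exact: esq_ge0|exact: mIs|by move=> *; exact: esq_ge0|exact: mIs].
  have i0 k : (0 <= \int[mu]_(t in I D) (dl (side D k t) ^+ 2)%:E)%E.
    by apply: integral_ge0 => t _; rewrite lee_fin sqr_ge0.
  rewrite !big_ord_recl big_ord0 adde0 /=.
  case: (b) => /=.
    by rewrite [leRHS]addeA; apply: leeDl; apply: adde_ge0; [exact: (i0 2%N)|exact: (i0 3%N)].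
  by rewrite [leRHS]addeA; apply: leeDr; apply: adde_ge0; [exact: (i0 0%N)|exact: (i0 1%N)].
have := @poincare_C1 _ D phi D0 cphi b J len E mJ JI muJ mE E0 JE.
have h1 : (sqint_on leb2 (Q : set T2) u.1 <=
    2%:E * sqint_on leb2 (Q : set T2) phi + 2%:E * sqint_on leb2 (Q : set T2) (phi - u.1)%R)%E.
  rewrite [X in (sqint_on _ _ X <= _)%E](_ : u.1 = phi - (phi - u.1)); last by rewrite opprB addrC subrK.
  have mph : measurable_fun (Q : set T2) (phi : T2 -> R).
    by apply: measurable_funTS; exact: (continuous_measurable2 cp).
  by apply: sqint_onB => //; apply: measurable_funB => //; exact: um.1.
have jm := jet_measurable D cphi.
have h3 : (gradsq D (classical_jet phi) <= 2%:E * gradsq D (classical_jet phi - u)%R + 2%:E * gradsq D u)%E.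
  have -> : gradsq D (classical_jet phi) = gradsq D ((classical_jet phi - u) - (- u)).
    by rewrite opprK subrK.
  have gN : gradsq D (- u) = gradsq D u by rewrite -sub0r gradsqC subr0.
  rewrite -[in leRHS]gN; apply: gradsqB.
    exact: sobolev_measurableB.
  by rewrite -sub0r; apply: sobolev_measurableB => //; split => // *; exact: measurable_cst.
rewrite H1sqE in p1; last exact: sobolev_measurableB.
have p1a := le_trans (leeDl _ (gradsq_ge0 D _)) p1.
have p1b := le_trans (leeDr _ (sqint_on_ge0 leb2 Q _)) p1.
have uoo' := uoo; rewrite H1sqE// in uoo'.
have [x x0 xE] := ge0_EFin (sqint_on_ge0 leb2 Q _) (le_lt_trans (leeDl _ (gradsq_ge0 D _)) uoo').
have [g g0 gE] := ge0_EFin (gradsq_ge0 D _) (le_lt_trans (leeDr _ (sqint_on_ge0 leb2 Q _)) uoo').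
have [y y0 yE] := ge0_EFin (sqint_on_ge0 leb2 Q _) (le_lt_trans p1a (ltry _)).
have [z z0 zE] := ge0_EFin (gradsq_ge0 D _) (le_lt_trans p1b (ltry _)).
have [w w0 wE] := ge0_EFin (sqint_on_ge0 leb2 Q phi) (sqint_on_continuous D0 cp).
have E0J : (0 <= \int[mu]_(t in J) E t)%E by apply: integral_ge0 => t _; exact: E0.
have [i i0 iE] := ge0_EFin E0J (le_lt_trans intE (ltry _)).
have [r r0 rE] := ge0_EFin (sqint_on_ge0 leb2 Q ('D_(dir b) phi)) (sqint_on_continuous D0 (cd _)).
have [s s0 sE] := ge0_EFin (sqint_on_ge0 leb2 Q ('D_(dir (~~ b)) phi)) (sqint_on_continuous D0 (cd _)).
have rsE : gradsq D (classical_jet phi) = (r + s)%:E.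
  by rewrite (gradsq_jet b) rE sE.
have iA : (\int[leb2]_(p in Q) esq phi p)%E = w%:E by exact: wE.
have iB : (\int[leb2]_(p in Q) esq ('D_(dir b) phi) p)%E = r%:E by exact: rE.
have iC : (\int[leb2]_(p in Q) esq ('D_(dir (~~ b)) phi) p)%E = s%:E by exact: sE.
rewrite iA iB iC iE -!EFinM -!EFinD lee_fin => main.
have yE' : sqint_on leb2 (Q : set T2) (phi - u.1) = y%:E by exact: yE.
rewrite xE wE yE' -!EFinM -!EFinD lee_fin in h1.
rewrite rsE zE gE -!EFinM -!EFinD lee_fin in h3.
rewrite yE lee_fin in p1a; rewrite zE lee_fin in p1b; rewrite iE lee_fin in intE.
rewrite xE gE -EFinM -EFinD lee_fin.
set e' := e / K in p1a p1b intE e'0.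
have eE : e = e' * K by rewrite /e' divfK// gt_eqF.
have hw : len * w <= 4 * D ^+ 2 * e' + c1 * (2 * e' + 2 * g).
  apply: le_trans main _.
  have k1 : 4 * D ^+ 3 <= c1 by rewrite /c1 lerDl !mulr_ge0// ltW.
  have k2 : 2 * D ^+ 2 * len <= c1 by rewrite /c1 lerDr mulr_ge0.
  have : 4 * D ^+ 2 * i <= 4 * D ^+ 2 * e' by apply: ler_wpM2l => //; rewrite mulr_ge0.
  have : c1 * (r + s) <= c1 * (2 * e' + 2 * g) by apply: ler_wpM2l => //; lra.
  have : 4 * D ^+ 3 * r <= c1 * r by apply: ler_wpM2r.
  have : 2 * D ^+ 2 * len * s <= c1 * s by apply: ler_wpM2r.
  lra.
have {}hw : w <= (4 * D ^+ 2 * e' + c1 * (2 * e' + 2 * g)) / len.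
  by rewrite ler_pdivlMr// mulrC.
rewrite eE /K; apply: le_trans h1 _.
have -> : 4 * c1 / len * g + e' * (2 + 8 * D ^+ 2 / len + 4 * c1 / len) =
   2 * ((4 * D ^+ 2 * e' + c1 * (2 * e' + 2 * g)) / len) + 2 * e'.
  by field; rewrite gt_eqF.
lra.
Qed.

End poincare.

(** * The pathwise estimate *)

Section Rintegral_facts.
Context d (T : measurableType d) (R : realType).
Variable mu : {measure set T -> \bar R}.
Implicit Types (A : set T) (f g : T -> R).

Lemma ae_le_Rintegral A f g : measurable A ->
  mu.-integrable A (EFin \o f) -> mu.-integrable A (EFin \o g) ->
  {ae mu, forall x, A x -> f x <= g x} ->
  \int[mu]_(x in A) f x <= \int[mu]_(x in A) g x.
Proof.
move=> mA fi gi fg; rewrite -subr_ge0 -RintegralB//.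
have mf := measurable_int _ fi; have mg := measurable_int _ gi.
have mgf : measurable_fun A (EFin \o (fun x => g x - f x)).
  apply/measurable_EFinP; apply: measurable_funB; exact/measurable_EFinP.
rewrite /Rintegral.
rewrite (@ae_eq_integral _ _ _ mu A (fun x => (`|g x - f x|)%:E))//.
- by apply: fine_ge0; apply: integral_ge0 => x _; rewrite lee_fin.
- by apply/measurable_EFinP; apply: measurableT_comp => //; apply/measurable_EFinP.
- by apply: filterS fg => x h Ax; rewrite ger0_norm// subr_ge0 h.
Qed.

Lemma integrable_sqr_on A f : measurable A -> measurable_fun A f -> (sqint_on mu A f < +oo)%E ->
  mu.-integrable A (EFin \o (fun x => f x ^+ 2)).
Proof. by move=> mA mf f2; exact: (integrable_mul_sqint_on mA mf mf f2 f2). Qed.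

Lemma bounded_mul_integrable A (h f : T -> R) (M : R) : measurable A -> measurable_fun A h ->
  (forall x, A x -> `|h x| <= M) -> mu.-integrable A (EFin \o f) ->
  mu.-integrable A (EFin \o (fun x => h x * f x)).
Proof.
move=> mA mh hM fi.
apply: (integrableMr mA mh _ fi).
exists M; split; first exact: num_real.
by move=> y My x Ax /=; exact: le_trans (hM _ Ax) (ltW My).
Qed.

End Rintegral_facts.

Section pathwise.
Context {R : realType}.
Notation T2 := (measurableTypeR R * measurableTypeR R)%type.
Variables (D : R) (Gamma1 Gamma2 : set (R * R)).
Hypothesis D0 : 0 < D.
Hypothesis G1B : Gamma1 `<=` bsquare D.
Hypothesis G2B : Gamma2 `<=` bsquare D.
Variable CP : R.
Hypothesis CP0 : 0 <= CP.
Hypothesis HCP : forall u, Vspace D Gamma1 u ->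
    (sqint_on leb2 (osquare D : set T2) u.1 <= CP%:E * gradsq D u)%E.
Notation Q := (osquare D).
Let mQ := @measurable_osquare R D.
Implicit Types (u v w : @sobolev R).

Definition dotg u v (x : R * R) : R := \sum_(b : bool) u.2 b x * v.2 b x.

Lemma dotgE u v x : dotg u v x = u.2 true x * v.2 true x + u.2 false x * v.2 false x.
Proof. by rewrite /dotg big_bool. Qed.

Lemma H1_grad u b : H1 D u -> measurable_fun (Q : set T2) (u.2 b : T2 -> R) /\
  (sqint_on leb2 (Q : set T2) (u.2 b) < +oo)%E.
Proof. by move=> [_ u2 _]; exact/(L2_onP _ _ mQ). Qed.

Lemma integrable_dotg u v : H1 D u -> H1 D v ->
  leb2.-integrable (Q : set T2) (EFin \o (dotg u v)).
Proof.
move=> uH vH.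
have H b : leb2.-integrable (Q : set T2) (EFin \o (fun x => u.2 b x * v.2 b x)).
  have [mub u2] := H1_grad b uH; have [mvb v2] := H1_grad b vH.
  exact: integrable_mul_sqint_on.
have := integrableD mQ (H true) (H false).
by apply: eq_integrable => // x _; rewrite /= dotgE EFinD.
Qed.

Lemma gradsq_dotg u : H1 D u -> gradsq D u = (\int[leb2]_(x in Q) dotg u u x)%:E.
Proof.
move=> uH.
have [mt t2] := H1_grad true uH; have [mf f2] := H1_grad false uH.
have E : \int[leb2]_(x in Q) dotg u u x =
    \int[leb2]_(x in Q) (u.2 true x ^+ 2) + \int[leb2]_(x in Q) (u.2 false x ^+ 2).
  rewrite -RintegralD//; [|exact: integrable_sqr_on..].
  by apply: eq_Rintegral => x _; rewrite dotgE !expr2.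
rewrite E EFinD /Rintegral !fineK//; apply: integrable_fin_num => //; exact: integrable_sqr_on.
Qed.

Lemma trace_V u : Vspace D Gamma1 u ->
  (sqint_on (surf D) (bsquare D : set T2) (trace D u) <=
   (Ctrace D * (CP + 1))%:E * gradsq D u)%E.
Proof.
move=> uV; have [uH ut _] := uV; have um := H1_measurable uH.
apply: le_trans (trace_le_H1sq D0 um (H1sq_lty uH) ut) _.
rewrite (EFinM (Ctrace D)) -muleA; apply: lee_wpmul2l; first by rewrite lee_fin Ctrace_ge0.
rewrite H1sqE// EFinD ge0_muleDl ?lee_fin// mul1e; apply: leeD => //; exact: HCP.
Qed.

(** The Poincare constant controls the volume term and the trace constant the boundary term; the
    final 1 makes the sum positive, so that it can serve as a Young weight. *)
Definition Cweak : R := CP + Ctrace D * (CP + 1) + 1.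

Lemma Cweak_gt0 : 0 < Cweak.
Proof. by rewrite /Cweak ltr_wpDl// addr_ge0// mulr_ge0 ?Ctrace_ge0// addr_ge0. Qed.

(** Young's inequality with weight l, from the square (l p - q)^2. Two sets occur because g lives on
    Gamma2 while the trace is square integrable on the whole boundary. *)
Lemma integral_mul_le (nu : {measure set T2 -> \bar R}) (A B : set T2) (g tau : T2 -> R) (l : R) :
  0 < l -> A `<=` B ->
  L2_on nu A g -> L2_on nu B tau ->
  \int[nu]_(x in A) (g x * tau x) <=
    l / 2 * fine (sqint_on nu A g) + (2 * l)^-1 * fine (sqint_on nu B tau).
Proof.
move=> l0 AB /Lfun2P[mg g2] /Lfun2P[mt t2].
rewrite Rintegral_mkcond [X in \int[nu]_x X x](_ : _ = fun x => (g \_ A) x * (tau \_ B) x); last first.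
  apply/funext => x; rewrite !patchE; case: ifPn => xA; last by rewrite mul0r.
  by rewrite (mem_set (AB _ (set_mem xA))).
rewrite !sqint_onE -[fine _]/(\int[nu]_x ((g \_ A) x ^+ 2)) -[fine (sqint nu (tau \_ B))]/(\int[nu]_x ((tau \_ B) x ^+ 2)).
have ig := integrable_sqr mg g2; have it := integrable_sqr mt t2.
rewrite -!RintegralZl// -RintegralD//; [|exact: (integrableZl measurableT (l / 2) ig)
  |exact: (integrableZl measurableT (2 * l)^-1 it)].
apply: le_Rintegral => //.
- exact: integrable_mul_L2.
- exact: (integrableD measurableT (integrableZl measurableT (l / 2) ig)
    (integrableZl measurableT (2 * l)^-1 it)).
move=> x _; set p := (g \_ A) x; set q := (tau \_ B) x.
have -> : l / 2 * p ^+ 2 + (2 * l)^-1 * q ^+ 2 = p * q + (l * p - q) ^+ 2 / (2 * l).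
  by field; rewrite gt_eqF.
by rewrite lerDl divr_ge0 ?sqr_ge0// mulr_ge0// ltW.
Qed.

(** Testing with u and absorbing half of m G, where G is the squared gradient norm, leaves G <= (2 /
    m) (l / 2) times the data; with l = Cweak / m this gives the factor Cweak / m^2. *)
Lemma energy_le (a f g : R * R -> R) (m M : R) u : 0 < m ->
  measurable_fun (Q : set T2) (a : T2 -> R) ->
  (forall x, Q x -> m <= a x <= M) ->
  L2_on leb2 Q f -> L2_on (surf D) Gamma2 g ->
  weak_solution D Gamma1 Gamma2 a f g u ->
  fine (gradsq D u) <= Cweak / m ^+ 2 *
    (fine (sqint_on leb2 (Q : set T2) f) + fine (sqint_on (surf D) (Gamma2 : set T2) g)).
Proof.
move=> m0 ma aM Lf Lg [uV uw]; have [uH ut _] := uV.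
have aM' x : Q x -> `|a x| <= M.
  by move=> Qx; have /andP[a1 a2] := aM _ Qx; rewrite ger0_norm// (le_trans (ltW m0) a1).
have iuu := integrable_dotg uH uH.
have h1 : m * fine (gradsq D u) <= \int[leb2]_(x in Q) (a x * dotg u u x).
  rewrite gradsq_dotg//= -RintegralZl//; apply: le_Rintegral => //.
  - exact: (integrableZl mQ m iuu).
  - exact: bounded_mul_integrable ma aM' iuu.
  - move=> x Qx; apply: ler_wpM2r; last by have /andP[] := aM _ Qx.
    by rewrite dotgE addr_ge0// -expr2 sqr_ge0.
have := uw _ uV; rewrite -[X in X = _ -> _]/(\int[leb2]_(x in Q) (a x * dotg u u x)) => h2.
rewrite h2 in h1.
(* Young's inequality with this weight leaves exactly half of the energy. *)
pose l := Cweak / m; have l0 : 0 < l by rewrite divr_gt0// Cweak_gt0.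
have Lu : L2_on leb2 Q u.1 by have [] := uH.
have h3 := integral_mul_le l0 (@subset_refl _ Q) Lf Lu.
have h4 := integral_mul_le l0 G2B Lg ut.1.
have gfin : gradsq D u \is a fin_num by rewrite gradsq_dotg.
have := HCP uV; rewrite -(fineK gfin) -EFinM => u1.
have {}u1 : fine (sqint_on leb2 (Q : set T2) u.1) <= CP * fine (gradsq D u).
  by rewrite -lee_fin fineK// ge0_fin_numE ?sqint_on_ge0// (le_lt_trans u1)// ltry.
have := trace_V uV; rewrite -(fineK gfin) -EFinM => u2.
have {}u2 : fine (sqint_on (surf D) (bsquare D : set T2) (trace D u)) <= Ctrace D * (CP + 1) * fine (gradsq D u).
  by rewrite -lee_fin fineK// ge0_fin_numE ?sqint_on_ge0// (le_lt_trans u2)// ltry.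
set G := fine (gradsq D u) in h1 u1 u2 *.
have G0 : 0 <= G by rewrite fine_ge0// gradsq_ge0.
set nf := fine (sqint_on leb2 (Q : set T2) f) in h3 *.
set ng := fine (sqint_on (surf D) (Gamma2 : set T2) g) in h4 *.
have il : (2 * l)^-1 * (CP * G + Ctrace D * (CP + 1) * G) <= m / 2 * G.
  have -> : m / 2 * G = (2 * l)^-1 * (Cweak * G).
    by rewrite /l; field; rewrite !gt_eqF// Cweak_gt0.
  apply: ler_wpM2l; first by rewrite invr_ge0 mulr_ge0// ltW.
  by rewrite -mulrDl ler_wpM2r// /Cweak lerDl.
have h5 : m * G <= l / 2 * (nf + ng) + m / 2 * G.
  apply: le_trans h1 _; apply: le_trans (lerD h3 h4) _.
  have l2 : 0 <= (2 * l)^-1 by rewrite invr_ge0 mulr_ge0// ltW.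
  have := ler_wpM2l l2 u1; have := ler_wpM2l l2 u2.
  rewrite mulrDr in il; lra.
have h6 : m / 2 * G <= l / 2 * (nf + ng) by lra.
have -> : G = (2 / m) * (m / 2 * G) by field; rewrite gt_eqF.
have -> : Cweak / m ^+ 2 * (nf + ng) = (2 / m) * (l / 2 * (nf + ng)).
  by rewrite /l; field; rewrite gt_eqF.
by apply: ler_wpM2l h6; rewrite divr_ge0// ltW.
Qed.

(** The two equations tested with w give an integrand of integral zero. Young's inequality is
    applied to it pointwise, so a bound of |a - b| almost everywhere suffices. *)
Lemma pathwise_le (a b f g : R * R -> R) (m M X : R) u v : 0 < m -> 0 <= X ->
  measurable_fun (Q : set T2) (a : T2 -> R) ->
  measurable_fun (Q : set T2) (b : T2 -> R) ->
  (forall x, Q x -> m <= a x <= M) -> (forall x, Q x -> m <= b x <= M) ->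
  {ae leb2, forall x, Q x -> `|a x - b x| <= X} ->
  L2_on leb2 Q f -> L2_on (surf D) Gamma2 g ->
  weak_solution D Gamma1 Gamma2 a f g u -> weak_solution D Gamma1 Gamma2 b f g v ->
  (H1sq D (u - v)%R <= ((CP + 1) * (X ^+ 2 / m ^+ 2) * (Cweak / m ^+ 2) *
    (fine (sqint_on leb2 (Q : set T2) f) + fine (sqint_on (surf D) (Gamma2 : set T2) g)))%:E)%E.
Proof.
move=> m0 X0 ma mb aM bM abX Lf Lg su sv.
have en := energy_le m0 ma aM Lf Lg su.
have [uV uw] := su; have [vV vw] := sv.
have uvV := VspaceB D0 G1B uV vV; set w := u - v in uvV *.
have [uH _ _] := uV; have [vH _ _] := vV; have [wH _ _] := uvV.
have E : \int[leb2]_(x in Q) (a x * dotg u w x) = \int[leb2]_(x in Q) (b x * dotg v w x).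
  exact: etrans (uw _ uvV) (esym (vw _ uvV)).
have aM' x : Q x -> `|a x| <= M.
  by move=> Qx; have /andP[a1 a2] := aM _ Qx; rewrite ger0_norm// (le_trans (ltW m0) a1).
have bM' x : Q x -> `|b x| <= M.
  by move=> Qx; have /andP[a1 a2] := bM _ Qx; rewrite ger0_norm// (le_trans (ltW m0) a1).
have iuu := integrable_dotg uH uH; have iww := integrable_dotg wH wH.
have iA := bounded_mul_integrable mQ ma aM' (integrable_dotg uH wH).
have iB := bounded_mul_integrable mQ mb bM' (integrable_dotg vH wH).
(* Since grad v = grad u - grad w, the integrand b grad v . grad w - a grad u . grad w equals (b -
   a) grad u . grad w - b |grad w|^2. *)
have dvw x : dotg v w x = dotg u w x - dotg w w x.
  have wE c : w.2 c x = u.2 c x - v.2 c x by [].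
  by rewrite !dotgE !wE; ring.
have h1 : \int[leb2]_(x in Q) (b x * dotg v w x - a x * dotg u w x) <=
    \int[leb2]_(x in Q) (X ^+ 2 / (2 * m) * dotg u u x - m / 2 * dotg w w x).
  apply: ae_le_Rintegral => //.
  - exact: (integrableB mQ iB iA).
  - exact: (integrableB mQ (integrableZl mQ (X ^+ 2 / (2 * m)) iuu) (integrableZl mQ (m / 2) iww)).
  have FF := ae_filter_ringOfSetsType (@leb2 R).
  apply: (filterS _ abX) => x abx Qx; have {}abx := abx Qx.
  have /andP[bm _] := bM _ Qx; rewrite dvw.
  (* The weight m / 2 leaves half of the coercive term m |grad w|^2. *)
  have key p q : (b x - a x) * (p * q) <= X ^+ 2 / (2 * m) * p ^+ 2 + m / 2 * q ^+ 2.
    apply: (@le_trans _ _ (X * (`|p| * `|q|))).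
      apply: le_trans (ler_norm _) _; rewrite !normrM; apply: ler_wpM2r => //.
      by rewrite distrC.
    rewrite -(real_normK (num_real p)) -(real_normK (num_real q)).
    have -> : X ^+ 2 / (2 * m) * `|p| ^+ 2 + m / 2 * `|q| ^+ 2 =
        X * (`|p| * `|q|) + (X * `|p| - m * `|q|) ^+ 2 / (2 * m).
      by field; rewrite gt_eqF.
    by rewrite lerDl divr_ge0 ?sqr_ge0// mulr_ge0// ltW.
  have kt := key (u.2 true x) (w.2 true x); have kf := key (u.2 false x) (w.2 false x).
  have ww : 0 <= dotg w w x by rewrite dotgE addr_ge0// -expr2 sqr_ge0.
  have : m * dotg w w x <= b x * dotg w w x by apply: ler_wpM2r.
  move: ww kt kf; rewrite !dotgE !expr2; lra.
rewrite RintegralB// E subrr RintegralB// in h1; last 2 first.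
- exact: (integrableZl mQ (X ^+ 2 / (2 * m)) iuu).
- exact: (integrableZl mQ (m / 2) iww).
rewrite !RintegralZl// in h1.
have gu : fine (gradsq D u) = \int[leb2]_(x in Q) dotg u u x by rewrite gradsq_dotg.
have gw := gradsq_dotg wH.
rewrite -gu in h1; set W := \int[leb2]_(x in Q) dotg w w x in h1 gw.
have h2 : W <= X ^+ 2 / m ^+ 2 * fine (gradsq D u).
  have -> : W = (2 / m) * (m / 2 * W) by field; rewrite gt_eqF.
  have -> : X ^+ 2 / m ^+ 2 * fine (gradsq D u) = (2 / m) * (X ^+ 2 / (2 * m) * fine (gradsq D u)).
    by field; rewrite gt_eqF.
  by apply: ler_wpM2l; [rewrite divr_ge0// ltW|lra].
rewrite H1sqE; last exact: H1_measurable.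
apply: (@le_trans _ _ ((CP + 1) * W)%:E).
  by have := HCP uvV; rewrite gw mulrDl mul1r EFinD EFinM => h; apply: leeD.
set S := _ + _ in en *.
rewrite lee_fin (_ : _ * S = (CP + 1) * (X ^+ 2 / m ^+ 2 * (Cweak / m ^+ 2 * S))); last first.
  by field; rewrite gt_eqF.
apply: ler_wpM2l; first by rewrite addr_ge0.
apply: le_trans h2 _; apply: ler_wpM2l => //.
by apply: divr_ge0; exact: sqr_ge0.
Qed.

End pathwise.

Definition ratpt {R : realType} (q : rat * rat) : R * R := (ratr q.1, ratr q.2).

(** * Measurability of the truncation error *)

Section complete_measurability.
Context d (Omega : measurableType d) (R : realType) (P : probability Omega R).
Hypothesis cP : measure_is_complete P.
Notation T2 := (measurableTypeR R * measurableTypeR R)%type.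

(** The event {f > c} agrees with S off a null set, and its remaining part lies inside that null
    set, hence is measurable by completeness. *)
Lemma measurable_ae_itv (f : Omega -> \bar R) (good : Omega -> Prop) :
  {ae P, forall w, good w} ->
  (forall c : R, exists2 S, measurable S & forall w, good w -> S w <-> (c%:E < f w)%E) ->
  measurable_fun setT f.
Proof.
move=> [N [mN N0 gN]] H.
apply: (measurability _ (ErealGenOInfty.measurableE R)) => _ [_ [c ->] <-].
have [S mS HS] := H c; rewrite setTI.
have -> : f @^-1` `]c%:E, +oo[ = (S `&` ~` N) `|` ((f @^-1` `]c%:E, +oo[) `&` N).
  have g w : ~ N w -> good w by move=> Nw; apply: contrapT => /gN.
  apply/seteqP; split=> [w fw|w [[Sw Nw]|[]//]].
    have [Nw|Nw] := pselect (N w); [by right|left; split => //].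
    apply/(HS _ (g _ Nw)).
    by move: fw; rewrite /= in_itv/= andbT.
  by rewrite /= in_itv/= andbT; apply/(HS _ (g _ Nw)).
apply: measurableU; first by apply: measurableI => //; exact: measurableC.
by apply: cP; exists N; split => // w [].
Qed.

Lemma measurable_real_ae_itv (f : Omega -> R) (good : Omega -> Prop) :
  {ae P, forall w, good w} ->
  (forall c : R, exists2 S, measurable S & forall w, good w -> S w <-> c < f w) ->
  measurable_fun setT f.
Proof.
move=> hg H; apply/measurable_EFinP; apply: (measurable_ae_itv hg) => c.
by have [S mS HS] := H c; exists S => // w gw; rewrite /= lte_fin; exact: HS.
Qed.

(** By path continuity, V (z w) w > c holds exactly when some rational ball contains z w and V stays
    above c + 1 / (n + 1) at every rational point of S in that ball. Only countably many events are
    involved. *)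
Lemma measurable_random_eval (S : set (R * R)) (V : R * R -> Omega -> R)
    (z : Omega -> R * R) :
  (forall p U, S p -> nbhs p U -> exists q, (S `&` U) (ratpt q)) ->
  (forall q, S (ratpt q) -> measurable_fun setT (V (ratpt q))) ->
  measurable_fun setT (z : Omega -> T2) ->
  {ae P, forall w, S (z w) /\ {within S, continuous (V ^~ w)}} ->
  measurable_fun setT (fun w => V (z w) w).
Proof.
move=> dS mV mz hg; apply: (measurable_real_ae_itv hg) => c.
(* The default [setT] makes rational points outside the ball or outside S impose no condition on the
   intersection. *)
pose A (i : rat * rat * nat) (n : nat) (q : rat * rat) : set Omega :=
  if `[< qball (R := R) i (ratpt q) /\ S (ratpt q) >]
  then [set w | c + n.+1%:R^-1 < V (ratpt q) w] else setT.
have mA i n q : measurable (A i n q).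
  rewrite /A; case: ifPn => // /asboolP[_ Sq].
  have := mV q Sq measurableT _ (measurable_itv `](c + n.+1%:R^-1), +oo[).
  rewrite setTI; congr measurable; apply/seteqP; split=> w /=; by rewrite in_itv/= andbT.
exists (\bigcup_i \bigcup_n (z @^-1` qball i `&` \bigcap_q A i n q)).
  apply: countable_bigcupT_measurable => // i; apply: bigcupT_measurable => n.
  apply: measurableI.
    by rewrite -[X in measurable X]setTI; apply: mz => //; exact: measurable_qball.
  rewrite -[X in measurable X]setCK setC_bigcap; apply: measurableC.
  by apply: countable_bigcupT_measurable => // q; exact: measurableC.
move=> w [Sz cV]; split=> [[i _ [n _ [zi Aw]]]|cw].
  apply: contrapT => /negP; rewrite -leNgt => Vc.
  (* The margin 1 / (n + 1) is what keeps the inequality strict in the passage from rational points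
     to z w. *)
  have e0 : 0 < (n.+1%:R^-1 : R) by rewrite invr_gt0.
  have := (subspace_continuousP _ _).1 cV (z w) Sz.
  move=> /cvgrPdist_lt /(_ _ e0); rewrite near_withinE => near_z.
  have nU : nbhs (z w) (qball i `&` [set x | S x -> `|V (z w) w - V x w| < n.+1%:R^-1]).
    by apply: filterI => //; apply: open_nbhs_nbhs; split => //; exact: open_qball.
  have [q [Sq [qi /(_ Sq) dq]]] := dS _ _ Sz nU.
  have := Aw q I; rewrite /A asboolT//= => h.
  move: dq; rewrite ltr_norml => /andP[h1 _].
  have : V (ratpt q) w - V (z w) w < n.+1%:R^-1 by rewrite ltrNl opprB in h1.
  by rewrite ltrBlDl => /(lt_trans h); rewrite ltrD2r ltNge Vc.
have [k] := @ltr_add_invr R c (V (z w) w) cw; rewrite -subr_gt0 => e0.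
have := (subspace_continuousP _ _).1 cV (z w) Sz.
move=> /cvgrPdist_lt /(_ _ e0); rewrite near_withinE => /nbhs_qball[i [iz iV]].
exists i => //; exists k => //; split => // q _.
rewrite /A; case: ifPn => // /asboolP[qi Sq] /=.
have := iV _ qi Sq; rewrite ltr_norml => /andP[_].
rewrite [X in X < _ -> _](_ : _ = V (z w) w - V (ratpt q) w)//.
by rewrite ltrD2l ltrN2.
Qed.

End complete_measurability.

(** * Continuity points of the coefficient *)

Section monotone.
Context {R : realType}.
Variable F : R -> R.
Hypothesis ndF : {homo F : x y / x <= y}.

(** Both one-sided limits exist by monotonicity and enclose F x; where they agree, they equal F
    x. *)
Lemma nondecreasing_continuous_at (x : R) : ~ discontinuity F x -> {for x, continuous F}.
Proof.
move=> nd.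
have cl : cvg (F y @[y --> x^'-]).
  apply: nondecreasing_at_left_is_cvgr.
    by near=> y => u v _ _; exact: ndF.
  near=> y; exists (F x) => _ [z /= + <-]; rewrite in_itv/= => /andP[_ zx].
  exact/ndF/ltW.
have cr : cvg (F y @[y --> x^'+]).
  apply: nondecreasing_at_right_is_cvgr.
    by near=> y => u v _ _; exact: ndF.
  near=> y; exists (F x) => _ [z /= + <-]; rewrite in_itv/= => /andP[zx _].
  exact/ndF/ltW.
have lr : lim (F y @[y --> x^'-]) = lim (F y @[y --> x^'+]).
  by apply: contrapT => /eqP h; apply: nd.
have lx : lim (F y @[y --> x^'-]) <= F x.
  apply: limr_le => //; near=> y; apply: ndF; apply: ltW.
  by near: y; exact: nbhs_left_lt.
have xr : F x <= lim (F y @[y --> x^'+]).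
  apply: limr_ge => //; near=> y; apply: ndF; apply: ltW.
  by near: y; exact: nbhs_right_gt.
apply/left_right_continuousP; split.
  suff -> : F x = lim (F y @[y --> x^'-]) by [].
  by apply/eqP; rewrite eq_le lx andbT lr.
suff -> : F x = lim (F y @[y --> x^'+]) by [].
by apply/eqP; rewrite eq_le xr -lr.
Unshelve. all: by end_near. Qed.

Lemma countable_not_continuous (a b : R) :
  countable [set x | x \in (`]a, b[) /\ ~ {for x, continuous F}].
Proof.
apply: sub_countable (@discontinuity_countable R a b F _); last by move=> x y _ _; exact: ndF.
apply: subset_card_le => x [xab nc]; split => //.
by apply: contrapT => /nondecreasing_continuous_at.
Qed.

End monotone.

Section coefficient_path.
Context {R : realType}.
Notation T1 := (measurableTypeR R).
Notation T2 := (measurableTypeR R * measurableTypeR R)%type.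
Variables (D K : R) (abar p q : R * R -> R) (Phi1 Phi2 : R -> R) (k1 k2 : R -> R).
Variables (am ap : R).
Hypotheses (D0 : 0 < D) (K0 : 0 < K).
Hypothesis habar : abar_assumption D abar am ap.
Hypotheses (cPhi1 : continuous Phi1) (cPhi2 : continuous Phi2).
Hypotheses (Phi10 : forall x, 0 <= Phi1 x) (Phi20 : forall x, 0 <= Phi2 x).
Hypothesis cp : {within csquare D, continuous p}.
Hypothesis cq : {within csquare K, continuous q}.
Definition subordinator_path (k : R -> R) :=
  k 0 = 0 /\ forall s t, 0 <= s -> s <= t -> t <= D -> k s <= k t.
Hypotheses (hk1 : subordinator_path k1) (hk2 : subordinator_path k2).
Notation Q := (osquare D).

(** One path of [a_K]: p, q, k1, k2 stand for the paths of the two fields and of the two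
    subordinators. *)
Definition coef (x : R * R) : R :=
  abar x + Phi1 (p x) + Phi2 (q (chi K (k1 x.1), chi K (k2 x.2))).

(* [k] is only monotone on [0, D]; clamping the argument makes it globally so. *)
Definition clampk (k : R -> R) (t : R) : R := chi K (k (Num.min (Num.max t 0) D)).

Lemma clamp_itv (t : R) : 0 <= Num.min (Num.max t 0) D <= D.
Proof. by rewrite le_min le_max lexx orbT (ltW D0) ge_min lexx orbT. Qed.

Lemma clampk_nd k : subordinator_path k -> {homo clampk k : s t / s <= t}.
Proof.
move=> [_ nk] s t st; rewrite /clampk /chi le_min !ge_min lexx orbT andbT.
rewrite nk//; first by have /andP[] := clamp_itv s.
  by rewrite le_min !ge_min lexx orbT andbT ge_max !le_max st lexx !orbT.
by have /andP[] := clamp_itv t.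
Qed.

Lemma clampkE k t : 0 <= t <= D -> clampk k t = chi K (k t).
Proof.
move=> /andP[t0 tD]; rewrite /clampk.
have -> : Num.max t 0 = t by apply/max_idPl.
by have -> : Num.min t D = t by apply/min_idPl.
Qed.

Lemma clampk_itv k t : subordinator_path k -> 0 <= clampk k t <= K.
Proof.
move=> [k0 nk]; rewrite /clampk /chi le_min ge_min lexx orbT (ltW K0) !andbT.
have /andP[t0 tD] := clamp_itv t.
by have := nk _ _ (lexx 0) t0 tD; rewrite k0.
Qed.

Definition kpair (x : R * R) : R * R := (clampk k1 x.1, clampk k2 x.2).

Lemma kpair_csquare x : csquare K (kpair x).
Proof. by split; rewrite /= in_itv/=; exact: clampk_itv. Qed.

Lemma Q_itv x : Q x -> 0 < x.1 < D /\ 0 < x.2 < D.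
Proof. by move=> [/=]; rewrite !in_itv. Qed.

Lemma coefE x : Q x -> coef x = abar x + Phi1 (p x) + Phi2 (q (kpair x)).
Proof.
move=> /Q_itv[/andP[a1 a2] /andP[b1 b2]]; rewrite /coef /kpair.
by rewrite !clampkE// ?ltW.
Qed.

Lemma measurable_clampk k : subordinator_path k -> measurable_fun (setT : set T1) (clampk k : T1 -> T1).
Proof. by move=> hk; apply: nondecreasing_measurable => //; exact: clampk_nd. Qed.

Lemma measurable_kpair : measurable_fun (setT : set T2) (kpair : T2 -> T2).
Proof.
apply/measurable_fun_pairP; split.
  exact: measurableT_comp (measurable_clampk hk1) (@measurable_fst _ _ T1 T1).
exact: measurableT_comp (measurable_clampk hk2) (@measurable_snd _ _ T1 T1).
Qed.

(** The path q is controlled on the closed square only, so it is extended by 0; the clamped pair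
    never leaves that square, hence the coefficient is unchanged. *)
Lemma measurable_coef : measurable_fun (Q : set T2) (coef : T2 -> R).
Proof.
have mQ := @measurable_osquare R D; have [_ _ cab _] := habar.
apply: (@eq_measurable_fun _ _ _ _ _ (fun x => abar x + Phi1 (p x) + Phi2 ((q \_ (csquare K)) (kpair x)))).
  by move=> x /set_mem Qx; rewrite coefE// patchE mem_set//; exact: kpair_csquare.
apply: measurable_funD; first apply: measurable_funD.
- exact: within_continuous_measurable2.
- apply: (@measurableT_comp _ _ _ _ _ _ Phi1); first exact: continuous_measurable_fun.
  apply: (@measurable_funS _ _ _ _ (csquare D : set T2)); [exact: measurable_csquare|exact: osquare_csquare|].
  by apply: within_continuous_measurable2 => //; exact: measurable_csquare.
- apply: measurable_funTS; apply: (@measurableT_comp _ _ _ _ _ _ Phi2).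
    exact: continuous_measurable_fun.
  apply: (@measurableT_comp _ _ _ _ _ _ ((q \_ (csquare K)) : T2 -> R)); last exact: measurable_kpair.
  have mK := @measurable_csquare R K.
  by apply: ((measurable_restrictT _ mK).1); exact: within_continuous_measurable2.
Qed.

(** The cut-off K confines the argument of q to a compact square, whence a finite bound M depending
    on the path. The lower bound holds because [Phi1] and [Phi2] are nonnegative. *)
Lemma coef_bounds : exists M, forall x, Q x -> am <= coef x <= M.
Proof.
have [am0 ap0 _ hab] := habar.
have cf (f : R -> R) (r : R * R -> R) (z : R) : continuous f -> {within csquare z, continuous r} ->
    {within csquare z, continuous (f \o r)}.
  move=> cf cr; apply/subspace_continuousP => x xz.
  have crx := (subspace_continuousP _ _).1 cr x xz.
  exact: cvg_comp crx (cf (r x)).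
have [M1 HM1] := @within_csquare_bounded R D (Phi1 \o p) (csquare D) (@subset_refl _ _) (cf _ _ _ cPhi1 cp).
have [M2 HM2] := @within_csquare_bounded R K (Phi2 \o q) (csquare K) (@subset_refl _ _) (cf _ _ _ cPhi2 cq).
exists (ap + M1 + M2) => x Qx; rewrite coefE//.
have /andP[h1 h2] := hab _ Qx.
have h3 := le_trans (ler_norm _) (HM1 _ (osquare_csquare Qx)).
have h4 := le_trans (ler_norm _) (HM2 _ (kpair_csquare x)).
have h5 := Phi10 (p x); have h6 := Phi20 (q (kpair x)).
rewrite /= in h3 h4; apply/andP; split; lra.
Qed.

Lemma open_osquare : open Q.
Proof.
have -> : Q = (crd true @^-1` `]0, D[%classic) `&` (crd false @^-1` `]0, D[%classic) by [].
by apply: openI; apply: open_comp => [x _|]; try exact: continuous_crd; exact: interval_open.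
Qed.

Lemma coef_continuous_at x : Q x -> {for x.1, continuous (clampk k1)} ->
  {for x.2, continuous (clampk k2)} -> {for x, continuous coef}.
Proof.
move=> Qx c1 c2; have nQ : nbhs x Q by apply: open_nbhs_nbhs; split => //; exact: open_osquare.
have [_ _ cab _] := habar.
have ab : abar @ x --> abar x.
  have := (subspace_continuousP _ _).1 cab x Qx.
  by rewrite within_interior//; exact: nQ.
have pp : p @ x --> p x.
  have := (subspace_continuousP _ _).1 cp x (osquare_csquare Qx).
  by rewrite within_interior//; apply: filterS nQ => y; exact: osquare_csquare.
(* Continuity of q is relative to the closed square, so convergence of its argument is needed within
   that square. *)
have kk : kpair @ x --> within (csquare K) (nbhs (kpair x)).
  have kx : kpair @ x --> kpair x.
    apply: cvg_pair_nbhs.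
      have c1' : clampk k1 @ crd true x --> clampk k1 (crd true x) := c1.
      exact: cvg_comp (@continuous_crd R true x) c1'.
    have c2' : clampk k2 @ crd false x --> clampk k2 (crd false x) := c2.
    exact: cvg_comp (@continuous_crd R false x) c2'.
  move=> U /= hU.
  have h : \forall y \near x, csquare K (kpair y) -> U (kpair y) := kx _ hU.
  change (\forall y \near x, U (kpair y)).
  by apply: filterS h => y h; exact: (h (kpair_csquare y)).
have qq : (q \o kpair) @ x --> q (kpair x).
  exact: cvg_comp kk ((subspace_continuousP _ _).1 cq _ (kpair_csquare x)).
have H : (fun y => abar y + Phi1 (p y) + Phi2 (q (kpair y))) @ x -->
    abar x + Phi1 (p x) + Phi2 (q (kpair x)).
  have P1 := (@cvg_comp _ _ _ p Phi1 (nbhs x) (nbhs (p x)) _ pp (@cPhi1 (p x))).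
  have P2 := (@cvg_comp _ _ _ (q \o kpair) Phi2 (nbhs x) (nbhs (q (kpair x))) _ qq (@cPhi2 (q (kpair x)))).
  exact: (cvgD (cvgD ab P1) P2).
rewrite /continuous_at /prop_for coefE//; apply: cvg_trans H.
apply: near_eq_cvg; apply: filterS nQ => y Qy; rewrite coefE//.
Qed.

(** The exceptional points lie on countably many horizontal and vertical lines, over the jumps of
    the two truncated paths. *)
Lemma coef_ae_continuous : exists C1 C2 : set R, [/\ countable C1, countable C2 &
  forall x, Q x -> ~ C1 x.1 -> ~ C2 x.2 -> {for x, continuous coef}].
Proof.
exists [set x | x \in (`]0, D[) /\ ~ {for x, continuous (clampk k1)}].
exists [set x | x \in (`]0, D[) /\ ~ {for x, continuous (clampk k2)}]; split.
- exact/countable_not_continuous/clampk_nd.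
- exact/countable_not_continuous/clampk_nd.
move=> x Qx n1 n2; have [h1 h2] := Q_itv Qx.
apply: coef_continuous_at => //; apply: contrapT => h; [apply: n1|apply: n2];
  by split => //; rewrite in_itv.
Qed.

End coefficient_path.

(** * The essential supremum through rational points *)

Section essential_supremum.
Context {R : realType}.
Notation T1 := (measurableTypeR R).
Notation T2 := (measurableTypeR R * measurableTypeR R)%type.
Notation mu := (@lebesgue_measure R).
Variable D : R.
Hypothesis D0 : 0 < D.
Notation Q := (osquare D).

(** Selects the branch of [Lnorm] at exponent +oo that is the essential supremum. *)
Lemma leb2_setT_gt0 : (0 < leb2 [set: T2])%E.
Proof.
apply: (@lt_le_trans _ _ (leb2 (Q : set T2))).
  by rewrite leb2_osquare// lte_fin mulr_gt0.
by apply: le_measure; rewrite ?inE//; exact: measurable_osquare.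
Qed.

Lemma Lnorm_on_ess_sup (phi : R * R -> R) :
  Lnorm_on leb2 Q +oo%E phi = ess_sup leb2 (fun x : T2 => (`|(phi \_ Q) x|)%:E).
Proof. by rewrite /Lnorm_on unlock leb2_setT_gt0. Qed.

Lemma countable_cross_negligible (C1 C2 : set R) : countable C1 -> countable C2 ->
  leb2.-negligible ([set x : T2 | C1 x.1 \/ C2 x.2]).
Proof.
move=> c1 c2.
have m1 (C : set T1) : countable C -> measurable C.
  by apply: countable_measurable => t; exact: measurable_set1.
exists ((C1 : set T1) `*` [set: T1] `|` [set: T1] `*` (C2 : set T1)); split.
- by apply: measurableU; apply: measurableX => //; exact: m1.
- apply/eqP; rewrite -measure_le0.
  apply: (@le_trans _ _ (leb2 ((C1 : set T1) `*` [set: T1] : set T2) + leb2 ([set: T1] `*` (C2 : set T1) : set T2))%E).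
    by apply: measureU2; apply: measurableX => //; exact: m1.
  have e1 : leb2 ((C1 : set T1) `*` [set: T1] : set T2) = (mu (C1 : set T1) * mu [set: T1])%E.
    by apply: product_measure1E => //; exact: m1.
  have e2 : leb2 ([set: T1] `*` (C2 : set T1) : set T2) = (mu [set: T1] * mu (C2 : set T1))%E.
    by apply: product_measure1E => //; exact: m1.
  by rewrite e1 e2 (countable_lebesgue_measure0 c1) (countable_lebesgue_measure0 c2) mul0e mule0 adde0.
- by move=> x [h|h]; [left|right].
Qed.

Lemma leb2_qball_gt0 i : (0 < leb2 (qball i : set T2))%E.
Proof.
have r0 : 0 < (i.2.+1%:R^-1 : R) by rewrite invr_gt0.
have e : leb2 (qball i : set T2) =
    (mu (ball (ratr i.1.1 : R) i.2.+1%:R^-1) * mu (ball (ratr i.1.2 : R) i.2.+1%:R^-1))%E.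
  by apply: product_measure1E; exact: measurable_ball.
by rewrite e !lebesgue_measure_ball ?ltW// -EFinM lte_fin mulr_gt0// mulrn_wgt0.
Qed.

Lemma rpt_in_nbhs (x : R * R) (U : set (R * R)) : nbhs x U -> exists q, U (ratpt q).
Proof.
move=> /nbhs_ballP[e /= e0 eU]; have [q hq] := rat_ball2 x e0.
by exists q; apply: eU; exact: ball_sym.
Qed.

(* Rational points see the essential supremum because [phi] is continuous at
   almost every point, although possibly at no rational one. *)
Lemma Lnorm_on_gtP (phi : R * R -> R) (C1 C2 : set R) (c : R) :
  countable C1 -> countable C2 -> 0 <= c ->
  (forall x, Q x -> 0 <= phi x) ->
  (forall x, Q x -> ~ C1 x.1 -> ~ C2 x.2 -> {for x, continuous phi}) ->
  (c%:E < Lnorm_on leb2 Q +oo%E phi)%E <->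
  exists i n, qball i `<=` Q /\ forall q, qball (R := R) i (ratpt q) -> c + n.+1%:R^-1 < phi (ratpt q).
Proof.
move=> cC1 cC2 c0 phi0 cphi; rewrite Lnorm_on_ess_sup.
have [Bd [mBd Bd0 BdC]] := countable_cross_negligible cC1 cC2.
have good x : Q x -> ~ Bd x -> {for x, continuous phi}.
  by move=> Qx nB; apply: cphi => // h; apply: nB; apply: BdC; [left|right].
have good_near x : Q x -> ~ Bd x -> forall e, 0 < e -> \forall t \near x, `|phi x - phi t| < e.
  move=> Qx xB e e0; have cx : phi @ x --> phi x := good x Qx xB.
  by move/cvgrPdist_lt : cx; apply.
split=> [|[i [n [iQ iphi]]]].
  rewrite ltNge => /negP h; apply: contrapT => hn; apply: h; apply/ess_supP.
  (* A continuity point above c would carry a whole ball above c + 1 / (k + 1); hence {phi > c} lies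
     in the null set of bad points. *)
  have key (x : R * R) : Q x -> ~ Bd x -> c < phi x -> False.
    move=> Qx xB cx; have [k hk] := ltr_add_invr cx.
    have e0 : 0 < phi x - (c + k.+1%:R^-1) by rewrite subr_gt0.
    have nQ : nbhs x Q by apply: open_nbhs_nbhs; split => //; exact: open_osquare.
    have [i [ix iU]] := nbhs_qball (filterI nQ (good_near x Qx xB _ e0)).
    apply: hn; exists i, k; split=> [y /iU[]//|q /iU[_ /=]].
    by rewrite ltr_norml => /andP[_]; rewrite ltrD2l ltrN2.
  exists Bd; split => // x /= /negP; rewrite -ltNge lte_fin patchE => hx.
  apply: contrapT => xB; move: hx; case: ifPn => [/set_mem Qx|_]; last first.
    by rewrite normr0 ltNge c0.
  by rewrite ger0_norm ?phi0//; exact: key.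
rewrite ltNge; apply/negP => /ess_supP [N [mN N0 NC]].
(* A continuity point of the ball with phi x <= c would have a rational neighbour below c + 1 / (n +
   1). So phi > c on the ball off a null set, and the ball has positive measure. *)
have key (x : R * R) : qball i x -> ~ Bd x -> phi x <= c -> False.
  move=> ix xB xc; have Qx := iQ x ix.
  have n0 : 0 < (n.+1%:R^-1 : R) by rewrite invr_gt0.
  have ni : nbhs x (qball i) by apply: open_nbhs_nbhs; split => //; exact: open_qball.
  have [q [qi /=]] := rpt_in_nbhs (filterI ni (good_near x Qx xB _ n0)).
  rewrite ltr_norml => /andP[+ _]; rewrite ltrNl opprB ltrBlDl => h.
  by have := lt_trans (iphi _ qi) h; rewrite ltrD2r ltNge xc.
have sub : (qball i : set T2) `<=` N `|` Bd.
  move=> x ix; have [xB|xB] := pselect (Bd x); [by right|left].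
  apply: NC => /=; rewrite lee_fin patchE mem_set; last exact: iQ.
  by rewrite ger0_norm; [exact: key|exact/phi0/iQ].
have ng : leb2.-negligible (qball i : set T2).
  by apply: negligibleS sub _; apply: negligibleU; [exists N; split|exists Bd; split].
have i0 : leb2 (qball i : set T2) = 0%E.
  exact: measure_negligible (measurable_qball i) ng.
by have := leb2_qball_gt0 i; rewrite i0 ltxx.
Qed.

Lemma Lnorm_on_ge0 (A : set (R * R)) (nu : {measure set T2 -> \bar R}) p (phi : R * R -> R) :
  (0 <= Lnorm_on nu A p phi)%E.
Proof. exact: Lnorm_ge0. Qed.

Lemma Lnorm_on_bound (phi : R * R -> R) (X : R) :
  (Lnorm_on leb2 Q +oo%E phi <= X%:E)%E -> {ae leb2, forall x, Q x -> `|phi x| <= X}.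
Proof.
rewrite Lnorm_on_ess_sup => /ess_supP.
have FF := ae_filter_ringOfSetsType (@leb2 R).
by apply: filterS => x; rewrite lee_fin patchE => h Qx; rewrite mem_set in h.
Qed.

Lemma Lnorm_on_le (phi : R * R -> R) (X : R) : 0 <= X ->
  (forall x, Q x -> `|phi x| <= X) -> (Lnorm_on leb2 Q +oo%E phi <= X%:E)%E.
Proof.
move=> X0 h; rewrite Lnorm_on_ess_sup; apply/ess_supP.
have FF := ae_filter_ringOfSetsType (@leb2 R).
apply: nearW => x; rewrite lee_fin patchE; case: ifPn => [/set_mem/h//|_].
by rewrite normr0.
Qed.

End essential_supremum.

Section random_essential_supremum.
Context d (Omega : measurableType d) (R : realType) (P : probability Omega R).
Hypothesis cP : measure_is_complete P.
Variable D : R.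
Hypothesis D0 : 0 < D.
Notation Q := (osquare D).

(** The criterion of [Lnorm_on_gtP] involves countably many balls and rational points, where F is a
    random variable. It needs c >= 0; for c < 0 the event is sure. *)
Lemma measurable_Lnorm_on (F : Omega -> R * R -> R) :
  (forall q, Q (ratpt q) -> measurable_fun setT (fun w => F w (ratpt q))) ->
  {ae P, forall w, (forall x, Q x -> 0 <= F w x) /\
    exists C1 C2 : set R, [/\ countable C1, countable C2 &
      forall x, Q x -> ~ C1 x.1 -> ~ C2 x.2 -> {for x, continuous (F w)}]} ->
  measurable_fun setT (fun w => Lnorm_on leb2 Q +oo%E (F w)).
Proof.
move=> mF hg; apply: (measurable_ae_itv cP hg) => c.
have [c0|c0] := ltP c 0.
  exists setT => // w _; split => // _.
  by apply: lt_le_trans (Lnorm_on_ge0 _ _ _ _); rewrite lte_fin.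
pose A (i : rat * rat * nat) (n : nat) (q : rat * rat) : set Omega :=
  if `[< qball (R := R) i (ratpt q) /\ Q (ratpt q) >]
  then [set w | c + n.+1%:R^-1 < F w (ratpt q)] else setT.
have mA i n q : measurable (A i n q).
  rewrite /A; case: ifPn => // /asboolP[_ Qq].
  have := mF q Qq measurableT _ (measurable_itv `](c + n.+1%:R^-1), +oo[).
  rewrite setTI; congr measurable; apply/seteqP; split=> w /=; by rewrite in_itv/= andbT.
exists (\bigcup_i \bigcup_n (if `[< qball (R := R) i `<=` Q >] then \bigcap_q A i n q else set0)).
  apply: countable_bigcupT_measurable => // i; apply: bigcupT_measurable => n.
  case: ifPn => // _.
  rewrite -[X in measurable X]setCK setC_bigcap; apply: measurableC.
  by apply: countable_bigcupT_measurable => // q; exact: measurableC.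
move=> w [F0 [C1 [C2 [cC1 cC2 cF]]]].
split=> [[i _ [n _]]|].
  case: asboolP => // iQ Aw; apply/(Lnorm_on_gtP D0 cC1 cC2 c0 F0 cF).
  exists i, n; split => // q qi; have := Aw q I.
  by rewrite /A asboolT//; split => //; exact: iQ.
move=> /(Lnorm_on_gtP D0 cC1 cC2 c0 F0 cF)[i [n [iQ iF]]].
exists i => //; exists n => //; rewrite asboolT// => q _.
by rewrite /A; case: ifPn => // /asboolP[qi _]; exact: iF.
Qed.

End random_essential_supremum.

Section random_coefficient.
Context d (Omega : measurableType d) (R : realType) (P : probability Omega R).
Hypothesis cP : measure_is_complete P.
Notation T1 := (measurableTypeR R).
Notation T2 := (measurableTypeR R * measurableTypeR R)%type.
Variables (D K A : R) (abar : R * R -> R) (am ap : R) (Phi1 Phi2 : R -> R).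
Variables (W1 W2 : R * R -> Omega -> R) (l1 l2 : R -> Omega -> R).
Variables (gamma1 gamma2 : R) (nu1 nu2 : {measure set (measurableTypeR R) -> \bar R}).
Hypotheses (D0 : 0 < D) (K0 : 0 < K).
Hypothesis hW : fields_assumption P D K W1 W2.
Hypothesis hPhi : Phi_assumption Phi1 Phi2.
Hypothesis habar : abar_assumption D abar am ap.
Hypothesis hl : levy_assumption P D K W1 W2 l1 l2 gamma1 gamma2 nu1 nu2.
Notation Q := (osquare D).
Notation aK := (a_K abar Phi1 Phi2 W1 W2 l1 l2 K).
Notation aKA := (a_KA abar Phi1 Phi2 W1 W2 l1 l2 K A).

Definition good_path (w : Omega) : Prop :=
  [/\ {within csquare D, continuous (W1 ^~ w)}, {within csquare K, continuous (W2 ^~ w)},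
      subordinator_path D (l1 ^~ w) & subordinator_path D (l2 ^~ w)].

Lemma chi_path_itv k t : subordinator_path D k -> 0 <= t <= D -> 0 <= chi K (k t) <= K.
Proof. by move=> hk tD; rewrite -(clampkE K k tD); exact: clampk_itv. Qed.

Lemma ae_subordinator_path (l : R -> Omega -> R) : levy_subordinator P D l ->
  {ae P, forall w, subordinator_path D (l ^~ w)}.
Proof.
move=> [[_ l0 _ _ _] lm]; have FF := ae_filter_ringOfSetsType P.
by apply: (filterS _ (filterI l0 lm)) => w [h0 h1]; split.
Qed.

Lemma ae_good_path : {ae P, forall w, good_path w}.
Proof.
have [al [be [Ce [Cl [la1 [la2 [e1 [e2 [_ _ [_ _ c1 _ _] [_ _ c2 _ _] _]]]]]]]]] := hW.
have [s1 s2 _ _ _] := hl; have FF := ae_filter_ringOfSetsType P.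
apply: (filterS _ (filterI (filterI c1 c2)
  (filterI (ae_subordinator_path s1) (ae_subordinator_path s2)))).
by move=> w [[h1 h2] [h3 h4]]; split.
Qed.

Lemma gaussian_measurable (S : set (R * R)) (W : R * R -> Omega -> R) x :
  gaussian_field P S W -> S x -> measurable_fun setT (W x : Omega -> R).
Proof.
move=> gW Sx; have [] := gW 1%N (fun=> x) (fun=> 1) (fun=> Sx).
by under eq_fun do rewrite big_ord1 mul1r.
Qed.

Lemma measurable_W1 x : csquare D x -> measurable_fun setT (W1 x : Omega -> R).
Proof.
have [al [be [Ce [Cl [la1 [la2 [e1 [e2 [_ _ [g1 _ _ _ _] _ _]]]]]]]]] := hW.
exact: gaussian_measurable.
Qed.

Lemma measurable_W2 x : csquare K x -> measurable_fun setT (W2 x : Omega -> R).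
Proof.
have [al [be [Ce [Cl [la1 [la2 [e1 [e2 [_ _ _ [g2 _ _ _ _] _]]]]]]]]] := hW.
exact: gaussian_measurable.
Qed.

Lemma rat_dense_itv (t e : R) : 0 <= t <= K -> 0 < e ->
  exists r : rat, 0 <= (ratr r : R) <= K /\ ball t e (ratr r : R).
Proof.
move=> /andP[t0 tK] e0.
have : Num.max 0 (t - e) < Num.min K (t + e).
  by rewrite gt_max !lt_min K0 /=; apply/andP; split; [lra|apply/andP; split; lra].
move=> /rat_in_itvoo[r]; rewrite in_itv/= gt_max lt_min => /andP[/andP[h1 h2] /andP[h3 h4]].
exists r; split; first by rewrite !ltW.
by rewrite /ball/= ltr_norml; apply/andP; split; lra.
Qed.

(** Density is needed up to the boundary: the truncated subordinators may equal 0 or K, and the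
    field is controlled only inside the closed square. *)
Lemma rat_dense_csquare (p : R * R) (U : set (R * R)) : csquare K p -> nbhs p U ->
  exists q, (csquare K `&` U) (ratpt q).
Proof.
move=> [/= p1 p2] /nbhs_ballP[e /= e0 eU]; move: p1 p2; rewrite !in_itv/= => p1 p2.
have [r1 [h1 b1]] := rat_dense_itv p1 e0; have [r2 [h2 b2]] := rat_dense_itv p2 e0.
exists (r1, r2); split; first by split; rewrite /= in_itv.
by apply: eU; split.
Qed.

Lemma measurable_chi (B : R) (l : Omega -> R) :
  measurable_fun setT (l : Omega -> T1) -> measurable_fun setT ((fun w => chi B (l w)) : Omega -> T1).
Proof. by move=> ml; apply: measurable_minr => //; exact: measurable_cst. Qed.

(** The delicate term is W2, which is evaluated at a random point; path continuity of the field
    resolves it. *)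
Lemma measurable_aK x : Q x -> measurable_fun setT (aK ^~ x).
Proof.
move=> Qx; have [ph [psi [Cl [_ [_ _ cPhi1 cPhi2] _ _ _]]]] := hPhi.
have xC := osquare_csquare Qx; have [/= x1 x2] := xC.
have [[[ml1 _ _ _ _] _] [[ml2 _ _ _ _] _] _ _ _] := hl.
apply: measurable_funD; first apply: measurable_funD.
- exact: measurable_cst.
- apply: (@measurableT_comp _ _ _ _ _ _ Phi1); first exact: continuous_measurable_fun.
  exact: measurable_W1.
apply: (@measurableT_comp _ _ _ _ _ _ Phi2); first exact: continuous_measurable_fun.
apply: (measurable_random_eval cP rat_dense_csquare).
- by move=> q; exact: measurable_W2.
- by apply: measurable_fun_pair; apply: measurable_chi; [apply: ml1|apply: ml2];
    move: x1 x2; rewrite !in_itv.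
apply: filterS ae_good_path => w [_ c2 s1 s2]; split => //.
move: x1 x2; rewrite !in_itv => x1 x2.
by split; rewrite /= in_itv; [exact: (chi_path_itv s1 x1)|exact: (chi_path_itv s2 x2)].
Qed.

Lemma truncation_error_continuous : continuous (fun y : R => y - chi A y).
Proof.
have -> : (fun y : R => y - chi A y) = (fun y => y - (y + A - `|y - A|) / 2).
  by apply/funext => y; rewrite /chi minr_absE.
move=> y; apply: cvgB; first exact: cvg_id.
apply: cvgM; last exact: cvg_cst.
apply: cvgB; first by apply: cvgD; [exact: cvg_id|exact: cvg_cst].
by apply: cvg_norm; apply: cvgB; [exact: cvg_id|exact: cvg_cst].
Qed.

Lemma truncation_error_ge0 y : 0 <= y - chi A y.
Proof. by rewrite subr_ge0 /chi ge_min lexx. Qed.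

Lemma good_path_coef w : good_path w ->
  [/\ measurable_fun (Q : set T2) (aK w : T2 -> R),
      exists M, forall x, Q x -> am <= aK w x <= M &
      exists C1 C2 : set R, [/\ countable C1, countable C2 &
        forall x, Q x -> ~ C1 x.1 -> ~ C2 x.2 -> {for x, continuous (aK w)}]].
Proof.
move=> [c1 c2 s1 s2].
have [ph [psi [Cl [_ [p1 p2 cP1 cP2] _ _ _]]]] := hPhi.
split.
- exact: (measurable_coef D0 K0 habar cP1 cP2 c1 c2 s1 s2).
- exact: (coef_bounds D0 K0 habar cP1 cP2 p1 p2 c1 c2 s1 s2).
- exact: (coef_ae_continuous D0 K0 habar cP1 cP2 c1 c2 s1 s2).
Qed.

Lemma measurable_truncation_error :
  measurable_fun setT (fun w => Lnorm_on leb2 Q +oo%E (fun x => aK w x - aKA w x)).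
Proof.
apply: (measurable_Lnorm_on cP D0).
  move=> q Qq; have mq := measurable_aK Qq.
  by apply: measurable_funB => //; exact: measurable_chi.
apply: filterS ae_good_path => w /good_path_coef[_ _ [C1 [C2 [h1 h2 h3]]]].
split; first by move=> x _; exact: truncation_error_ge0.
exists C1, C2; split => // x Qx n1 n2.
have cx : aK w @ x --> aK w x := h3 x Qx n1 n2.
exact: (@cvg_comp _ _ _ (aK w) (fun y => y - chi A y) (nbhs x) (nbhs (aK w x)) _ cx
  (@truncation_error_continuous (aK w x))).
Qed.

End random_coefficient.

(** * Bochner norms *)

Section bochner_measurability.
Context d (Omega : measurableType d) (R : realType) (P : probability Omega R).
Hypothesis cP : measure_is_complete P.
Notation T2 := (measurableTypeR R * measurableTypeR R)%type.
Variables (nu : {measure set T2 -> \bar R}) (A : set (R * R)).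
Notation N := (Lnorm_on nu A 2%:E).

Lemma Lnorm_on_fin (f : R * R -> R) : L2_on nu A f -> N f \is a fin_num.
Proof.
by move=> /andP[_]; rewrite inE /= /finite_norm ge0_fin_numE ?Lnorm_on_ge0.
Qed.

Lemma Lnorm_on_triangle (f g : R * R -> R) : L2_on nu A f -> L2_on nu A g ->
  (N f <= N (f - g)%R + N g)%E.
Proof.
move=> Lf Lg; have [mf _] := (Lfun2P _ _).1 Lf; have [mg _] := (Lfun2P _ _).1 Lg.
have mfg := ((Lfun2P _ _).1 (L2_onB Lf Lg)).1.
have := @minkowski_EFin _ _ _ nu ((f - g) \_ A) (g \_ A) 2 mfg mg ltac:(by rewrite ler1n).
congr (_ <= _)%E; rewrite /Lnorm_on; congr Lnorm; apply/funext => x /=.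
by rewrite restrB /= subrK.
Qed.

Lemma Lnorm_onC (f g : R * R -> R) : N (f - g) = N (g - f).
Proof. by rewrite !Lnorm_on2; congr sqrte; exact: sqint_onC. Qed.

Lemma Lnorm_on_cvg (s : nat -> R * R -> R) (f : R * R -> R) :
  (forall n, L2_on nu A (s n)) -> L2_on nu A f ->
  (fun n => N (s n - f)) @ \oo --> 0%E -> (fun n => N (s n)) @ \oo --> N f.
Proof.
move=> Ls Lf /fine_cvgP[_ h].
rewrite -(fineK (Lnorm_on_fin Lf)); apply/fine_cvgP; split.
  by apply: nearW => n; exact: Lnorm_on_fin.
apply/cvgrPdist_le => e e0.
move/cvgrPdist_le : h => /(_ e e0); apply: filterS => n /=.
have Lsf := L2_onB (Ls n) Lf; have Lfs := L2_onB Lf (Ls n).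
rewrite sub0r normrN ger0_norm; last by apply: fine_ge0; exact: Lnorm_on_ge0.
move=> se; have {}se : fine (N (s n - f)) <= e := se.
have t1 := Lnorm_on_triangle (Ls n) Lf; have t2 := Lnorm_on_triangle Lf (Ls n).
rewrite (Lnorm_onC f) in t2.
rewrite -(fineK (Lnorm_on_fin (Ls n))) -(fineK (Lnorm_on_fin Lf)) -(fineK (Lnorm_on_fin Lsf))
  -EFinD lee_fin in t1 t2.
rewrite -EFinD lee_fin in t2.
by rewrite ler_norml; apply/andP; split; lra.
Qed.

(** A preimage under w |-> g (s w) is a finite union of level sets of s, so norms of simple
    functions are measurable without a sigma-algebra on the function space. *)
Lemma measurable_finite_range (s : Omega -> R * R -> R) (g : (R * R -> R) -> \bar R) :
  finite_set (range s) -> (forall v, measurable (s @^-1` [set v])) ->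
  measurable_fun setT (fun w => g (s w)).
Proof.
move=> fs ms _ B mB; rewrite setTI.
have -> : (fun w => g (s w)) @^-1` B =
    \bigcup_(v in range s `&` [set v | B (g v)]) (s @^-1` [set v]).
  apply/seteqP; split=> [w Bw|w [v [_ Bv] /= sw]] /=; last by rewrite sw.
  by exists (s w) => //; split => //; exists w.
apply: fin_bigcup_measurable => //.
exact: finite_setIl.
Qed.

(** The norm is almost everywhere the limit of norms of simple functions. The upper limit is taken
    because it exists everywhere, and completeness absorbs the exceptional null set. *)
Lemma measurable_bochner_norm q (f : Omega -> R * R -> R) : bochner P (L2_on nu A) N q f ->
  measurable_fun setT (fun w => N (f w)).
Proof.
move=> [Lf [s [fs ms Ls cs]] _].
apply: (@ae_measurable_fun _ _ _ P cP setT (fun w => limn_esup (fun n => N (s n w)))); last first.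
  by apply: measurable_fun_limn_esup => n; exact: measurable_finite_range.
have FF := ae_filter_ringOfSetsType P.
apply: (filterS _ (filterI Lf cs)) => w [Lfw cw] _.
have := Lnorm_on_cvg (fun n => Ls n w) Lfw cw.
by move/cvg_limn_einf_sup => [_ ->].
Qed.

End bochner_measurability.

(** * Hoelder and Minkowski inequalities over the probability space *)

Section hoelder_bochner.
Context d (Omega : measurableType d) (R : realType) (P : probability Omega R).

Import HBNNSimple.

(* [f] need not be measurable: the integral of a nonnegative function is the
   supremum of the integrals of the simple functions below it. *)
Lemma ge0_ae_le_integral_lower (f g : Omega -> \bar R) :
  (forall w, 0 <= f w)%E -> (forall w, 0 <= g w)%E -> measurable_fun setT g ->
  {ae P, forall w, (f w <= g w)%E} -> (\int[P]_w f w <= \int[P]_w g w)%E.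
Proof.
move=> f0 g0 mg fg; rewrite (ge0_integralTE _ f0); apply: ge_ereal_sup => _ [h /= hf <-].
rewrite -integralT_nnsfun; apply: ae_ge0_le_integral => //.
- by move=> w _; rewrite lee_fin.
- exact/measurable_EFinP.
- have FF := ae_filter_ringOfSetsType P.
  by apply: (filterS _ fg) => w fgw _; exact: le_trans (hf w) fgw.
Qed.

Implicit Types x y u v : Omega -> R.

Lemma Lnorm_fin_integral x (p : R) : (forall w, 0 <= x w) ->
  Lnorm P p%:E (EFin \o x) = ((\int[P]_w (x w `^ p)%:E) `^ p^-1)%E.
Proof.
move=> x0; rewrite unlock /Lnorm; congr (poweR _ _); apply: eq_integral => w _.
by rewrite abse_EFin ger0_norm// poweR_EFin.
Qed.

(** Hoelder's inequality with exponents t and n for the r-th powers of x and y, followed by an r-th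
    root. *)
Lemma gen_hoelder x y (r t n : R) : measurable_fun setT x -> measurable_fun setT y ->
  (forall w, 0 <= x w) -> (forall w, 0 <= y w) ->
  0 < r -> 0 < t -> 0 < n -> t^-1 + n^-1 = 1 ->
  (Lnorm P r%:E (EFin \o (fun w => (x w * y w)%R)) <=
   Lnorm P (r * t)%:E (EFin \o x) * Lnorm P (r * n)%:E (EFin \o y))%E.
Proof.
move=> mx my x0 y0 r0 t0 n0 tn.
have mpow (z : Omega -> R) : measurable_fun setT z -> measurable_fun setT (fun w => z w `^ r).
  by move=> mz; exact: (measurableT_comp (measurable_powR r) mz).
have H := hoelder P (mpow _ mx) (mpow _ my) t0 n0 tn.
have E (z : Omega -> R) s : (forall w, 0 <= z w) -> 0 < s ->
    ((Lnorm P s%:E (EFin \o (fun w => (z w `^ r)%R))) `^ r^-1)%E = Lnorm P (r * s)%:E (EFin \o z).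
  move=> z0 s0; rewrite !Lnorm_fin_integral//; last by move=> w; exact: powR_ge0.
  rewrite -poweRrM invfM mulrC; congr (poweR _ _); apply: eq_integral => w _.
  by rewrite powRrM.
have xy0 w : 0 <= x w * y w by rewrite mulr_ge0.
have E1 : Lnorm P r%:E (EFin \o (fun w => (x w * y w)%R)) =
   ((Lnorm P 1%:E (EFin \o ((fun w => (x w `^ r)%R) \* (fun w => (y w `^ r)%R))%R)) `^ r^-1)%E.
  rewrite Lnorm_fin_integral// [in RHS]Lnorm_fin_integral; last first.
    by move=> w; rewrite mulr_ge0// powR_ge0.
  rewrite invr1 poweRe1; last by apply: integral_ge0 => w _; rewrite lee_fin powR_ge0.
  congr (poweR _ _); apply: eq_integral => w _ /=.
  by rewrite powRM// powRr1// mulr_ge0// powR_ge0.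
rewrite E1 -(E x t x0 t0) -(E y n y0 n0) -poweRM ?Lnorm_ge0//.
apply: gt0_ler_poweR H; first by rewrite invr_ge0 ltW.
- by rewrite in_itv/= leey andbT Lnorm_ge0.
- by rewrite in_itv/= leey andbT mule_ge0// Lnorm_ge0.
Qed.

Lemma conjugate_exponents (s : R) : 1 < s -> s^-1 + (s / (s - 1))^-1 = 1.
Proof.
move=> s1; have s0 : 0 < s by apply: lt_trans s1.
by rewrite invf_div -[X in X + _]mul1r -mulrDl addrC subrK divff// gt_eqF.
Qed.

(** Hoelder's inequality against the constant 1, with exponent q / p and its conjugate; the norm of
    1 is 1 since P has total mass 1. *)
Lemma Lnorm_le_exponent y (p q : R) : measurable_fun setT y -> (forall w, 0 <= y w) ->
  0 < p -> p < q -> (Lnorm P p%:E (EFin \o y) <= Lnorm P q%:E (EFin \o y))%E.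
Proof.
move=> my y0 p0 pq; have q0 := lt_trans p0 pq.
have t1 : 1 < q / p by rewrite ltr_pdivlMr// mul1r.
have := @gen_hoelder y (cst 1) p (q / p) (q / p / (q / p - 1)) my (measurable_cst _) y0
   (fun=> ler01) p0.
have -> : p * (q / p) = q by rewrite mulrC divfK// gt_eqF.
have d0 : 0 < q / p - 1 by rewrite subr_gt0.
have -> : EFin \o (fun w => y w * cst 1 w) = EFin \o y.
  by apply/funext => w /=; rewrite mulr1.
move=> /(_ _ _ _)/le_trans; apply.
- by rewrite divr_gt0.
- by rewrite !divr_gt0.
- exact: conjugate_exponents.
rewrite (_ : EFin \o cst 1 = cst 1%E)// Lnorm_cst1.
by rewrite [X in (X `^ _)%E](_ : _ = 1%E) ?poweR1r ?mule1//; exact: probability_setT.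
Qed.

Lemma LnormZ_fin x (c p : R) : measurable_fun setT x -> (forall w, 0 <= x w) ->
  0 <= c -> 0 < p ->
  (Lnorm P p%:E (EFin \o (fun w => (c * x w)%R)) = c%:E * Lnorm P p%:E (EFin \o x))%E.
Proof.
move=> mx x0 c0 p0; rewrite !Lnorm_fin_integral//; last by move=> w; rewrite mulr_ge0.
under eq_integral do rewrite powRM// EFinM.
rewrite ge0_integralZl//.
- rewrite poweRM//; last by apply: integral_ge0 => w _; rewrite lee_fin powR_ge0.
    by rewrite poweR_EFin -powRrM divff ?gt_eqF// powRr1.
  by rewrite lee_fin powR_ge0.
- by apply/measurable_EFinP; exact: (measurableT_comp (measurable_powR p) mx).
- by move=> w _; rewrite lee_fin powR_ge0.
- by rewrite lee_fin powR_ge0.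
Qed.

Lemma Lnorm_fine (X : Omega -> \bar R) (p : R) : measurable_fun setT X -> (forall w, 0 <= X w)%E ->
  {ae P, forall w, X w \is a fin_num} ->
  Lnorm P p%:E (EFin \o (fine \o X)) = ((\int[P]_w (X w `^ p)) `^ p^-1)%E.
Proof.
move=> mX X0 fX; rewrite Lnorm_fin_integral; last by move=> w; exact: fine_ge0.
congr (_ `^ _)%E; apply: ge0_ae_eq_integral => //.
- apply/measurable_EFinP; apply: (measurableT_comp (measurable_powR p)).
  by apply: measurableT_comp => //; exact: measurable_fine.
- exact: (measurableT_comp (measurable_poweR p) mX).
- by move=> w _; rewrite lee_fin powR_ge0.
- by move=> w _; exact: poweR_ge0.
- by apply: filterS fX => w fw _; rewrite -poweR_EFin [((fine \o X) w)%:E]fineK.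
Qed.

(** X keeps the exponent r t; the data factor, at exponent r n, is raised to q, where Minkowski's
    inequality (q >= 1) separates U from V. *)
Lemma bochner_product_le (H X U V : Omega -> \bar R) (c r t n q : R) :
  (forall w, 0 <= H w)%E -> (forall w, 0 <= X w)%E -> (forall w, 0 <= U w)%E -> (forall w, 0 <= V w)%E ->
  measurable_fun setT X -> measurable_fun setT U -> measurable_fun setT V ->
  {ae P, forall w, [/\ X w \is a fin_num, U w \is a fin_num, V w \is a fin_num &
     (H w <= c%:E * (U w + V w) * X w)%E]} ->
  0 <= c -> 0 < r -> 1 < t -> n = t / (t - 1) -> r * n < q -> 1 <= q ->
  ((\int[P]_w (H w `^ r)) `^ r^-1 <=
   c%:E * ((\int[P]_w (U w `^ q)) `^ q^-1 + (\int[P]_w (V w `^ q)) `^ q^-1) *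
    (\int[P]_w (X w `^ (r * t))) `^ (r * t)^-1)%E.
Proof.
move=> H0 X0 U0 V0 mX mU mV hae c0 r0 t1 nE rnq q1.
have t0 : 0 < t by apply: lt_trans t1.
have n0 : 0 < n by rewrite nE divr_gt0// subr_gt0.
have FF := ae_filter_ringOfSetsType P.
have fX : {ae P, forall w, X w \is a fin_num} by apply: (filterS _ hae) => w [].
have fU : {ae P, forall w, U w \is a fin_num} by apply: (filterS _ hae) => w [].
have fV : {ae P, forall w, V w \is a fin_num} by apply: (filterS _ hae) => w [].
pose x := fine \o X; pose u := fine \o U; pose v := fine \o V.
have x0 w : 0 <= x w by exact: fine_ge0.
have u0 w : 0 <= u w by exact: fine_ge0.
have v0 w : 0 <= v w by exact: fine_ge0.
have mfin Z : measurable_fun setT Z -> measurable_fun setT (fine \o Z : Omega -> R).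
  by move=> mZ; apply: measurableT_comp => //; exact: measurable_fine.
have mx := mfin _ mX; have mu := mfin _ mU; have mv := mfin _ mV.
pose y w := c * (u w + v w).
have y0 w : 0 <= y w by rewrite mulr_ge0// addr_ge0.
have my : measurable_fun setT y by apply: measurable_funM => //; exact: measurable_funD.
have step1 : ((\int[P]_w (H w `^ r)) `^ r^-1 <= Lnorm P r%:E (EFin \o (fun w => (x w * y w)%R)))%E.
  rewrite Lnorm_fin_integral; last by move=> w; rewrite mulr_ge0.
  apply: gt0_ler_poweR; first by rewrite invr_ge0 ltW.
  - by rewrite in_itv/= leey andbT; apply: integral_ge0 => w _; exact: poweR_ge0.
  - by rewrite in_itv/= leey andbT; apply: integral_ge0 => w _; rewrite lee_fin powR_ge0.
  (* H is the norm of the difference of the solutions, not known to be measurable; its integral is a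
     supremum over simple functions. *)
  apply: ge0_ae_le_integral_lower.
  - by move=> w; exact: poweR_ge0.
  - by move=> w; rewrite lee_fin powR_ge0.
  - apply/measurable_EFinP; apply: (measurableT_comp (measurable_powR r)).
    exact: measurable_funM.
  apply: (filterS _ hae) => w [fx fu fv Hw]; rewrite -poweR_EFin.
  apply: gt0_ler_poweR; first exact: ltW.
  - by rewrite in_itv/= leey andbT.
  - by rewrite in_itv/= leey andbT lee_fin mulr_ge0.
  by apply: le_trans Hw _; rewrite -(fineK fx) -(fineK fu) -(fineK fv) -EFinD -!EFinM lee_fin mulrC.
apply: le_trans step1 _.
have tn : t^-1 + n^-1 = 1 by rewrite nE conjugate_exponents.
apply: le_trans (gen_hoelder mx my x0 y0 r0 t0 n0 tn) _.
rewrite (Lnorm_fine _ mX X0 fX) muleC; apply: lee_wpmul2r; first exact: poweR_ge0.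
apply: le_trans (Lnorm_le_exponent my y0 (mulr_gt0 r0 n0) rnq) _.
have q0 : 0 < q by apply: lt_le_trans q1.
have uv0 w : 0 <= u w + v w by rewrite addr_ge0.
rewrite (LnormZ_fin (measurable_funD mu mv) uv0 c0 q0); apply: lee_wpmul2l; first by rewrite lee_fin.
rewrite -(Lnorm_fine _ mU U0 fU) -(Lnorm_fine _ mV V0 fV).
exact: (minkowski_EFin P mu mv q1).
Qed.

End hoelder_bochner.

(** * From squared norms to the final estimate *)

Section pathwise_norms.
Context {R : realType}.
Notation T2 := (measurableTypeR R * measurableTypeR R)%type.
Variables (D : R) (Gamma1 Gamma2 : set (R * R)).
Hypothesis D0 : 0 < D.
Hypothesis hGamma : boundary_decomposition D Gamma1 Gamma2.
Variable CP : R.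
Hypothesis CP0 : 0 <= CP.
Hypothesis HCP : forall u, Vspace D Gamma1 u ->
    (sqint_on leb2 (osquare D : set T2) u.1 <= CP%:E * gradsq D u)%E.
Notation Q := (osquare D).

(** Square root of the constant of [pathwise_le] without its factor X^2: one 1 / m comes from
    comparing grad w with grad u, the other from the energy bound on grad u. *)
Definition Cpath (m : R) : R := Num.sqrt ((CP + 1) * Cweak D CP) / m ^+ 2.

Lemma Cpath_ge0 m : 0 <= Cpath m.
Proof. by rewrite /Cpath divr_ge0 ?sqrtr_ge0 ?sqr_ge0. Qed.

Lemma H1norm_le (a b f g : R * R -> R) (m M : R) (u v : sobolev) : 0 < m ->
  measurable_fun (Q : set T2) (a : T2 -> R) ->
  measurable_fun (Q : set T2) (b : T2 -> R) ->
  (forall x, Q x -> m <= a x <= M) -> (forall x, Q x -> m <= b x <= M) ->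
  Lnorm_on leb2 Q +oo%E (fun x => a x - b x) \is a fin_num ->
  L2_on leb2 Q f -> L2_on (surf D) Gamma2 g ->
  weak_solution D Gamma1 Gamma2 a f g u -> weak_solution D Gamma1 Gamma2 b f g v ->
  (H1norm D (u - v)%R <= (Cpath m)%:E *
    (Lnorm_on leb2 Q 2%:E f + Lnorm_on (surf D) Gamma2 2%:E g) *
    Lnorm_on leb2 Q +oo%E (fun x => (a x - b x)%R))%E.
Proof.
move=> m0 ma mb aM bM Xfin Lf Lg su sv; have [G12 _ _ _ _] := hGamma.
have G1B : Gamma1 `<=` bsquare D by rewrite -G12; exact: subsetUl.
have G2B : Gamma2 `<=` bsquare D by rewrite -G12; exact: subsetUr.
set X := Lnorm_on leb2 Q +oo%E _ in Xfin *.
have X0 : 0 <= fine X by apply: fine_ge0; exact: Lnorm_on_ge0.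
have abX : {ae leb2, forall x, Q x -> `|a x - b x| <= fine X}.
  by apply: (Lnorm_on_bound D0); rewrite fineK.
have h := pathwise_le D0 G1B G2B CP0 HCP m0 X0 ma mb aM bM abX Lf Lg su sv.
have nf_fin : sqint_on leb2 (Q : set T2) f \is a fin_num.
  by have := Lnorm_on_fin Lf; rewrite Lnorm_on2 sqrte_fin_num// sqint_on_ge0.
have ng_fin : sqint_on (surf D) (Gamma2 : set T2) g \is a fin_num.
  by have := Lnorm_on_fin Lg; rewrite Lnorm_on2 sqrte_fin_num// sqint_on_ge0.
rewrite H1norm_sqrte !Lnorm_on2 -(fineK Xfin) -(fineK nf_fin) -(fineK ng_fin).
have f0 : 0 <= fine (sqint_on leb2 (Q : set T2) f) by apply: fine_ge0; exact: sqint_on_ge0.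
have g0 : 0 <= fine (sqint_on (surf D) (Gamma2 : set T2) g) by apply: fine_ge0; exact: sqint_on_ge0.
move: h; set nf := fine _ in f0 *; set ng := fine _ in g0 * => h.
set xx := fine X in X0 h *.
rewrite [sqrte nf%:E]/= [sqrte ng%:E]/= -EFinD -!EFinM.
set z := Cpath m * _ * xx.
have z0 : 0 <= z.
  apply: mulr_ge0 => //; apply: mulr_ge0; first exact: Cpath_ge0.
  by apply: addr_ge0; exact: sqrtr_ge0.
rewrite -(ger0_norm z0) -sqrtr_sqr -[leRHS]/(sqrte (z ^+ 2)%:E) lee_sqrt ?lee_fin ?sqr_ge0//.
apply: le_trans h _; rewrite lee_fin.
have CW0 : 0 <= (CP + 1) * Cweak D CP.
  by apply: mulr_ge0; [exact: addr_ge0|apply: ltW; exact: Cweak_gt0].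
have -> : z ^+ 2 = (CP + 1) * (xx ^+ 2 / m ^+ 2) * (Cweak D CP / m ^+ 2) *
    (Num.sqrt nf + Num.sqrt ng) ^+ 2.
  rewrite /z /Cpath !exprMn sqr_sqrtr// -exprVn; field; rewrite gt_eqF//.
apply: ler_wpM2l.
  have CW1 : 0 <= Cweak D CP by apply: ltW; exact: Cweak_gt0.
  apply: mulr_ge0; last exact: divr_ge0 CW1 (sqr_ge0 _).
  by apply: mulr_ge0; [exact: addr_ge0|exact: divr_ge0 (sqr_ge0 _) (sqr_ge0 _)].
(* Separates the data norms: nf + ng <= (sqrt nf + sqrt ng)^2. *)
rewrite sqrrD !sqr_sqrtr//.
have : 0 <= Num.sqrt nf * Num.sqrt ng by rewrite mulr_ge0 ?sqrtr_ge0.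
lra.
Qed.

End pathwise_norms.

Unset Implicit Arguments.
Set Strict Implicit.
Set Printing Implicit Defensive.

Theorem theorem5p3 (R : realType) (D : R) (Gamma1 Gamma2 : set (R * R))
    (D_gt0 : 0 < D) (hGamma : boundary_decomposition D Gamma1 Gamma2) :
  exists C : R -> R -> R,
  forall (d : measure_display) (Omega : measurableType d)
    (P : probability Omega R) (hP : measure_is_complete P)
    (K A : R) (hK : 0 < K) (hA : 0 < A)
    (abar : R * R -> R) (am ap : R) (Phi1 Phi2 : R -> R)
    (W1 W2 : R * R -> Omega -> R) (l1 l2 : R -> Omega -> R)
    (gamma1 gamma2 : R)
    (nu1 nu2 : {measure set (measurableTypeR R) -> \bar R})
    (hW : fields_assumption P D K W1 W2)
    (hPhi : Phi_assumption Phi1 Phi2)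
    (habar : abar_assumption D abar am ap)
    (hl : levy_assumption P D K W1 W2 l1 l2 gamma1 gamma2 nu1 nu2)
    (q : R) (hq : 1 <= q)
    (f g : Omega -> R * R -> R)
    (hf : bochner P (L2_on leb2 (osquare D))
            (Lnorm_on leb2 (osquare D) 2%:E) q f)
    (hg : bochner P (L2_on (surf D) Gamma2)
            (Lnorm_on (surf D) Gamma2 2%:E) q g)
    (uK uKA : Omega -> sobolev)
    (huK : {ae P, forall w, weak_solution D Gamma1 Gamma2
              (a_K abar Phi1 Phi2 W1 W2 l1 l2 K w) (f w) (g w) (uK w)})
    (huKA : {ae P, forall w, weak_solution D Gamma1 Gamma2
              (a_KA abar Phi1 Phi2 W1 W2 l1 l2 K A w) (f w) (g w) (uKA w)})
    (t n : R) (ht : 1 < t) (hn : n = t / (t - 1))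
    (r : R) (hr : 1 <= r < q / n),
  (bochner_norm P (H1norm D) r (fun w => uK w - uKA w)%R <=
   (C (chi A am) r)%:E *
   (bochner_norm P (Lnorm_on leb2 (osquare D) 2%:E) q f +
    bochner_norm P (Lnorm_on (surf D) Gamma2 2%:E) q g) *
   (\int[P]_w
      (Lnorm_on leb2 (osquare D) +oo
         (fun x => a_K abar Phi1 Phi2 W1 W2 l1 l2 K w x -
                   a_KA abar Phi1 Phi2 W1 W2 l1 l2 K A w x)%R
       `^ (r * t))) `^ (r * t)^-1)%E.
Proof.
have [CP CP0 HCP] := poincare_V D_gt0 hGamma.
(* [CP] is determined by D and Gamma1; the constant is evaluated at m = [chi A am], a common lower
   bound of both coefficients. *)
exists (fun m _ => Cpath D CP m).
move=> d Omega P hP K A hK hA abar am ap Phi1 Phi2 W1 W2 l1 l2 gamma1 gamma2 nu1 nu2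
  hW hPhi habar hl q hq f g hf hg uK uKA huK huKA t n ht hn r /andP[r1 rqn].
have r0 : 0 < r by apply: lt_le_trans r1.
have n0 : 0 < n by rewrite hn divr_gt0 ?subr_gt0// (lt_trans _ ht).
have [am0 _ _ _] := habar.
have m0 : 0 < chi A am by rewrite /chi lt_min am0 hA.
have [Lf _ _] := hf; have [Lg _ _] := hg.
apply: (bochner_product_le (H := fun w => H1norm D (uK w - uKA w)) (n := n)) => //.
- by move=> w; exact: poweR_ge0.
- by move=> w; exact: Lnorm_on_ge0.
- by move=> w; exact: Lnorm_on_ge0.
- by move=> w; exact: Lnorm_on_ge0.
- exact: (measurable_truncation_error hP A D_gt0 hK hW hPhi habar hl).
- exact: (measurable_bochner_norm hP hf).
- exact: (measurable_bochner_norm hP hg).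
- have FF := ae_filter_ringOfSetsType P.
  apply: (filterS _ (filterI (ae_good_path hW hl) (filterI (filterI Lf Lg) (filterI huK huKA)))).
  move=> w [gw [[Lfw Lgw] [sK sKA]]].
  have [ma [M aM] _] := good_path_coef D_gt0 hK hPhi habar gw.
  have Xfin : Lnorm_on leb2 (osquare D) +oo%E (fun x => a_K abar Phi1 Phi2 W1 W2 l1 l2 K w x -
      a_KA abar Phi1 Phi2 W1 W2 l1 l2 K A w x) \is a fin_num.
    rewrite ge0_fin_numE ?Lnorm_on_ge0//.
    apply: le_lt_trans (@Lnorm_on_le _ _ D_gt0 _ `|M| (normr_ge0 _) _) (ltry _).
    move=> x Qx; have /andP[a1 a2] := aM _ Qx.
    rewrite ger0_norm ?truncation_error_ge0//; apply: le_trans (ler_norm _).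
    (* Hence the truncation error lies between 0 and M on the square, so its essential supremum is
       finite on each good path. *)
    have : 0 <= a_KA abar Phi1 Phi2 W1 W2 l1 l2 K A w x.
      by rewrite /a_KA /chi le_min (ltW hA) andbT (le_trans (ltW am0) a1).
    lra.
  split; [exact: Xfin|exact: Lnorm_on_fin|exact: Lnorm_on_fin|].
  apply: (H1norm_le D_gt0 hGamma CP0 HCP m0 (M := M)) => //.
  + by apply: measurable_minr => //; exact: measurable_cst.
  + by move=> x Qx; have /andP[a1 a2] := aM _ Qx; rewrite a2 andbT /chi ge_min a1.
  + move=> x Qx; have /andP[a1 a2] := aM _ Qx; apply/andP; split.
      by rewrite /a_KA /chi le_min !ge_min a1 lexx orbT.
    by rewrite /a_KA /chi ge_min a2.
- exact: Cpath_ge0.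
- by rewrite -ltr_pdivlMr.
Qed.
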